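(* Let $(g_p)_{p\text{ prime}}$ be independent standard normal random variables. There exists a function $R(x)$, with $R(x)=O\bigl((\log\log\log x)^{3/4}\bigr)$ as $x\to\infty$, such that, as $x\to\infty$, $$\mathbb{P}\Biggl(\sup_{1\le t\le 2(\log\log x)^2}\ \sum_{p\le x}g_p\,\frac{\cos(t\log p)}{p^{1/2+1/\log x}}\ \le\ \log\log x-\log\log\log x+R(x)\Biggr)=O\bigl((\log\log\log x)^{-1/2}\bigr).$$
   Context: The sum is over prime numbers $p\le x$, and the supremum is over real $t$ in the stated interval. *)

(* Defs.v *)
From HB Require Import structures.
From mathcomp Require Import all_boot all_order all_algebra finmap.
From mathcomp Require Import all_classical all_reals all_analysis.

Set Implicit Arguments.
Unset Strict Implicit.
Unset Printing Implicit Defensive.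

Import Order.TTheory GRing.Theory Num.Theory.
Import numFieldNormedType.Exports.

Local Open Scope classical_set_scope.
Local Open Scope ring_scope.

(* Lets the Landau notations take x --> +oo as their filter. *)
Canonical pinfty_nbhs_filter_on (R : numFieldType) : filter_on R :=
  FilterType (pinfty_nbhs R) _.

(* Mutual independence of the subfamily of X indexed by D: the product rule
   holds on every finite set J of indices in D. *)
Definition mutually_independent d (T : measurableType d) (R : realType)
    (P : probability T R) (I : choiceType) (D : set I)
    (X : I -> {RV P >-> R}) : Prop :=
  forall (J : {fset I}) (B : I -> set R),
    [set` J] `<=` D ->
    (forall i, i \in J -> measurable (B i)) ->
    P (\bigcap_(i in [set` J]) (X i @^-1` B i)) =
    (\prod_(i <- J) P (X i @^-1` B i))%E.

(* Equality of laws is only required on Borel sets: a measure is a function on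
   all sets, with unspecified values on the non-measurable ones. *)
Definition standard_normal d (T : measurableType d) (R : realType)
    (P : probability T R) (X : {RV P >-> R}) : Prop :=
  forall A : set R, measurable A ->
    distribution P X A = normal_prob (0 : R) 1 A.

Definition loglog (R : realType) (x : R) : R := ln (ln x).

Definition logloglog (R : realType) (x : R) : R := ln (ln (ln x)).

(* For x >= 0, the primes p <= Num.truncn x are the primes p with p%:R <= x. *)
Definition random_prime_sum d (T : measurableType d) (R : realType)
    (P : probability T R) (g : nat -> {RV P >-> R}) (x t : R) (w : T) : R :=
  \sum_(0 <= p < (Num.truncn x).+1 | prime p)
    g p w * (cos (t * ln p%:R) / p%:R `^ (1 / 2 + 1 / ln x)).

(* Main.v *)
(* Put Y = loglog x, y = log Y, H = y^(3/4), s = 2 / log x, and let F(u) be the sum over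
   primes p <= x of cos (u log p) / p^(1+s), so that the process X_t has covariance
   (F(t-u) + F(t+u)) / 2.  Up to O(1), F(u) is log |zeta(1+s+iu)|, read off from partial
   sums of the Dirichlet series and the Euler product; hence F(u) <= log (1/|u|) + O(log y)
   for small u, and F(2t) >= -O(log y) by the 3-4-1 inequality, which gives
   Var X_t >= V := (Y - H) / 2.  After scaling every X_t down to variance V, Slepian's
   inequality, applied to the smooth functional exp (- sum_t exp (beta (X_t - c))), compares X
   with about Y^2 independent binary branching random walks with Gaussian steps of
   variance (log 2) / 2 and depth K ~ (Y - y - 3H) / log 2, all shifted by one common
   Gaussian of variance s0^2 = V - K (log 2) / 2, which is about y / 2.
   One tree exceeds K log 2 with probability at least a constant times K^(-3/2), by a
   subsolution of the recursion over generations built on the ballot-type barrier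
   z exp (- 2z - z^2 / (2 p^2)) / p^3; so the Y^2 trees all fail with probability at most
   exp (- const * sqrt Y), while the common shift is below -H with probability at most
   exp (- H^2 / (2 s0^2)) <= 4 / sqrt y. *)
Require Import Defs.
From HB Require Import structures.
From mathcomp Require Import all_boot all_order all_algebra finmap complex.
From mathcomp Require Import all_classical all_reals all_analysis.
From mathcomp Require Import measurable_realfun.
From mathcomp Require Import ring lra.

Set Implicit Arguments.
Unset Strict Implicit.
Unset Printing Implicit Defensive.

Import Order.TTheory GRing.Theory Num.Theory.
Import numFieldNormedType.Exports.

Local Open Scope classical_set_scope.
Local Open Scope ring_scope.

(** * Gaussian integrals *)

(** The loss [y] in the depth comes from the geometry of the leaves. A tree of depth K squeezed into
    an interval of length 1 guarantees leaves that share m generations only a distance 2^(-m) / K,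
    so log (1/|t-u|) may exceed m log 2 by log K <= y + 1. This excess is put into the common
    Gaussian; the other errors are O(log y) and disappear in H. The main obstacle is the lower bound
    for Var X_t. At abscissa 1 + s the 3-4-1 inequality loses (3/4) log (1/s), which is of the order
    of Y itself. It is therefore applied at 1 + eta, with eta a fixed power of a constant over 1 +
    log (1 + 2t), where the loss is only O(log y); a Lipschitz estimate on partial sums then moves
    the zeta sum from eta to s. Neither analytic continuation nor the derivative of zeta is needed.
    Expectations over finitely many independent Gaussians are iterated one-dimensional integrals
    ([gavgs]) of functionals of plain functions. The given random variables enter through
    [law_gavgs], and the interpolation behind Slepian's inequality becomes a succession of short
    steps. *)

Section gauss.
Variable R : realType.
Local Notation mu := (@lebesgue_measure R).
Local Notation gam := (normal_prob (0 : R) 1).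
Local Notation phi := (normal_pdf (0 : R) 1).

Import HBNNSimple.

Lemma gauss_pdfE (x : R) : phi x = normal_peak 1 * expR (- (x ^+ 2 / 2)).
Proof.
by rewrite normal_pdfE ?oner_eq0//= /normal_fun subr0 expr1n mulNr.
Qed.

Let mphi : measurable_fun setT (EFin \o phi).
Proof. by apply/measurable_EFinP; exact: measurable_normal_pdf. Qed.

Let integral_gauss_nnsfun (f : {nnsfun _ >-> R}) :
  (\int[gam]_x (f x)%:E = \int[mu]_x ((f x)%:E * (phi x)%:E))%E.
Proof.
under [LHS]eq_integral do rewrite fimfunE -fsumEFin//.
rewrite [LHS]ge0_integral_fsum//; last 2 first.
  - by move=> r; exact/measurable_EFinP/measurableT_comp.
  - by move=> n x _; rewrite EFinM nnfun_muleindic_ge0.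
under [RHS]eq_integral.
  move=> x xD; rewrite fimfunE -fsumEFin// muleC ge0_mule_fsumr; last first.
    by move=> r; rewrite EFinM nnfun_muleindic_ge0.
  over.
rewrite [RHS]ge0_integral_fsum//; last 2 first.
  - move=> r; apply: emeasurable_funM => //; apply/measurable_EFinP.
    by do 2 apply/measurableT_comp => //.
  - move=> n x _; rewrite mule_ge0//; last by rewrite EFinM nnfun_muleindic_ge0.
    by rewrite lee_fin normal_pdf_ge0.
apply: eq_fsbigr => r _.
rewrite integralZl_indic_nnsfun//= integral_indic// setIT.
have [r0|r0] := boolP (0 <= r).
  under [RHS]eq_integral do rewrite EFinM muleCA.
  rewrite ge0_integralZl//; last 2 first.
  - apply: emeasurable_funM => //; exact/measurable_EFinP.
  - by move=> x _; rewrite mule_ge0// lee_fin normal_pdf_ge0.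
  congr (_ * _)%E; rewrite /= /normal_prob [LHS]integral_mkcond; apply: eq_integral => x _.
  rewrite /patch/= indicE; case: ifP => /=; by rewrite ?mule1 ?mule0.
have -> : f @^-1` [set r] = set0.
  rewrite -subset0 => x /= fx; move: r0; rewrite -fx; by rewrite fun_ge0.
rewrite measure0 mule0 integral0_eq// => x _.
by rewrite indicE in_set0 mulr0 mule0.
Qed.

Let ge0_integral_gauss_ (f : _ -> \bar R) :
  measurable_fun setT f -> (forall x, 0 <= f x)%E ->
  (\int[gam]_x f x = \int[mu]_x (f x * (phi x)%:E))%E.
Proof.
move=> mf f0; pose f_ := nnsfun_approx measurableT mf.
transitivity (lim (\int[gam]_x (f_ n x)%:E @[n --> \oo])%E).
  rewrite -monotone_convergence//=.
  - apply: eq_integral => ? /[!inE] xD; apply/esym/cvg_lim => //=.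
    exact: cvg_nnsfun_approx.
  - by move=> n; exact/measurable_EFinP/measurable_funTS.
  - by move=> n ? _; rewrite lee_fin.
  - by move=> ? _ ? ? mn; rewrite lee_fin; exact/lefP/nd_nnsfun_approx.
rewrite [RHS](_ : _ = lim
    (\int[mu]_x ((f_ n x)%:E * (phi x)%:E) @[n --> \oo])%E); last first.
  rewrite -monotone_convergence//=.
  - apply: eq_integral => x /[!inE] xD; apply/esym/cvg_lim => //=.
    by apply: cvgeZr => //; exact: cvg_nnsfun_approx.
  - move=> n; apply: emeasurable_funM => //; exact/measurable_EFinP.
  - by move=> n x _; rewrite mule_ge0// lee_fin// normal_pdf_ge0.
  - move=> x _ a b ab; rewrite lee_wpmul2r ?lee_fin ?normal_pdf_ge0//.
    exact/lefP/nd_nnsfun_approx.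
by apply: congr_lim; apply/funext => n /=; exact: integral_gauss_nnsfun.
Qed.

Lemma ge0_integral_gauss (f : R -> \bar R) :
  measurable_fun [set: R] f -> (forall x, 0 <= f x)%E ->
  (\int[gam]_x f x = \int[mu]_x (f x * (phi x)%:E))%E.
Proof. by move=> mf f0; rewrite ge0_integral_gauss_. Qed.

Lemma ge0_integral_affine (a b : R) (f : R -> R) : 0 < b ->
  continuous f -> (forall x, 0 <= f x) ->
  (\int[mu]_x (f x)%:E = \int[mu]_x (f (a + b * x) * b)%:E)%E.
Proof.
move=> b0 cf f0.
pose F (x : R^o) : R^o := a + b * x.
have dF (x : R) : is_derive (x : R^o) (1 : R^o) F b.
  rewrite /F; apply: is_derive_eq; by rewrite add0r mul1r; exact: mulr1.
have F'E : F^`()%classic = cst b.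
  by apply/funext => x; rewrite derive1E derive_val.
rewrite (@increasing_ge0_integration_by_substitutionT R F f)//.
- by apply: eq_integral => x _; rewrite F'E.
- by move=> x y xy; rewrite /F ltrD2l ltr_pM2l.
- by rewrite F'E => ?; exact: cvg_cst.
- by rewrite F'E; exact: is_cvg_cst.
- by rewrite F'E; exact: is_cvg_cst.
- apply/cvgrNyPle => A; exists ((A - a) / b); split; first exact: num_real.
  by move=> x; rewrite ltr_pdivlMr// /F => /ltW; lra.
- apply/cvgryPge => A; exists ((A - a) / b); split; first exact: num_real.
  by move=> x; rewrite ltr_pdivrMr// /F => /ltW; lra.
Qed.

End gauss.

(** * Moments of the standard normal law *)

Section gauss_moments.
Variable R : realType.
Local Notation mu := (@lebesgue_measure R).
Local Notation gam := (normal_prob (0 : R) 1).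
Local Notation phi := (normal_pdf (0 : R) 1).
Local Notation gint f := (gam.-integrable setT (EFin \o f)).

Lemma measurable_EFin d (T : measurableType d) (f : T -> R) :
  measurable_fun setT f -> measurable_fun setT (fun x => (f x)%:E).
Proof. by move=> mf; have /measurable_EFinP := mf. Qed.

Lemma continuous_gauss_pdf : continuous phi.
Proof. exact/continuous_normal_pdf/oner_neq0. Qed.

Lemma gauss_affine (a b : R) (f : R -> R) : 0 < b ->
  continuous f -> (forall x, 0 <= f x) ->
  (\int[gam]_x (f x)%:E =
   \int[mu]_x (f (a + b * x) * phi (a + b * x) * b)%:E)%E.
Proof.
move=> b0 cf f0; have mf := measurable_EFin (continuous_measurable_fun cf).
rewrite ge0_integral_gauss//.
under eq_integral do rewrite -EFinM.
rewrite (@ge0_integral_affine _ a b (fun x => f x * phi x))//.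
- move=> x; apply: continuousM; [exact: cf|exact: continuous_gauss_pdf].
- by move=> x; rewrite mulr_ge0// normal_pdf_ge0.
Qed.

Lemma gauss_exp (l : R) :
  (\int[gam]_x (expR (l * x))%:E = (expR (l ^+ 2 / 2))%:E)%E.
Proof.
rewrite (@gauss_affine l 1)//; last first.
  move=> x; apply: (@continuous_comp _ _ _ (fun x => l * x) expR).
    exact: mulrl_continuous.
  exact: continuous_expR.
transitivity (\int[mu]_x ((expR (l ^+ 2 / 2))%:E * (phi x)%:E))%E.
  apply: eq_integral => x _; rewrite -EFinM; congr EFin.
  rewrite !gauss_pdfE mulr1 mul1r mulrCA [RHS]mulrCA; congr (_ * _).
  by rewrite -!expRD; congr expR; field.
rewrite ge0_integralZl//.
- by rewrite integral_normal_pdf mule1.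
- exact: (measurable_EFin (measurable_normal_pdf _ _)).
- by move=> x _; rewrite lee_fin normal_pdf_ge0.
Qed.

Lemma gint_exp (l : R) : gint (fun x => expR (l * x)).
Proof.
apply/integrableP; split.
  apply/measurable_EFinP; apply: continuous_measurable_fun.
  move=> x; apply: (@continuous_comp _ _ _ (fun x => l * x) expR).
    exact: mulrl_continuous.
  exact: continuous_expR.
under eq_integral do rewrite /= ger0_norm ?expR_ge0//.
by rewrite gauss_exp ltry.
Qed.

Lemma gE_exp (l : R) : \int[gam]_x expR (l * x) = expR (l ^+ 2 / 2).
Proof. by rewrite /Rintegral gauss_exp. Qed.

Lemma gint_le (f g : R -> R) : measurable_fun setT f ->
  (forall x, `|f x| <= g x) -> gint g -> gint f.
Proof.
move=> mf fg ig; apply: (le_integrable _ _ _ ig) => //.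
  exact/measurable_EFinP.
by move=> x _ /=; rewrite lee_fin (le_trans (fg x))// ler_norm.
Qed.

Lemma gint_cst (c : R) : gint (fun=> c).
Proof. exact: finite_measure_integrable_cst. Qed.

Lemma gint_bounded (f : R -> R) (M : R) : measurable_fun setT f ->
  (forall x, `|f x| <= M) -> gint f.
Proof. by move=> mf fM; apply: (gint_le mf fM); exact: gint_cst. Qed.

Lemma gintD (f g : R -> R) : gint f -> gint g -> gint (fun x => f x + g x).
Proof.
move=> fi gi; apply: (@eq_integrable _ _ _ _ _ _ _ _ _ (integrableD _ fi gi)) => //.
Qed.

Lemma gintZ (c : R) (f : R -> R) : gint f -> gint (fun x => c * f x).
Proof.
move=> fi; apply: (@eq_integrable _ _ _ _ _ _ _ _ _ (integrableZl _ c fi)) => //.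
Qed.

Lemma gE_cst (c : R) : \int[gam]_x c = c.
Proof.
rewrite Rintegral_cst// -[RHS]mulr1; congr (_ * _).
exact: (congr1 fine (@probability_setT _ _ _ gam)).
Qed.

Lemma gint_cube : gint (fun x => `|x| ^+ 3).
Proof.
apply: (@gint_le _ (fun x => 6 * (expR (1 * x) + expR (-1 * x)))).
- by apply: measurable_funX; exact: normr_measurable.
- move=> x; rewrite ger0_norm ?exprn_ge0//.
  have : `|x| ^+ 3 / 6 <= expR `|x|.
    apply: le_trans (@expR_ge1Dxn R `|x| 2 (normr_ge0 _)).
    by rewrite lerDr.
  have : expR `|x| <= expR (1 * x) + expR (-1 * x).
    rewrite mul1r mulN1r; case: (ger0P x) => _.
      by rewrite lerDl expR_ge0.
    by rewrite lerDr expR_ge0.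
  lra.
- by apply: gintZ; apply: gintD; exact: gint_exp.
Qed.

Lemma gint_id : gint (fun x => x).
Proof.
apply: (@gint_le _ (fun x => 1 + `|x| ^+ 3)).
- exact: measurable_id.
- move=> x; have := normr_ge0 x; set y := `|x| => y0.
  have [y1|y1] := leP y 1; first by rewrite (le_trans y1)// lerDl exprn_ge0.
  rewrite (@le_trans _ _ (y ^+ 3))// ?lerDr// -[leLHS]expr1 ler_weXn2l//.
  exact: ltW.
- by apply: gintD; [exact: gint_cst|exact: gint_cube].
Qed.

(** Integrating [1 + l x <= exp (l x)] gives [l m <= exp (l^2 / 2) - 1 <= l^2] for the mean [m] and
    every small [l] of either sign; hence [|m| <= |l|]. The mean is thus read off the exponential
    moments. *)
Lemma gE_id : \int[gam]_x x = 0.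
Proof.
have key (l : R) : l * (\int[gam]_x x) <= expR (l ^+ 2 / 2) - 1.
  rewrite -RintegralZl//; last exact: gint_id.
  rewrite -gE_exp -[X in _ - X](gE_cst 1) -RintegralB//; last 2 first.
  - exact: gint_exp.
  - exact: gint_cst.
  apply: le_Rintegral => //.
  - by apply: gintZ; exact: gint_id.
  - apply: (@eq_integrable _ _ _ _ _ _ _ _ _ (integrableB _ (gint_exp l) (gint_cst 1))) => //.
  - by move=> x _; rewrite lerBrDl expR_ge1Dx.
have small (l : R) : 0 < l -> l <= 1 -> expR (l ^+ 2 / 2) - 1 <= l ^+ 2.
  move=> l0 l1; set y := l ^+ 2 / 2.
  have y0 : 0 <= y by rewrite /y; nra.
  have y1 : y <= 1 / 2.
    by rewrite /y; nra.
  have := expR_ge1Dx (- y); rewrite expRN => h.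
  have e0 := expR_gt0 y.
  have h2 : (1 - y) * expR y <= 1.
    by rewrite -ler_pdivlMr// mul1r.
  have -> : l ^+ 2 = 2 * y by rewrite /y; field.
  have : expR y <= 1 + 2 * y by nra.
  lra.
set m := \int[gam]_x x.
apply/eqP; rewrite -normr_le0; apply/ler_addgt0Pl => e e0; rewrite addr0.
pose l := Num.min e 1.
have l0 : 0 < l by rewrite lt_min e0 ltr01.
have l1 : l <= 1 by rewrite ge_min lexx orbT.
have le : l <= e by rewrite ge_min lexx.
apply: (le_trans _ le); rewrite ler_norml.
have k1 := key l; have k2 := key (- l); have s := small _ l0 l1.
rewrite -/m sqrrN in k1 k2.
by apply/andP; split; nra.
Qed.

End gauss_moments.

(** * Stability of the normal law under normalised sums *)

Section gauss_conv.
Variable R : realType.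
Local Notation mu := (@lebesgue_measure R).
Local Notation gam := (normal_prob (0 : R) 1).
Local Notation phi := (normal_pdf (0 : R) 1).
Local Notation gint f := (gam.-integrable setT (EFin \o f)).

Let measurable_gauss_pdf : measurable_fun [set: R] phi.
Proof. exact: measurable_normal_pdf. Qed.

(** The substitution [z = c y + c x] is a rotation by 45 degrees: the two densities become [phi y]
    and [phi x], and the constants multiply to [2 c^2 = 1]. *)
Let conv_pdf (c y : R) : 0 < c -> 2 * c ^+ 2 = 1 ->
  (\int[mu]_z (phi (- z + 2 * c * y) * (2 * c) * phi z)%:E = (phi y)%:E)%E.
Proof.
move=> c0 c2.
have cG : continuous (fun z : R => phi (- z + 2 * c * y) * (2 * c) * phi z).
  move=> z; apply: cvgM; last exact: continuous_gauss_pdf.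
  apply: cvgM; last exact: cvg_cst.
  apply: (@continuous_comp _ _ _ (fun z : R => - z + 2 * c * y) phi).
    by apply: cvgD; [exact: opp_continuous|exact: cvg_cst].
  exact: continuous_gauss_pdf.
rewrite (@ge0_integral_affine _ (c * y) c)//; last first.
  by move=> z; rewrite !mulr_ge0// ?normal_pdf_ge0// ltW.
transitivity (\int[mu]_x ((phi y)%:E * (phi x)%:E))%E.
  apply: eq_integral => x _; rewrite -EFinM; congr EFin.
  rewrite !gauss_pdfE.
  set k := normal_peak 1.
  have -> : - (c * y + c * x) + 2 * c * y = c * (y - x) by ring.
  rewrite -mulrDr !exprMn.
  have -> : c ^+ 2 = 2^-1 by apply: (mulfI (x := 2)) => //; rewrite c2 mulfV.
  transitivity (2 * c ^+ 2 * (k * k * (expR (- (2^-1 * (y - x) ^+ 2 / 2)) * expR (- (2^-1 * (y + x) ^+ 2 / 2)))));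
    first by ring.
  rewrite c2 mul1r -expRD.
  transitivity (k * k * (expR (- (y ^+ 2 / 2)) * expR (- (x ^+ 2 / 2)))); last by ring.
  by rewrite -expRD; congr (_ * expR _); field.
rewrite ge0_integralZl//.
- by rewrite integral_normal_pdf mule1.
- exact: (measurable_EFin (measurable_normal_pdf _ _)).
- by move=> x _; rewrite lee_fin normal_pdf_ge0.
- by rewrite lee_fin normal_pdf_ge0.
Qed.

(** The inner integral is rewritten in the variable [c (x + y)], so that [f] no longer sees [x];
    Tonelli then lets the [x]-integral be done first, by [conv_pdf]. This is what allows a Gaussian
    step to be split into two shorter ones. *)
Lemma gauss_conv (c : R) (f : R -> R) : 0 < c -> 2 * c ^+ 2 = 1 ->
  continuous f -> (forall x, 0 <= f x) ->
  (\int[gam]_x \int[gam]_y (f (c * (x + y)))%:E = \int[gam]_x (f x)%:E)%E.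
Proof.
move=> c0 c2 cf f0.
have mf : measurable_fun [set: R] f := continuous_measurable_fun cf.
pose G (p : R * R) : R := f p.2 * (phi (- p.1 + 2 * c * p.2) * (2 * c)).
have G0 p : 0 <= G p by rewrite !mulr_ge0// ?normal_pdf_ge0// ltW.
have mG : measurable_fun [set: R * R] G.
  apply: measurable_funM; first exact: (measurableT_comp mf).
  apply: measurable_funM => //.
  apply: (measurableT_comp measurable_gauss_pdf).
  apply: measurable_funD; first exact: measurableT_comp.
  by apply: measurable_funM.
have cinv : c * (2 * c) = 1 by rewrite -[RHS]c2; ring.
transitivity (\int[gam]_x \int[mu]_y (G (x, y))%:E)%E.
  apply: eq_integral => x _.
  rewrite (@gauss_affine _ (- x) (2 * c)); last 3 first.
  - by rewrite mulr_gt0.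
  - move=> y; apply: (@continuous_comp _ _ _ (fun y => c * (x + y)) f).
      by apply: cvgM; [exact: cvg_cst|apply: cvgD; [exact: cvg_cst|exact: cvg_id]].
    exact: cf.
  - by move=> y.
  apply: eq_integral => y _; congr EFin; rewrite /G/= -mulrA; congr (f _ * _).
  by rewrite addrA subrr add0r mulrA cinv mul1r.
have mGE : measurable_fun [set: R * R] (fun p => (G p)%:E) := measurable_EFin mG.
pose Gp (p : R * R) : R := G p * phi p.1.
have mGp : measurable_fun [set: R * R] (fun p => (Gp p)%:E).
  apply: measurable_EFin; apply: measurable_funM => //.
  exact: (measurableT_comp measurable_gauss_pdf).
have Gp0 p : (0 <= (Gp p)%:E)%E by rewrite lee_fin mulr_ge0// normal_pdf_ge0.
transitivity (\int[mu]_x \int[mu]_y (Gp (x, y))%:E)%E.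
  rewrite ge0_integral_gauss; last 2 first.
  - apply: (@measurable_fun_fubini_tonelli_F _ _ _ _ _ mu (EFin \o G)).
      exact: mGE.
    by move=> p; rewrite /= lee_fin.
  - by move=> x; apply: integral_ge0 => y _; rewrite lee_fin.
  apply: eq_integral => x _.
  rewrite muleC -ge0_integralZl//.
  - by apply: eq_integral => y _; rewrite -EFinM mulrC.
  - apply: (measurableT_comp mGE); exact: measurable_pair1.
  - by move=> y _; rewrite lee_fin.
  - by rewrite lee_fin normal_pdf_ge0.
rewrite (@fubini_tonelli _ _ _ _ _ mu mu (EFin \o Gp))//.
rewrite ge0_integral_gauss; last 2 first.
- exact: (measurable_EFin mf).
- by move=> x; rewrite lee_fin.
apply: eq_integral => y _ /=.
rewrite -(conv_pdf y c0 c2) -ge0_integralZl//.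
- by apply: eq_integral => x _; rewrite -EFinM /Gp /G/= -!mulrA.
- apply: measurable_EFin; apply: measurable_funM => //.
  apply: measurable_funM => //; apply: (measurableT_comp measurable_gauss_pdf).
  exact: measurable_funD.
- by move=> x _; rewrite lee_fin !mulr_ge0// ?normal_pdf_ge0// ltW.
- by rewrite lee_fin.
Qed.

End gauss_conv.

(** * One Gaussian step of the barrier function, and a Gaussian tail *)

Section gauss_barrier.
Variable R : realType.
Local Notation mu := (@lebesgue_measure R).
Local Notation gam := (normal_prob (0 : R) 1).
Local Notation phi := (normal_pdf (0 : R) 1).
Local Notation gint f := (gam.-integrable setT (EFin \o f)).

(* The heat kernel with a Dirichlet condition at [Z = 0], tilted by [expR (- 2 * Z)]. *)
Definition barrier_fun (p Z : R) : R :=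
  expR (- (2 * Z)) * (Num.max Z 0 * expR (- (Z ^+ 2 / (2 * p ^+ 2))) / p ^+ 3).

Lemma barrier_fun_ge0 (p Z : R) : 0 < p -> 0 <= barrier_fun p Z.
Proof.
move=> p0; rewrite /barrier_fun mulr_ge0 ?expR_ge0// mulr_ge0 ?invr_ge0 ?exprn_ge0 ?(ltW p0)//.
by rewrite mulr_ge0 ?expR_ge0// le_max lexx orbT.
Qed.

Lemma barrier_fun_le (p Z : R) : 0 < p -> barrier_fun p Z <= p ^- 3.
Proof.
move=> p0; rewrite /barrier_fun mulrA ler_piMl ?invr_ge0 ?exprn_ge0 ?(ltW p0)//.
have h1 : expR (- (Z ^+ 2 / (2 * p ^+ 2))) <= 1.
  by rewrite expR_le1 oppr_le0 divr_ge0 ?sqr_ge0// mulr_ge0// sqr_ge0.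
have h2 : expR (- (2 * Z)) * Num.max Z 0 <= 1.
  rewrite /Num.max; case: ifPn; first by rewrite mulr0.
  rewrite -leNgt => Z0; rewrite expRN mulrC ler_pdivrMr ?expR_gt0// mul1r.
  by apply: le_trans (expR_ge1Dx _); lra.
have h3 : 0 <= expR (- (2 * Z)) * Num.max Z 0.
  by rewrite mulr_ge0 ?expR_ge0// le_max lexx orbT.
rewrite mulrA; apply: le_trans (_ : 1 * 1 <= _); last by rewrite mulr1.
by apply: ler_pM => //; rewrite expR_ge0.
Qed.

Lemma continuous_barrier_fun (p a b : R) :
  continuous (fun y : R => barrier_fun p (a - b * y)).
Proof.
have clin (u v : R) : continuous (fun y : R => u - v * y).
  move=> y; apply: cvgB; first exact: cvg_cst.
  by apply: cvgM; [exact: cvg_cst|exact: cvg_id].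
move=> y; rewrite /barrier_fun; apply: cvgM.
  apply: (@continuous_comp _ _ _ (fun y : R => - (2 * (a - b * y))) expR);
    last exact: continuous_expR.
  by apply: cvgN; apply: cvgM; [exact: cvg_cst|exact: clin].
apply: cvgM; last exact: cvg_cst.
apply: cvgM.
  apply: (@continuous_max _ _ (fun y : R => a - b * y) (fun=> 0)).
    exact: clin.
  exact: cvg_cst.
apply: (@continuous_comp _ _ _ (fun y : R => - ((a - b * y) ^+ 2 / (2 * p ^+ 2))) expR);
  last exact: continuous_expR.
apply: cvgN; apply: cvgM; last exact: cvg_cst.
by rewrite expr2; apply: cvgM; exact: clin.
Qed.

Lemma gint_barrier_fun (p a b : R) : 0 < p ->
  gint (fun y => barrier_fun p (a - b * y)).
Proof.
move=> p0; apply: (@gint_bounded _ _ (p ^- 3)).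
  exact: (continuous_measurable_fun (@continuous_barrier_fun _ _ _)).
by move=> x; rewrite ger0_norm ?barrier_fun_ge0// barrier_fun_le.
Qed.

(* Completing the square turns the tilted integrand into a Gaussian times the
   positive part of an affine function, bounded below by that function. *)
Lemma gauss_barrier (s p q z : R) : 0 < p -> 0 < q -> s ^+ 2 = q ^+ 2 - p ^+ 2 ->
  expR (- (2 * s ^+ 2)) *
    (expR (- (2 * z)) * (z * expR (- (z ^+ 2 / (2 * q ^+ 2))) / q ^+ 3)) <=
  \int[gam]_y barrier_fun p (z + 2 * s ^+ 2 - s * y).
Proof.
move=> p0 q0 s2.
(* [a] and [b] are the centre and the scale of the Gaussian in [y] once the tilt and the heat kernel
   are absorbed; [m] is the argument of the barrier at that centre and [k] collects the factors free
   of [y]. *)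
pose b := p / q; pose a := 2 * s + s * z / q ^+ 2.
pose m := z * b ^+ 2; pose k := expR (- (2 * z) - 2 * s ^+ 2 - z ^+ 2 / (2 * q ^+ 2)) * b / p ^+ 3.
have b0 : 0 < b by rewrite divr_gt0.
have pn : p != 0 by rewrite gt_eqF.
have qn : q != 0 by rewrite gt_eqF.
have k0 : 0 <= k by rewrite /k !mulr_ge0 ?expR_ge0 ?invr_ge0 ?exprn_ge0 ?ltW.
have clin (u v : R) : continuous (fun y : R => u - v * y).
  move=> y; apply: cvgB; first exact: cvg_cst.
  by apply: cvgM; [exact: cvg_cst|exact: cvg_id].
have cmax : continuous (fun y : R => Num.max (m - s * b * y) 0).
  move=> y; apply: (@continuous_max _ _ (fun y : R => m - s * b * y) (fun=> 0)).
    exact: clin.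
  exact: cvg_cst.
have kE (v : R) : barrier_fun p (z + 2 * s ^+ 2 - s * (a + b * v)) * phi (a + b * v) * b
    = k * Num.max (m - s * b * v) 0 * phi v.
  have -> : z + 2 * s ^+ 2 - s * (a + b * v) = m - s * b * v.
    have -> : m = z * (q ^+ 2 - s ^+ 2) / q ^+ 2.
      by rewrite s2 /m /b expr_div_n; field.
    by rewrite /a; field.
  rewrite /barrier_fun /k !gauss_pdfE.
  set M := Num.max _ _; set N := normal_peak 1.
  transitivity (M * N * b / p ^+ 3 * (expR (- (2 * (m - s * b * v))) *
     expR (- ((m - s * b * v) ^+ 2 / (2 * p ^+ 2))) * expR (- ((a + b * v) ^+ 2 / 2)))); first by ring.
  transitivity (M * N * b / p ^+ 3 * (expR (- (2 * z) - 2 * s ^+ 2 - z ^+ 2 / (2 * q ^+ 2)) *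
     expR (- (v ^+ 2 / 2)))); last by ring.
  congr (_ * _); rewrite -!expRD; congr expR.
  transitivity (- (b ^+ 2 * (s ^+ 2 + p ^+ 2) / (2 * p ^+ 2)) * v ^+ 2 -
     2 * z * ((s ^+ 2 + p ^+ 2) / q ^+ 2) - 2 * s ^+ 2
     - z ^+ 2 * (s ^+ 2 + p ^+ 2) / (2 * (q ^+ 2) ^+ 2)).
    by rewrite /m /b /a; field; rewrite pn qn.
  rewrite s2 subrK divff ?sqrf_eq0// /b; field; by rewrite pn qn.
have E0 : (\int[gam]_y (barrier_fun p (z + 2 * s ^+ 2 - s * y))%:E =
    \int[gam]_y (k * Num.max (m - s * b * y) 0)%:E)%E.
  rewrite (@gauss_affine _ a b _ b0); last 2 first.
  - exact: continuous_barrier_fun.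
  - by move=> x; exact: barrier_fun_ge0.
  rewrite ge0_integral_gauss; last 2 first.
  - apply: measurable_EFin; apply: measurable_funM => //.
    exact: continuous_measurable_fun.
  - by move=> x; rewrite lee_fin mulr_ge0// le_max lexx orbT.
  by apply: eq_integral => v _; rewrite -EFinM kE.
have -> : \int[gam]_y barrier_fun p (z + 2 * s ^+ 2 - s * y) =
    \int[gam]_y (k * Num.max (m - s * b * y) 0) by rewrite /Rintegral E0.
have il : gint (fun y => m + (- (s * b)) * y).
  by apply: gintD; [exact: gint_cst|apply: gintZ; exact: gint_id].
have im : gint (fun y => Num.max (m - s * b * y) 0).
  apply: (@gint_le _ _ (fun y => `|m| + `|s * b| * (1 + `|y| ^+ 3))).
  - exact: continuous_measurable_fun.
  - move=> y; have y1 : `|y| <= 1 + `|y| ^+ 3.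
      have := normr_ge0 y; set w := `|y| => w0.
      have [w1|w1] := leP w 1; first by rewrite (le_trans w1)// lerDl exprn_ge0.
      rewrite (@le_trans _ _ (w ^+ 3))// ?lerDr// -[leLHS]expr1 ler_weXn2l//.
      exact: ltW.
    apply: (@le_trans _ _ (`|m| + `|s * b| * `|y|)); last first.
      by rewrite lerD2l ler_wpM2l.
    rewrite -normrM; apply: le_trans (ler_normB _ _).
    by rewrite ger0_norm ?le_max ?lexx ?orbT// ge_max ler_norm normr_ge0.
  - apply: gintD; first exact: gint_cst.
    by apply: gintZ; apply: gintD; [exact: gint_cst|exact: gint_cube].
rewrite RintegralZl//.
have : m <= \int[gam]_y Num.max (m - s * b * y) 0.
  have em : \int[gam]_y (m + - (s * b) * y) = m.
    rewrite RintegralD//; [|exact: gint_cst|by apply: gintZ; exact: gint_id].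
    by rewrite gE_cst RintegralZl ?gE_id ?mulr0 ?addr0//; exact: gint_id.
  rewrite -[leLHS]em; apply: le_Rintegral => // y _.
  by rewrite le_max mulNr lexx.
move=> /(ler_wpM2l k0); apply: le_trans.
rewrite /k /m /b le_eqVlt; apply/orP; left; apply/eqP.
have -> : expR (- (2 * z) - 2 * s ^+ 2 - z ^+ 2 / (2 * q ^+ 2)) =
  expR (- (2 * s ^+ 2)) * (expR (- (2 * z)) * expR (- (z ^+ 2 / (2 * q ^+ 2)))).
  by rewrite -!expRD; congr expR; ring.
by field; rewrite pn qn.
Qed.

(** Only the mass of [y, y + 1] is kept, where half the square of the variable is at most 1 + y^2.
    The crude rate y^2 instead of y^2 / 2 is matched by the width of the first barrier. *)
Lemma gauss_tail (f : R -> R) (k y : R) : measurable_fun setT f ->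
  (forall x, 0 <= f x <= 1) -> 0 <= k -> 0 <= y -> (forall x, y <= x -> k <= f x) ->
  k * (normal_peak 1 * expR (- 1) * expR (- y ^+ 2)) <= \int[gam]_x f x.
Proof.
move=> mf f01 k0 y0 kf.
have fi : gint f.
  apply: (@gint_bounded _ _ 1) => // x.
  by have /andP[f0 f1] := f01 x; rewrite ger0_norm.
set K := normal_peak 1 * expR (- 1) * expR (- y ^+ 2).
have gI : (K%:E <= gam `[y, (y + 1)%R]%classic)%E.
  apply: (@le_trans _ _ (\int[mu]_(x in `[y, (y + 1)%R]) K%:E)%E).
    rewrite integral_cst//= lebesgue_measure_itv/= lte_fin ltrDl ltr01.
    by rewrite -EFinB addrC addKr mule1.
  apply: ge0_le_integral => //=.
  - by move=> x _; rewrite lee_fin !mulr_ge0 ?expR_ge0// normal_peak_ge0.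
  - apply: measurable_funTS; exact: (measurable_EFin (measurable_normal_pdf _ _)).
  - move=> x; rewrite in_itv/= => /andP[yx xy]; rewrite lee_fin gauss_pdfE /K -mulrA.
    rewrite ler_wpM2l ?normal_peak_ge0// -expRD ler_expR.
    have h1 : 0 <= (y + 1 - x) * (y + 1 + x) by rewrite mulr_ge0//; lra.
    have h2 := sqr_ge0 (y - 1); nra.
rewrite -lee_fin /Rintegral fineK; last exact: integrable_fin_num.
apply: (@le_trans _ _ (\int[gam]_(x in `[y, (y + 1)%R]) k%:E)%E).
  by rewrite integral_cst// EFinM lee_wpmul2l// lee_fin.
apply: (@le_trans _ _ (\int[gam]_(x in `[y, (y + 1)%R]) (f x)%:E)%E).
  apply: ge0_le_integral => //=.
  - by apply: measurable_funTS; exact: measurable_EFin.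
  - by move=> x; rewrite in_itv/= => /andP[yx _]; rewrite lee_fin kf.
apply: ge0_subset_integral => //=.
- exact: measurable_EFin.
- by move=> x _; rewrite lee_fin; have /andP[] := f01 x.
Qed.

End gauss_barrier.

(** * Gaussian averages of functionals of a field, and Slepian comparison *)

Section gavg.
Variable R : realType.
Local Notation gam := (normal_prob (0 : R) 1).
Local Notation gint f := (gam.-integrable setT (EFin \o f)).
Local Notation field := (R -> R).
Implicit Types (F G : field -> R) (a b w : field) (l : seq field).

(* A functional of fields is evaluated on arbitrary functions [R -> R]; only finitely
   many coordinates matter, so no measurable structure on fields is needed. *)
Definition nice F : Prop :=
  [/\ forall w, 0 <= F w <= 1,
      exists K (r : seq R), 0 <= K /\
        forall w w', `|F w - F w'| <= K * \sum_(t <- r) `|w t - w' t| &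
      forall d (S : measurableType d) (h : S -> field),
        (forall t, measurable_fun setT (h^~ t)) ->
        measurable_fun setT (fun s => F (h s))].

Definition gavg a F w : R := \int[gam]_z F (fun t => w t + z * a t).

(* [gavgs l F w] is the expectation of [F (w + \sum_(a <- l) xi_a * a)] for
   independent standard normal [xi_a]. *)
Definition gavgs l F : field -> R := foldr gavg F l.

Definition fscale (e : R) a : field := fun t => e * a t.

Lemma nice_meas F w a : nice F ->
  measurable_fun [set: R] (fun z => F (fun t => w t + z * a t)).
Proof.
move=> [_ _]; apply => t; apply: measurable_funD => //.
by apply: measurable_funM => //.
Qed.

Lemma nice_gint F w a : nice F -> gint (fun z => F (fun t => w t + z * a t)).
Proof.
move=> nF; apply: (@gint_bounded _ _ 1).
  exact: nice_meas.
by case: nF => nF _ _ z; have /andP[F0 F1] := nF (fun t => w t + z * a t); rewrite ger0_norm.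
Qed.

Lemma gavg_EFin F w a : nice F ->
  ((gavg a F w)%:E = \int[gam]_z (F (fun t => w t + z * a t)%R)%:E)%E.
Proof.
by move=> nF; rewrite /gavg /Rintegral fineK//; apply: integrable_fin_num => //; exact: nice_gint.
Qed.

Lemma gavg_le F G w a (e : R) : nice F -> nice G ->
  (forall w', F w' <= G w' + e) -> gavg a F w <= gavg a G w + e.
Proof.
move=> nF nG FG; rewrite -[X in _ + X](gE_cst e) -RintegralD//; last 2 first.
- exact: nice_gint.
- exact: gint_cst.
apply: le_Rintegral => //.
- exact: nice_gint.
- by apply: gintD; [exact: nice_gint|exact: gint_cst].
Qed.

Lemma nice_gavg F a : nice F -> nice (gavg a F).
Proof.
move=> nF; split.
- move=> w; apply/andP; split.
    apply: Rintegral_ge0 => z _.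
    by case: nF => nF _ _; have /andP[] := nF (fun t => w t + z * a t).
  rewrite -[leRHS](gE_cst 1); apply: le_Rintegral => //.
  - exact: nice_gint.
  - exact: gint_cst.
  - by move=> z _; case: nF => nF _ _; have /andP[] := nF (fun t => w t + z * a t).
- have [_ [K [r [K0 FK]]] _] := nF; exists K, r; split => // w w'.
  have h (u v : field) : gavg a F u <= gavg a F v + K * \sum_(t <- r) `|u t - v t|.
    set e := K * _; rewrite -[X in _ + X](gE_cst e) -RintegralD//; last 2 first.
    - exact: nice_gint.
    - exact: gint_cst.
    apply: le_Rintegral => //.
    - exact: nice_gint.
    - by apply: gintD; [exact: nice_gint|exact: gint_cst].
    move=> z _; rewrite -lerBlDl; apply: le_trans (ler_norm _) _.
    apply: le_trans (FK _ _) _; rewrite /e le_eqVlt; apply/orP; left; apply/eqP.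
    congr (_ * _); apply: eq_bigr => t _; congr (`| _ |); ring.
  have h1 := h w w'; have := h w' w.
  rewrite (eq_bigr (fun t => `|w t - w' t|)); last by move=> t _; rewrite distrC.
  by move=> h2; rewrite ler_norml; apply/andP; split; lra.
- move=> d S h mh.
  have mfi : measurable_fun [set: S * R] (fun p => F (fun t => h p.1 t + p.2 * a t)).
    case: nF => _ _; apply => t; apply: measurable_funD.
      exact: (measurableT_comp (mh t)).
    by apply: measurable_funM.
  have := @measurable_fun_fubini_tonelli_F _ _ _ _ _ gam _ (measurable_EFin mfi).
  move=> H; have {}H := H _.
  apply: (measurableT_comp (fine_measurable measurableT)) => //.
  apply: H => p; rewrite lee_fin.
  by case: nF => nF _ _; have /andP[] := nF (fun t => h p.1 t + p.2 * a t).
Qed.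

Lemma nice_gavgs F l : nice F -> nice (gavgs l F).
Proof. by move=> nF; elim: l => //= a l IH; exact: nice_gavg. Qed.

Lemma gavgC F a b : nice F -> gavg a (gavg b F) = gavg b (gavg a F).
Proof.
move=> nF; apply/funext => w; apply: EFin_inj.
rewrite !gavg_EFin; [|exact: nice_gavg..].
under eq_integral do rewrite gavg_EFin//.
under [RHS]eq_integral do rewrite gavg_EFin//.
pose f (p : R * R) := (F (fun t => w t + p.1 * a t + p.2 * b t))%:E.
rewrite (@fubini_tonelli _ _ _ _ _ gam gam f).
- apply: eq_integral => z _; apply: eq_integral => z' _; rewrite /f/=.
  by congr (F _)%:E; apply/funext => t; ring.
- apply: measurable_EFin; case: nF => _ _; apply => t.
  by apply: measurable_funD; [apply: measurable_funD|]; rewrite //; apply: measurable_funM.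
- by move=> p; rewrite lee_fin; case: nF => nF _ _; have /andP[] := nF (fun t => w t + p.1 * a t + p.2 * b t).
Qed.

Lemma nice_continuous F w a : nice F -> continuous (fun z : R => F (fun t => w t + z * a t)).
Proof.
move=> [_ [K [r [K0 FK]]] _] z.
have h (z' : R) : `|F (fun t => w t + z * a t) - F (fun t => w t + z' * a t)| <=
    (K * \sum_(t <- r) `|a t|) * `|z - z'|.
  apply: le_trans (FK _ _) _; rewrite -mulrA ler_wpM2l// mulr_suml ler_sum// => t _.
  by rewrite addrAC opprD addrA subrr add0r -mulNr addrC -mulrDl normrM mulrC.
set M := K * _ in h.
have M0 : 0 <= M by rewrite mulr_ge0// sumr_ge0.
apply/cvgrPdist_le => /= e e0; near=> z'.
apply: le_trans (h z') _; apply: le_trans (_ : M * (e / (M + 1)) <= _).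
  rewrite ler_wpM2l//; near: z'.
  apply: cvgr_dist_le; first exact: cvg_id.
  by rewrite divr_gt0// ltr_wpDl.
rewrite mulrA ler_pdivrMr ?ltr_wpDl// mulrC; nra.
Unshelve. all: end_near. Qed.

Lemma gavg_half F a (c : R) : nice F -> 0 < c -> 2 * c ^+ 2 = 1 ->
  gavg (fscale c a) (gavg (fscale c a) F) = gavg a F.
Proof.
move=> nF c0 c2; apply/funext => w; apply: EFin_inj.
rewrite !gavg_EFin//; last exact: nice_gavg.
under eq_integral do rewrite gavg_EFin//.
rewrite -(@gauss_conv _ c (fun z => F (fun t => w t + z * a t)))//.
- apply: eq_integral => z _; apply: eq_integral => z' _.
  by congr (F _)%:E; apply/funext => t; rewrite /fscale; ring.
- exact: nice_continuous.
- by move=> z; case: nF => nF _ _; have /andP[] := nF (fun t => w t + z * a t).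
Qed.

Lemma gavgs_le F G l w (e : R) : nice F -> nice G ->
  (forall w', F w' <= G w' + e) -> gavgs l F w <= gavgs l G w + e.
Proof.
move=> nF nG FG; elim: l w => //= a l IH w.
by apply: gavg_le => //; exact: nice_gavgs.
Qed.

Lemma gavg_gavgs F a l : nice F -> gavg a (gavgs l F) = gavgs l (gavg a F).
Proof.
move=> nF; elim: l => //= b l IH; rewrite gavgC ?IH//; exact: nice_gavgs.
Qed.

Lemma gavgsC F l l' : nice F -> gavgs l (gavgs l' F) = gavgs l' (gavgs l F).
Proof.
move=> nF; elim: l => //= a l IH; rewrite IH gavg_gavgs//; exact: nice_gavgs.
Qed.

Lemma gavgs_cat F l l' : gavgs (l ++ l') F = gavgs l (gavgs l' F).
Proof. by rewrite /gavgs foldr_cat. Qed.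

Lemma gavgs_half F l (c : R) : nice F -> 0 < c -> 2 * c ^+ 2 = 1 ->
  gavgs (map (fscale c) l) (gavgs (map (fscale c) l) F) = gavgs l F.
Proof.
move=> nF c0 c2; elim: l => //= a l IH.
rewrite -gavg_gavgs; last exact: nice_gavgs.
rewrite IH gavg_half//; exact: nice_gavgs.
Qed.

End gavg.

(** * Expansion of the smoothed maximum along a line *)

Section taylor.
Variable R : realType.
Implicit Types (k e b : R -> R) (r : seq R).

(* Along a line [w + s h] the functional [expR (- \sum expR (beta (w t - c)))] is
   [expR (- moment 0 s)], where [e] are the exponentials at [s = 0] and [k = beta h]. *)
Definition wmoment r b k e (s : R) : R := \sum_(t <- r) b t * (e t * expR (s * k t)).

Lemma is_derive_wmoment r b k e (s : R) :
  is_derive s 1 (wmoment r b k e) (wmoment r (fun t => b t * k t) k e s).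
Proof.
elim: r => [|t r IH].
  have -> : wmoment [::] b k e = cst 0 by apply/funext => x; rewrite /wmoment big_nil.
  by rewrite /wmoment big_nil; exact: is_derive_cst.
have -> : wmoment (t :: r) b k e =
    (fun s => b t * (e t * expR (s * k t))) \+ wmoment r b k e.
  by apply/funext => x; rewrite /wmoment big_cons.
rewrite /wmoment big_cons; apply: is_deriveD.
have h : is_derive s (1 : R) (fun s => s * k t) (k t).
  by apply: is_derive_eq; rewrite scaler0 add0r; exact: mulr1.
apply: is_derive_eq.
by rewrite /GRing.scale/=; ring.
Qed.

Lemma wmoment_le r b k e (s B : R) : 0 <= B -> (forall t, t \in r -> 0 <= e t) ->
  (forall t, t \in r -> `|b t| <= B) ->
  `|wmoment r b k e s| <= B * wmoment r (fun=> 1) k e s.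
Proof.
move=> B0 e0 bB; apply: le_trans (ler_norm_sum _ _ _) _.
rewrite /wmoment mulr_sumr big_seq [leRHS]big_seq; apply: ler_sum => t tr.
have h : 0 <= e t * expR (s * k t) by rewrite mulr_ge0 ?expR_ge0 ?e0.
by rewrite normrM (ger0_norm h) mul1r ler_wpM2r ?bB.
Qed.

Lemma wmoment_ge0 r k e (s : R) : (forall t, t \in r -> 0 <= e t) ->
  0 <= wmoment r (fun=> 1) k e s.
Proof.
move=> e0; rewrite /wmoment big_seq; apply: sumr_ge0 => t tr.
by rewrite !mulr_ge0 ?expR_ge0 ?e0.
Qed.

(** Keeps the derivatives of [expR (- S0)] bounded however large the sum [S0] of exponentials is. *)
Lemma exprn_expRN_le (x : R) n : 0 <= x -> x ^+ n * expR (- x) <= n`!%:R.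
Proof.
move=> x0; rewrite expRN ler_pdivrMr ?expR_gt0//.
case: n => [|n]; first by rewrite expr0 fact0 mul1r (le_trans _ (expR_ge1Dx _))// lerDl.
rewrite mulrC -ler_pdivrMr ?ltr0n ?fact_gt0//.
by apply: le_trans (expR_ge1Dxn n x0); rewrite lerDr.
Qed.

Lemma mvt_bound (f df : R -> R) (x M : R) : 0 <= x -> x <= 1 ->
  (forall y : R, is_derive y 1 f (df y)) ->
  (forall y, 0 <= y <= 1 -> `|df y| <= M) -> `|f x - f 0| <= M * x.
Proof.
move=> x0 x1 fd dM.
have [->|xn] := eqVneq x 0; first by rewrite subrr normr0 mulr0.
have xp : 0 < x by rewrite lt_def xn.
have cf : {within `[0, x], continuous f}.
  by apply: derivable_within_continuous => y _; exact: ex_derive.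
have [c + ->] := @MVT R f df 0 x xp (fun y _ => fd y) cf.
rewrite in_itv/= => /andP[c0 cx]; rewrite subr0 normrM (ger0_norm x0).
by rewrite ler_wpM2r// dM// (ltW c0) (le_trans (ltW cx)).
Qed.

Lemma taylor2 (f f1 f2 f3 : R -> R) (M : R) :
  (forall y : R, is_derive y 1 f (f1 y)) ->
  (forall y : R, is_derive y 1 f1 (f2 y)) ->
  (forall y : R, is_derive y 1 f2 (f3 y)) ->
  (forall y, 0 <= y <= 1 -> `|f3 y| <= M) ->
  `|f 1 - f 0 - f1 0 - f2 0 / 2| <= M.
Proof.
move=> d1 d2 d3 hM.
have M0 : 0 <= M by apply: le_trans (normr_ge0 _) (hM 0 _); rewrite lexx ler01.
have h2 y : 0 <= y <= 1 -> `|f2 y - f2 0| <= M.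
  move=> /andP[y0 y1]; apply: le_trans (mvt_bound y0 y1 d3 hM) _.
  by rewrite ler_piMr.
have h1 y : 0 <= y <= 1 -> `|f1 y - f1 0 - f2 0 * y| <= M.
  move=> /andP[y0 y1].
  have dg (z : R) : is_derive z 1 (fun y => f1 y - f2 0 * y) (f2 z - f2 0).
    by have := d2 z => ?; apply: is_derive_eq; rewrite /GRing.scale/=; ring.
  have := @mvt_bound (fun y => f1 y - f2 0 * y) (fun z => f2 z - f2 0) y M y0 y1 dg h2.
  rewrite mulr0 subr0 addrAC => /le_trans; apply.
  by rewrite ler_piMr.
have dg (z : R) : is_derive z 1 (fun y => f y - f1 0 * y - f2 0 / 2 * (y * y)) (f1 z - f1 0 - f2 0 * z).
  have := d1 z => ?; apply: is_derive_eq; rewrite /GRing.scale/=; by field.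
have := @mvt_bound (fun y => f y - f1 0 * y - f2 0 / 2 * (y * y)) _ 1 M ler01 (lexx 1) dg h1.
rewrite !mulr0 !subr0 !mulr1 => h; apply: le_trans h.
by rewrite le_eqVlt; apply/orP; left; apply/eqP; congr (`| _ |); ring.
Qed.

Section line.
Variables (r : seq R) (k e : R -> R) (K : R).
Hypothesis K0 : 0 <= K.
Hypothesis e0 : forall t, t \in r -> 0 <= e t.
Hypothesis kK : forall t, t \in r -> `|k t| <= K.

Let S0 := wmoment r (fun=> 1) k e.
Let S1 := wmoment r k k e.
Let S2 := wmoment r (fun t => k t * k t) k e.
Let S3 := wmoment r (fun t => k t * k t * k t) k e.

Let dS0 (s : R) : is_derive s 1 S0 (S1 s).
Proof.
have := is_derive_wmoment r (fun=> 1) k e s.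
by rewrite (_ : (fun t => 1 * k t) = k)//; apply/funext => t; rewrite mul1r.
Qed.
Let dS1 (s : R) : is_derive s 1 S1 (S2 s).
Proof. exact: is_derive_wmoment. Qed.
Let dS2 (s : R) : is_derive s 1 S2 (S3 s).
Proof. exact: is_derive_wmoment. Qed.

Let dE (s : R) : is_derive s 1 (fun s => expR (- S0 s)) (- S1 s * expR (- S0 s)).
Proof.
by have ? := dS0 s; apply: is_derive_eq; rewrite /GRing.scale/= mulrC.
Qed.

Let S0_ge0 s : 0 <= S0 s. Proof. exact: wmoment_ge0. Qed.
Let S1_le s : `|S1 s| <= K * S0 s. Proof. exact: wmoment_le. Qed.
Let S2_le s : `|S2 s| <= K ^+ 2 * S0 s.
Proof.
apply: wmoment_le => // [|t tr]; first exact: sqr_ge0.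
by rewrite normrM expr2 ler_pM ?kK.
Qed.
Let S3_le s : `|S3 s| <= K ^+ 3 * S0 s.
Proof.
apply: wmoment_le => // [|t tr]; first exact: exprn_ge0.
by rewrite !normrM !exprSr expr0 mul1r ler_pM ?kK ?mulr_ge0// ler_pM ?kK.
Qed.

Lemma line_lip : `|expR (- S0 1) - expR (- S0 0)| <= K.
Proof.
have := @mvt_bound (fun s => expR (- S0 s)) _ 1 K ler01 (lexx 1) dE.
rewrite mulr1; apply => y _.
rewrite normrM normrN (ger0_norm (expR_ge0 _)).
apply: le_trans (_ : K * (S0 y ^+ 1 * expR (- S0 y)) <= _).
  by rewrite mulrA ler_wpM2r ?expR_ge0// expr1 S1_le.
by rewrite -[leRHS]mulr1 ler_wpM2l// (exprn_expRN_le 1).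
Qed.

Lemma line_taylor :
  `|expR (- S0 1) - expR (- S0 0) + S1 0 * expR (- S0 0)
    - (S1 0 ^+ 2 - S2 0) * expR (- S0 0) / 2| <= 13 * K ^+ 3.
Proof.
pose f2 s := (S1 s ^+ 2 - S2 s) * expR (- S0 s).
pose f3 s := (- S1 s ^+ 3 + 3 * S1 s * S2 s - S3 s) * expR (- S0 s).
have d2 (s : R) : is_derive s 1 (fun s => - S1 s * expR (- S0 s)) (f2 s).
  have ? := dS1 s; have ? := dE s; apply: is_derive_eq.
  by rewrite /f2 /GRing.scale/=; ring.
have d3 (s : R) : is_derive s 1 f2 (f3 s).
  have ? := dS1 s; have ? := dS2 s; have ? := dE s; rewrite /f2; apply: is_derive_eq.
  by rewrite /f3 /GRing.scale/=; ring.
(* 13 = 3! + 3 * 2! + 1!, from [exprn_expRN_le] applied to [S0 ^+ 3 + 3 * S0 ^+ 2 + S0]. *)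
have bd y : 0 <= y <= 1 -> `|f3 y| <= 13 * K ^+ 3.
  move=> _; rewrite normrM (ger0_norm (expR_ge0 _)).
  apply: (@le_trans _ _ (K ^+ 3 * (S0 y ^+ 3 + 3 * S0 y ^+ 2 + S0 y) * expR (- S0 y))).
    rewrite ler_wpM2r ?expR_ge0//.
    apply: le_trans (ler_normB _ _) _.
    have -> : K ^+ 3 * (S0 y ^+ 3 + 3 * S0 y ^+ 2 + S0 y) =
      ((K * S0 y) ^+ 3 + 3 * ((K * S0 y) * (K ^+ 2 * S0 y))) + K ^+ 3 * S0 y by ring.
    apply: lerD => //; apply: le_trans (ler_normD _ _) _; apply: lerD.
      by rewrite normrN normrX lerXn2r ?nnegrE// mulr_ge0.
    rewrite -mulrA normrM ger0_norm// ler_wpM2l// normrM ler_pM//.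
  have e1 := exprn_expRN_le 1 (S0_ge0 y); have e2 := exprn_expRN_le 2 (S0_ge0 y).
  have e3 := exprn_expRN_le 3 (S0_ge0 y).
  rewrite /= in e1 e2 e3; rewrite -mulrA mulrC ler_wpM2r ?exprn_ge0//.
  rewrite !mulrDl -mulrA; move: e1 e2 e3; rewrite expr1 !factE/=; lra.
have := taylor2 dE d2 d3 bd; rewrite /f2 => h; apply: le_trans h.
by rewrite le_eqVlt; apply/orP; left; apply/eqP; congr (`| _ |); ring.
Qed.

(** When vectors are averaged one after another, the quadratic term of one is evaluated at a field
    already displaced by another; this bounds the effect of the displacement [k] on the term of
    [b]. *)
Lemma line_quad_lip (b : R -> R) (L : R) : 0 <= L ->
  (forall t, t \in r -> `|b t| <= L) ->
  forall q, q = (fun s => (wmoment r b k e s ^+ 2 - wmoment r (fun t => b t * b t) k e s) * expR (- S0 s)) ->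
  `|q 1 - q 0| <= 13 * L ^+ 2 * K.
Proof.
move=> L0 bL q qE.
pose B1 := wmoment r b k e; pose B2 := wmoment r (fun t => b t * b t) k e.
pose B1' := wmoment r (fun t => b t * k t) k e.
pose B2' := wmoment r (fun t => b t * b t * k t) k e.
pose q' s := (2 * B1 s * B1' s - B2' s - (B1 s ^+ 2 - B2 s) * S1 s) * expR (- S0 s).
have dq (s : R) : is_derive s 1 q (q' s).
  have ? : is_derive s 1 B1 (B1' s) := is_derive_wmoment _ _ _ _ _.
  have ? : is_derive s 1 B2 (B2' s) := is_derive_wmoment _ _ _ _ _.
  have ? := dE s; rewrite qE -/B1 -/B2; apply: is_derive_eq.
  by rewrite /q' /GRing.scale/=; ring.
have := @mvt_bound q q' 1 (13 * L ^+ 2 * K) ler01 (lexx 1) dq.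
rewrite mulr1; apply => y _.
have b1 : `|B1 y| <= L * S0 y by apply: wmoment_le.
have b2 : `|B2 y| <= L ^+ 2 * S0 y.
  apply: wmoment_le => // [|t tr]; first exact: sqr_ge0.
  by rewrite normrM expr2 ler_pM ?bL.
have b1' : `|B1' y| <= L * K * S0 y.
  by apply: wmoment_le => // [|t tr]; [exact: mulr_ge0|rewrite normrM ler_pM ?bL ?kK].
have b2' : `|B2' y| <= L ^+ 2 * K * S0 y.
  apply: wmoment_le => // [|t tr]; first by rewrite mulr_ge0 ?sqr_ge0.
  by rewrite !normrM expr2 ler_pM ?kK ?mulr_ge0// ler_pM ?bL.
rewrite /q' normrM (ger0_norm (expR_ge0 _)).
have s0 := S0_ge0 y.
apply: (@le_trans _ _ (L ^+ 2 * K * (S0 y ^+ 3 + 3 * S0 y ^+ 2 + S0 y) * expR (- S0 y))).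
  rewrite ler_wpM2r ?expR_ge0//.
  apply: le_trans (ler_normB _ _) _.
  have -> : L ^+ 2 * K * (S0 y ^+ 3 + 3 * S0 y ^+ 2 + S0 y) =
    (2 * ((L * S0 y) * (L * K * S0 y)) + L ^+ 2 * K * S0 y) +
    ((L * S0 y) ^+ 2 + L ^+ 2 * S0 y) * (K * S0 y) by ring.
  apply: lerD.
    apply: le_trans (ler_normB _ _) _; apply: lerD => //.
    by rewrite -mulrA normrM ger0_norm// ler_wpM2l// normrM ler_pM.
  rewrite normrM ler_pM//; apply: le_trans (ler_normB _ _) _; apply: lerD => //.
  by rewrite normrX lerXn2r ?nnegrE// mulr_ge0.
have e1 := exprn_expRN_le 1 s0; have e2 := exprn_expRN_le 2 s0.
have e3 := exprn_expRN_le 3 s0.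
rewrite -mulrA mulrC (mulrC 13) -mulrA [leRHS]mulrAC [leRHS]mulrC -mulrA.
have LK : 0 <= L ^+ 2 * K by rewrite mulr_ge0 ?sqr_ge0.
set z := expR _ in e1 e2 e3 *.
have hz : (S0 y ^+ 3 + 3 * S0 y ^+ 2 + S0 y) * z <= 13.
  rewrite !mulrDl -mulrA; move: e1 e2 e3; rewrite expr1 !factE/=; lra.
have := ler_wpM2l LK hz; lra.
Qed.

End line.
End taylor.

(** * Slepian's inequality for the smoothed maximum *)

Section slepian.
Variable R : realType.
Local Notation gam := (normal_prob (0 : R) 1).
Local Notation gint f := (gam.-integrable setT (EFin \o f)).
Local Notation field := (R -> R).
Implicit Types (w b h : field) (r : seq R) (l : seq field).

Lemma ler_dist_intro (a b e : R) : a <= b + e -> b <= a + e -> `|a - b| <= e.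
Proof. by move=> h1 h2; rewrite ler_norml; apply/andP; split; lra. Qed.

Lemma ler_dist_elim (a b e : R) : `|a - b| <= e -> a <= b + e /\ b <= a + e.
Proof. by rewrite ler_norml => /andP[h1 h2]; split; lra. Qed.

Lemma gE_dist (f g h : R -> R) : gint f -> gint g -> gint h ->
  (forall z, `|f z - g z| <= h z) -> `|\int[gam]_z f z - \int[gam]_z g z| <= \int[gam]_z h z.
Proof.
move=> fi gi hi fgh.
have h1 : \int[gam]_z f z <= \int[gam]_z g z + \int[gam]_z h z.
  rewrite -RintegralD//; apply: le_Rintegral => //; first exact: gintD.
  by move=> z _; have /ler_dist_elim[] := fgh z.
have h2 : \int[gam]_z g z <= \int[gam]_z f z + \int[gam]_z h z.
  rewrite -RintegralD//; apply: le_Rintegral => //; first exact: gintD.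
  by move=> z _; have /ler_dist_elim[] := fgh z.
exact: ler_dist_intro.
Qed.

Lemma norm_le_cube (x : R) : `|x| <= 1 + `|x| ^+ 3.
Proof. have := normr_ge0 x; set y := `|x|; have [|] := leP y 1; nra. Qed.

Lemma gint_sqr : gint (fun x => x ^+ 2).
Proof.
apply: (@gint_le _ _ (fun x => 1 + `|x| ^+ 3)).
- by apply: measurable_funX; exact: measurable_id.
- move=> x; rewrite normrX; have := normr_ge0 x; set y := `|x|.
  by have [|] := leP y 1; nra.
- by apply: gintD; [exact: gint_cst|exact: gint_cube].
Qed.

Lemma gint_norm : gint (fun x => `|x|).
Proof.
apply: (@gint_le _ _ (fun x => 1 + `|x| ^+ 3)).
- exact: normr_measurable.
- by move=> x; rewrite normr_id norm_le_cube.
- by apply: gintD; [exact: gint_cst|exact: gint_cube].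
Qed.

Section expF.
Variables (beta c : R) (r : seq R).
Hypothesis beta0 : 0 <= beta.

Definition expF w : R := expR (- \sum_(t <- r) expR (beta * (w t - c))).

(** The second derivative of [expF] in the direction [b], up to the factor [beta ^+ 2]. *)
Definition quadF b w : R :=
  ((\sum_(t <- r) b t * expR (beta * (w t - c))) ^+ 2 -
   \sum_(t <- r) b t * b t * expR (beta * (w t - c))) * expF w.

Let e w t := expR (beta * (w t - c)).

Let wm1 w h (b : R -> R) :
  wmoment r b (fun t => beta * h t) (e w) 1 = \sum_(t <- r) b t * e (fun t => w t + h t) t.
Proof.
by apply: eq_bigr => t _; rewrite /e -expRD mul1r; congr (_ * expR _); ring.
Qed.

Let wm0 w h (b : R -> R) :
  wmoment r b (fun t => beta * h t) (e w) 0 = \sum_(t <- r) b t * e w t.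
Proof. by apply: eq_bigr => t _; rewrite mul0r expR0 mulr1. Qed.

Let expFE w : expF w = expR (- \sum_(t <- r) 1 * e w t).
Proof. by congr (expR (- _)); apply: eq_bigr => t _; rewrite mul1r. Qed.

Lemma expF_ge0_le1 w : 0 <= expF w <= 1.
Proof. by rewrite expR_ge0 expR_le1 oppr_le0 sumr_ge0// => t _; rewrite expR_ge0. Qed.

Lemma nice_expF : nice expF.
Proof.
split; first exact: expF_ge0_le1.
- exists beta, r; split => // w w'.
  pose h t := w' t - w t.
  have -> : w' = (fun t => w t + h t) by apply/funext => t; rewrite /h addrC subrK.
  have := @line_lip _ r (fun t => beta * h t) (e w) (beta * \sum_(t <- r) `|h t|).
  rewrite wm1 wm0 -!expFE distrC => H.
  apply: le_trans (H _ _ _) _.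
  + by rewrite mulr_ge0// sumr_ge0.
  + by move=> t _; exact: expR_ge0.
  + move=> t tr; rewrite normrM (ger0_norm beta0) ler_wpM2l//.
    by rewrite (big_rem t tr)/= lerDl sumr_ge0.
  rewrite ler_wpM2l// ler_sum// => t _.
  by rewrite opprD addrA subrr add0r normrN.
- move=> d S h mh; apply: (measurableT_comp (@measurable_expR R)) => //.
  apply: measurableT_comp => //; apply: measurable_sum => t.
  apply: (measurableT_comp (@measurable_expR R)) => //.
  by apply: measurable_funM => //; apply: measurable_funB.
Qed.

Lemma expF_taylor w b (x L : R) : 0 <= L -> (forall t, t \in r -> `|b t| <= L) ->
  `|expF (fun t => w t + x * b t) - expF w
    + x * (beta * (\sum_(t <- r) b t * expR (beta * (w t - c))) * expF w)
    - x ^+ 2 * (beta ^+ 2 / 2 * quadF b w)| <= 13 * (beta * L) ^+ 3 * `|x| ^+ 3.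
Proof.
move=> L0 bL.
pose h t := x * b t.
have bh t : t \in r -> `|beta * h t| <= beta * L * `|x|.
  move=> tr; rewrite /h !normrM (ger0_norm beta0) -mulrA ler_wpM2l// mulrC.
  by rewrite ler_wpM2r ?bL.
have := @line_taylor _ r (fun t => beta * h t) (e w) (beta * L * `|x|) _ _ bh.
rewrite !wm1 !wm0 -!expFE => H.
have -> : 13 * (beta * L) ^+ 3 * `|x| ^+ 3 = 13 * (beta * L * `|x|) ^+ 3 by ring.
apply: le_trans (H _ _); first last.
- by move=> t _; exact: expR_ge0.
- by rewrite !mulr_ge0.
have -> : \sum_(t <- r) beta * h t * e w t = x * beta * \sum_(t <- r) b t * e w t.
  by rewrite mulr_sumr; apply: eq_bigr => t _; rewrite /h; ring.
have -> : \sum_(t <- r) beta * h t * (beta * h t) * e w t = (x * beta) ^+ 2 * \sum_(t <- r) b t * b t * e w t.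
  by rewrite mulr_sumr; apply: eq_bigr => t _; rewrite /h; ring.
rewrite le_eqVlt; apply/orP; left; apply/eqP; congr (`| _ |).
by rewrite /quadF /e; field.
Qed.

Lemma quadF_lip w b h (H L : R) : 0 <= L -> (forall t, t \in r -> `|b t| <= L) ->
  0 <= H -> (forall t, t \in r -> `|h t| <= H) ->
  `|quadF b (fun t => w t + h t) - quadF b w| <= 13 * L ^+ 2 * (beta * H).
Proof.
move=> L0 bL H0 hH.
have := @line_quad_lip _ r (fun t => beta * h t) (e w) (beta * H) _ _ _ b L L0 bL _ erefl.
rewrite /= !wm1 !wm0 -!expFE; apply.
- exact: mulr_ge0.
- by move=> t _; exact: expR_ge0.
- by move=> t tr; rewrite normrM (ger0_norm beta0) ler_wpM2l// hH.
Qed.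

Local Notation v := (\int[gam]_z z ^+ 2).
Local Notation m3 := (\int[gam]_z `|z| ^+ 3).
Local Notation m1 := (\int[gam]_z `|z|).

(** The linear term averages to zero. The second moment [v] is never evaluated: it multiplies both
    sides of the comparison, and only its sign matters. *)
Lemma gavg_taylor b (L ep : R) w : 0 <= L -> (forall t, t \in r -> `|b t| <= L) -> 0 <= ep ->
  `|gavg (fscale ep b) expF w - (expF w + ep ^+ 2 * (beta ^+ 2 * v / 2 * quadF b w))|
    <= 13 * (beta * L) ^+ 3 * m3 * ep ^+ 3.
Proof.
move=> L0 bL ep0.
pose q1 := beta * (\sum_(t <- r) b t * expR (beta * (w t - c))) * expF w.
pose q2 := beta ^+ 2 / 2 * quadF b w.
pose g z := expF w + (- (ep * q1)) * z + (ep ^+ 2 * q2) * z ^+ 2.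
have gi1 : gint (fun z => expF w + (- (ep * q1)) * z).
  by apply: gintD; [exact: gint_cst|apply: gintZ; exact: gint_id].
have gi : gint g by apply: gintD => //; apply: gintZ; exact: gint_sqr.
have Eg : \int[gam]_z g z = expF w + ep ^+ 2 * (beta ^+ 2 * v / 2 * quadF b w).
  rewrite RintegralD//; last by apply: gintZ; exact: gint_sqr.
  rewrite RintegralD//; [|exact: gint_cst|by apply: gintZ; exact: gint_id].
  rewrite !RintegralZl//; [|exact: gint_id|exact: gint_sqr].
  by rewrite gE_cst gE_id mulr0 addr0 /q2; congr (_ + _); ring.
rewrite -Eg; apply: le_trans (@gE_dist _ g (fun z => 13 * (beta * L) ^+ 3 * ep ^+ 3 * `|z| ^+ 3) _ gi _ _) _.
- exact/nice_gint/nice_expF.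
- by apply: gintZ; exact: gint_cube.
- move=> z; have := @expF_taylor w b (z * ep) L L0 bL.
  rewrite normrM (ger0_norm ep0) -/q1 -/q2 => H.
  have -> : (fun t => w t + z * fscale ep b t) = (fun t => w t + z * ep * b t).
    by apply/funext => t; rewrite /fscale mulrA.
  have -> : 13 * (beta * L) ^+ 3 * ep ^+ 3 * `|z| ^+ 3 = 13 * (beta * L) ^+ 3 * (`|z| * ep) ^+ 3 by ring.
  apply: le_trans H.
  by rewrite le_eqVlt; apply/orP; left; apply/eqP; congr (`| _ |); rewrite /g; ring.
- by rewrite RintegralZl//; [rewrite mulrAC|exact: gint_cube].
Qed.

(** Induction on the list: averaging along [b] moves the point at which the other quadratic terms
    are read by O(ep), and these carry a factor [ep ^+ 2], so the change is cubic by [quadF_lip]. *)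
Lemma gavgs_taylor l (L : R) : 0 <= L ->
  (forall b, b \in l -> forall t, t \in r -> `|b t| <= L) ->
  exists2 C, 0 <= C & forall ep w, 0 <= ep ->
  `|gavgs (map (fscale ep) l) expF w -
    (expF w + ep ^+ 2 * (beta ^+ 2 * v / 2 * \sum_(b <- l) quadF b w))| <= C * ep ^+ 3.
Proof.
move=> L0; elim: l => [|b l IH] bL.
  exists 0 => // ep w ep0; rewrite big_nil /= !mulr0 addr0 subrr normr0 mul0r//.
have [|C C0 HC] := IH; first by move=> b' b'l; apply: bL; rewrite inE b'l orbT.
have v0 : 0 <= v by apply: Rintegral_ge0 => z _; exact: sqr_ge0.
have m10 : 0 <= m1 by apply: Rintegral_ge0.
have m30 : 0 <= m3 by apply: Rintegral_ge0 => z _; exact: exprn_ge0.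
have bL' : forall t, t \in r -> `|b t| <= L by apply: bL; rewrite mem_head.
pose D := beta ^+ 2 * v / 2 * ((size l)%:R * (13 * L ^+ 2 * (beta * L))).
have D0 : 0 <= D.
  by rewrite !mulr_ge0 ?sqr_ge0 ?exprn_ge0.
exists (C + D * m1 + 13 * (beta * L) ^+ 3 * m3).
  by rewrite !addr_ge0// !mulr_ge0// exprn_ge0// mulr_ge0.
move=> ep w ep0 /=.
set K := ep ^+ 2 * (beta ^+ 2 * v / 2 * \sum_(b <- l) quadF b w).
pose wz z t := w t + z * fscale ep b t.
have nT := nice_gavgs (map (fscale ep) l) nice_expF.
have i1 : gint (fun z => gavgs (map (fscale ep) l) expF (wz z)) := nice_gint w (fscale ep b) nT.
have i2 : gint (fun z => expF (wz z) + K).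
  by apply: gintD; [exact: (nice_gint w (fscale ep b) nice_expF)|exact: gint_cst].
have i3 : gint (fun z => C * ep ^+ 3 + D * ep ^+ 3 * `|z|).
  by apply: gintD; [exact: gint_cst|apply: gintZ; exact: gint_norm].
have B : `|gavg (fscale ep b) (gavgs (map (fscale ep) l) expF) w - (gavg (fscale ep b) expF w + K)|
    <= C * ep ^+ 3 + D * ep ^+ 3 * m1.
  have -> : gavg (fscale ep b) expF w + K = \int[gam]_z (expF (wz z) + K).
    rewrite RintegralD ?gE_cst//; [exact: (nice_gint w (fscale ep b) nice_expF)|exact: gint_cst].
  have -> : C * ep ^+ 3 + D * ep ^+ 3 * m1 = \int[gam]_z (C * ep ^+ 3 + D * ep ^+ 3 * `|z|).
    rewrite RintegralD; [|by []|exact: gint_cst|by apply: gintZ; exact: gint_norm].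
    by rewrite gE_cst RintegralZl//; exact: gint_norm.
  apply: gE_dist => // z.
  have h1 := HC ep (wz z) ep0.
  have h2 : `|\sum_(b <- l) quadF b (wz z) - \sum_(b <- l) quadF b w| <=
      (size l)%:R * (13 * L ^+ 2 * (beta * L)) * (ep * `|z|).
    rewrite -sumrB; apply: le_trans (ler_norm_sum _ _ _) _.
    rewrite big_seq; apply: le_trans (_ : \sum_(b' <- l | b' \in l) (13 * L ^+ 2 * (beta * L)) * (ep * `|z|) <= _).
      apply: ler_sum => b' b'l.
      have := @quadF_lip w b' (fun t => z * fscale ep b t) (L * (ep * `|z|)) L L0.
      rewrite -!mulrA; apply.
      + by apply: bL; rewrite inE b'l orbT.
      + by rewrite !mulr_ge0.
      + move=> t tr; rewrite /fscale mulrA normrM mulrC ler_pM ?bL'//.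
        by rewrite normrM mulrC (ger0_norm ep0).
    by rewrite -big_seq big_const_seq count_predT iter_addr_0 -[leLHS]mulr_natl mulrA.
  have k0 : 0 <= ep ^+ 2 * (beta ^+ 2 * v / 2) by rewrite !mulr_ge0 ?sqr_ge0.
  have h3 : `|ep ^+ 2 * (beta ^+ 2 * v / 2) * (\sum_(b <- l) quadF b (wz z) - \sum_(b <- l) quadF b w)|
     <= D * ep ^+ 3 * `|z|.
    rewrite normrM (ger0_norm k0); apply: le_trans (ler_wpM2l k0 h2) _.
    by rewrite /D le_eqVlt; apply/orP; left; apply/eqP; ring.
  apply: le_trans (lerD h1 h3); apply: le_trans (ler_normD _ _).
  by rewrite le_eqVlt; apply/orP; left; apply/eqP; congr (`| _ |); rewrite /K; ring.
have A := gavg_taylor w L0 bL' ep0.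
have -> : (C + D * m1 + 13 * (beta * L) ^+ 3 * m3) * ep ^+ 3 =
  (C * ep ^+ 3 + D * ep ^+ 3 * m1) + 13 * (beta * L) ^+ 3 * m3 * ep ^+ 3 by ring.
apply: le_trans (lerD B A); apply: le_trans (ler_normD _ _).
rewrite le_eqVlt; apply/orP; left; apply/eqP; congr (`| _ |).
by rewrite /K big_cons; ring.
Qed.

(** The list enters only through its covariances: all of them with the positive weights
    [e w t * e w s], and the variances once more with a minus sign. Equal variances and larger
    covariances therefore give a larger sum. *)
Lemma sum_quadFE l w : \sum_(b <- l) quadF b w =
  (\sum_(t <- r) \sum_(s <- r) (\sum_(b <- l) b t * b s) * (e w t * e w s) -
   \sum_(t <- r) (\sum_(b <- l) b t * b t) * e w t) * expF w.
Proof.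
rewrite -mulr_suml sumrB; congr ((_ - _) * _).
- transitivity (\sum_(b <- l) \sum_(t <- r) \sum_(s <- r) b t * b s * (e w t * e w s)).
    apply: eq_bigr => b _; rewrite expr2 mulr_suml; apply: eq_bigr => t _.
    by rewrite mulr_sumr; apply: eq_bigr => s _; rewrite -/(e w t) -/(e w s); ring.
  rewrite exchange_big/=; apply: eq_bigr => t _.
  by rewrite exchange_big/=; apply: eq_bigr => s _; rewrite mulr_suml.
- by rewrite exchange_big/=; apply: eq_bigr => t _; rewrite mulr_suml.
Qed.

Lemma sum_quadF_le l1 l2 w :
  (forall t s, t \in r -> s \in r -> \sum_(a <- l1) a t * a s <= \sum_(a <- l2) a t * a s) ->
  (forall t, t \in r -> \sum_(a <- l1) a t * a t = \sum_(a <- l2) a t * a t) ->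
  \sum_(b <- l1) quadF b w <= \sum_(b <- l2) quadF b w.
Proof.
move=> cov var; rewrite !sum_quadFE ler_wpM2r ?expR_ge0//; apply: lerB.
- rewrite big_seq [leRHS]big_seq; apply: ler_sum => t tr.
  rewrite big_seq [leRHS]big_seq; apply: ler_sum => s sr.
  by rewrite ler_wpM2r ?mulr_ge0 ?expR_ge0// cov.
- by rewrite big_seq [leRHS]big_seq; apply: ler_sum => t tr; rewrite var.
Qed.

Let halves_iter (ch : R) l n : 0 < ch -> 2 * ch ^+ 2 = 1 ->
  iter (2 ^ n) (gavgs (map (fscale (ch ^+ n)) l)) expF = gavgs l expF.
Proof.
move=> c0 c2; have niter m l' : nice (iter m (gavgs l') expF).
  by elim: m => [|m IH]; [exact: nice_expF|exact: nice_gavgs].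
elim: n => [|n IH].
  rewrite expn0 expr0 /=; congr (gavgs _ _); rewrite -[RHS]map_id.
  by apply: eq_map => a; apply/funext => t; rewrite /fscale mul1r.
rewrite -IH expnS mulnC.
have -> : map (fscale (ch ^+ n.+1)) l = map (fscale ch) (map (fscale (ch ^+ n)) l).
  rewrite -map_comp; apply: eq_map => a; apply/funext => t.
  by rewrite /fscale/= exprS mulrA.
elim: (2 ^ n)%N => [//|m IHm]; rewrite mulSn !iterS /= IHm gavgs_half//.
Qed.

(* Each vector [a] is replaced by [2 ^ n] copies of [a / 2 ^ (n / 2)]; a single step along
   short vectors only sees the covariance, up to a cubic error, and the off-diagonal
   second derivatives of [expF] are nonnegative. *)
Theorem slepian l1 l2 w :
  (forall t s, t \in r -> s \in r -> \sum_(a <- l1) a t * a s <= \sum_(a <- l2) a t * a s) ->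
  (forall t, t \in r -> \sum_(a <- l1) a t * a t = \sum_(a <- l2) a t * a t) ->
  gavgs l1 expF w <= gavgs l2 expF w.
Proof.
move=> cov var.
have bnd l : exists2 L, 0 <= L & forall b, b \in l -> forall t, t \in r -> `|b t| <= L.
  exists (\sum_(b <- l) \sum_(t <- r) `|b t|).
    by apply: sumr_ge0 => b _; exact: sumr_ge0.
  move=> b bl t tr; rewrite (big_rem b bl)/= (big_rem t tr)/=.
  by rewrite -addrA lerDl addr_ge0 ?sumr_ge0// => b' _; rewrite sumr_ge0.
have [L1 L10 bL1] := bnd l1; have [L2 L20 bL2] := bnd l2.
have [C1 C10 T1] := gavgs_taylor L10 bL1.
have [C2 C20 T2] := gavgs_taylor L20 bL2.
pose C := C1 + C2.
pose ch : R := Num.sqrt (1 / 2).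
have ch0 : 0 < ch by rewrite sqrtr_gt0.
have ch2 : 2 * ch ^+ 2 = 1 by rewrite sqr_sqrtr// mulrC divfK.
have ch1 : ch < 1 by rewrite -(ltr_pXn2r (n := 2))// ?nnegrE ?ltW//; lra.
have one ep w' : 0 <= ep ->
    gavgs (map (fscale ep) l1) expF w' <= gavgs (map (fscale ep) l2) expF w' + C * ep ^+ 3.
  move=> ep0; have := T1 ep w' ep0; have := T2 ep w' ep0.
  rewrite !ler_norml => /andP[h1 h2] /andP[h3 h4].
  have : ep ^+ 2 * (beta ^+ 2 * v / 2 * \sum_(b <- l1) quadF b w') <=
    ep ^+ 2 * (beta ^+ 2 * v / 2 * \sum_(b <- l2) quadF b w').
    rewrite !mulrA ler_wpM2l ?sum_quadF_le// !mulr_ge0 ?sqr_ge0//.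
    by apply: Rintegral_ge0 => z _; exact: sqr_ge0.
  rewrite /C mulrDl; lra.
have niter m l' : nice (iter m (gavgs l') expF).
  by elim: m => [|m IH]; [exact: nice_expF|exact: nice_gavgs].
have many ep m w' : 0 <= ep ->
    iter m (gavgs (map (fscale ep) l1)) expF w' <=
    iter m (gavgs (map (fscale ep) l2)) expF w' + m%:R * (C * ep ^+ 3).
  move=> ep0; elim: m w' => [|m IH] w'; first by rewrite mul0r addr0.
  (* Averages commute, so the one remaining block of [l1] can be moved innermost and exchanged there
     by [one]. *)
  have comm k : gavgs (map (fscale ep) l1) (iter k (gavgs (map (fscale ep) l2)) expF) =
      iter k (gavgs (map (fscale ep) l2)) (gavgs (map (fscale ep) l1) expF).
    elim: k => //= k <-; rewrite gavgsC//; exact: niter.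
  rewrite iterS; apply: le_trans (@gavgs_le _ _ _ _ w' _ (niter m _) (niter m _) IH) _.
  have -> : m.+1%:R * (C * ep ^+ 3) = C * ep ^+ 3 + m%:R * (C * ep ^+ 3).
    by rewrite -natr1; ring.
  rewrite addrA lerD2r comm.
  have step k u : iter k (gavgs (map (fscale ep) l2)) (gavgs (map (fscale ep) l1) expF) u <=
      iter k (gavgs (map (fscale ep) l2)) (gavgs (map (fscale ep) l2) expF) u + C * ep ^+ 3.
    elim: k u => [|k IHk] u /=; first exact: one.
    have ni l' : nice (iter k (gavgs (map (fscale ep) l2)) (gavgs (map (fscale ep) l') expF)).
      by elim: (k) => [|k' IH']; [exact/nice_gavgs/nice_expF|exact: nice_gavgs].
    by apply: gavgs_le => //; exact: ni.
  by rewrite iterSr; exact: step.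
(* There are 2^n steps, each with error C ch^(3n); since 2 ch^2 = 1 the total is C ch^n, which tends
   to 0. *)
have lim n : gavgs l1 expF w <= gavgs l2 expF w + C * ch ^+ n.
  have := many (ch ^+ n) (2 ^ n)%N w (exprn_ge0 _ (ltW ch0)).
  rewrite !halves_iter// => h; apply: le_trans h _.
  rewrite lerD2l natrX -exprM.
  have -> : ch ^+ (n * 3) = ch ^+ n * (ch ^+ 2) ^+ n.
    by rewrite -exprM -exprD mulnC mulSn.
  apply: (@le_trans _ _ (C * ch ^+ n * (2 * ch ^+ 2) ^+ n)).
    rewrite [(2 * _) ^+ n]exprMn; move: (ch ^+ n) ((ch ^+ 2) ^+ n) (2 ^+ n) => x y z.
    by rewrite le_eqVlt; apply/orP; left; apply/eqP; ring.
  by rewrite ch2 expr1n mulr1.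
apply/ler_addgt0Pl => ep ep0.
have : (fun n => C * ch ^+ n) @ \oo --> C * 0.
  apply: cvgMr; apply: cvg_expr; by rewrite ger0_norm// ltW.
rewrite mulr0 => /cvgrPdist_lt/(_ _ ep0)[n _ /(_ n (leqnn n))].
rewrite sub0r normrN => h; rewrite addrC; apply: le_trans (lim n) _.
by rewrite lerD2l; apply: le_trans (ler_norm _) (ltW h).
Qed.

End expF.
End slepian.

(** * Branching random walk *)

Section tree.
Variable R : realType.
Local Notation gam := (normal_prob (0 : R) 1).
Local Notation gint f := (gam.-integrable setT (EFin \o f)).
Local Notation field := (R -> R).
Implicit Types (w a : field) (r : seq R) (l : seq field) (F G H : field -> R).

Lemma in_consP (T : eqType) (x y : T) (q : seq T) :
  x \in y :: q -> x = y \/ x \in q.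
Proof. by rewrite in_cons => /orP[/eqP|]; [left|right]. Qed.

Definition dep r F := forall w w', {in r, w =1 w'} -> F w = F w'.

Lemma dep_gavg r F a : dep r F -> dep r (gavg a F).
Proof.
move=> dF w w' ww'; rewrite /gavg; apply: eq_Rintegral => z _.
by apply: dF => t tr; rewrite ww'.
Qed.

Lemma dep_gavgs r F l : dep r F -> dep r (gavgs l F).
Proof. by move=> dF; elim: l => //= a l IH; exact: dep_gavg. Qed.

Lemma dep_expF (beta c : R) r : dep r (expF beta c r).
Proof.
move=> w w' ww'; rewrite /expF; congr (expR (- _)).
by rewrite big_seq [RHS]big_seq; apply: eq_bigr => t tr; rewrite ww'.
Qed.

Lemma gavg_mul_dep r F H a : nice F -> dep r H -> {in r, forall t, a t = 0} ->
  gavg a (fun w => F w * H w) = (fun w => gavg a F w * H w).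
Proof.
move=> nF dH a0; apply/funext => w; rewrite /gavg.
transitivity (\int[gam]_z (F (fun t => w t + z * a t) * H w)).
  apply: eq_Rintegral => z _; congr (_ * _); apply: dH => t tr.
  by rewrite a0// mulr0 addr0.
by rewrite RintegralZr//; exact: nice_gint.
Qed.

(** Independence in functional form: vectors vanishing on [r] do not move a factor that reads only
    the coordinates in [r]. Functionals of subtrees with disjoint leaves factor in this way, without
    product measures. *)
Lemma gavgs_mul_dep r F H l : nice F -> dep r H ->
  (forall a, a \in l -> {in r, forall t, a t = 0}) ->
  gavgs l (fun w => F w * H w) = (fun w => gavgs l F w * H w).
Proof.
move=> nF dH; elim: l => //= a l IH l0.
rewrite IH; last by move=> a' a'l; apply: l0; rewrite in_cons a'l orbT.
rewrite (@gavg_mul_dep r)//; first exact: nice_gavgs.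
by apply: l0; rewrite mem_head.
Qed.

Lemma gavgs_dep_mul r F H l : nice F -> dep r H ->
  (forall a, a \in l -> {in r, forall t, a t = 0}) ->
  gavgs l (fun w => H w * F w) = (fun w => H w * gavgs l F w).
Proof.
move=> nF dH l0; rewrite (_ : (fun w => H w * F w) = (fun w => F w * H w)).
  by rewrite (gavgs_mul_dep nF dH l0); apply/funext => w; rewrite mulrC.
by apply/funext => w; rewrite mulrC.
Qed.

Lemma expF_cat (beta c : R) r1 r2 :
  expF beta c (r1 ++ r2) = (fun w => expF beta c r1 w * expF beta c r2 w).
Proof. by apply/funext => w; rewrite /expF big_cat/= opprD expRD. Qed.

Variables (kap s : R).
Hypothesis kap0 : 0 < kap.

(* The gap [kap * 2 ^ k * (k + 2)] puts the second subtree of depth [k] at distance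
   [kap * 2 ^ k.+1] from the first one, whose length is [kap * k * 2 ^ k]. *)
Fixpoint leaves k (b : R) : seq R :=
  if k is k'.+1 then leaves k' b ++ leaves k' (b + kap * 2 ^+ k' * (k'%:R + 2))
  else [:: b].

(** The edge leading to the subtree with leaves [r]: its Gaussian step is shared by exactly these
    leaves. *)
Definition nvec r : field := fun t => s * (t \in r)%:R.

Fixpoint nodes k (b : R) : seq field :=
  if k is k'.+1 then
    let b' := b + kap * 2 ^+ k' * (k'%:R + 2) in
    (nvec (leaves k' b) :: nodes k' b) ++ (nvec (leaves k' b') :: nodes k' b')
  else [::].

Lemma leaves_itv k b t : t \in leaves k b -> b <= t <= b + kap * k%:R * 2 ^+ k.
Proof.
elim: k b => [|k IH] b /=.
  by rewrite inE => /eqP ->; rewrite mulr0 mul0r addr0 lexx.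
have p0 : 0 < (2 : R) ^+ k by rewrite exprn_gt0.
have k0 : 0 <= (k%:R : R) by [].
have e1 : kap * k.+1%:R * 2 ^+ k.+1 = kap * 2 ^+ k * (k%:R + 2) + kap * k%:R * 2 ^+ k.
  by rewrite -natr1 exprS; ring.
have kp : 0 < kap * 2 ^+ k by rewrite mulr_gt0.
have p2 : 0 < kap * 2 ^+ k * (k%:R + 2) by rewrite mulr_gt0// ltr_wpDl.
rewrite mem_cat => /orP[] /IH /andP[h1 h2]; apply/andP; split => //.
- by rewrite e1; apply: le_trans h2 _; rewrite lerD2l lerDr ltW.
- by apply: le_trans h1; rewrite lerDl ltW.
- by rewrite e1 addrA.
Qed.

Lemma leaves_sep k b t u : t \in leaves k b ->
  u \in leaves k (b + kap * 2 ^+ k * (k%:R + 2)) -> kap * 2 ^+ k.+1 <= u - t.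
Proof.
move=> /leaves_itv/andP[_ h1] /leaves_itv/andP[h2 _].
have e1 : kap * 2 ^+ k * (k%:R + 2) = kap * k%:R * 2 ^+ k + kap * 2 ^+ k.+1.
  by rewrite exprS; ring.
by move: h1 h2; rewrite e1; lra.
Qed.

Lemma leaves_disj k b t : t \in leaves k b ->
  t \notin leaves k (b + kap * 2 ^+ k * (k%:R + 2)).
Proof.
move=> h1; apply/negP => h2; have := leaves_sep h1 h2; rewrite subrr leNgt.
by rewrite mulr_gt0// exprn_gt0.
Qed.

Lemma leaves_disj_sym k b t :
  t \in leaves k (b + kap * 2 ^+ k * (k%:R + 2)) -> t \notin leaves k b.
Proof. by move=> h; apply/negP => /leaves_disj; rewrite h. Qed.

Lemma nodes_vanish k b a t : a \in nodes k b -> t \notin leaves k b -> a t = 0.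
Proof.
elim: k b => [|k IH] b //=.
rewrite -cat_cons !mem_cat negb_or => H /andP[t1 t2].
case/orP: H => /in_consP[->|].
- by rewrite /nvec (negbTE t1) mulr0.
- by move/IH; apply.
- by rewrite /nvec (negbTE t2) mulr0.
- by move/IH; apply.
Qed.

Definition tcov l (t u : R) := \sum_(a <- l) a t * a u.

Lemma tcov_vanish k b t u : t \notin leaves k b -> tcov (nodes k b) t u = 0.
Proof.
move=> tn; rewrite /tcov big_seq big1// => a al.
by rewrite (nodes_vanish al tn) mul0r.
Qed.

Lemma tcovC l t u : tcov l t u = tcov l u t.
Proof. by apply: eq_bigr => a _; rewrite mulrC. Qed.

Lemma tcov_cat l l' t u : tcov (l ++ l') t u = tcov l t u + tcov l' t u.
Proof. by rewrite /tcov big_cat. Qed.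

Lemma tcov_cons a l t u : tcov (a :: l) t u = a t * a u + tcov l t u.
Proof. by rewrite /tcov big_cons. Qed.

Lemma tcov_diag k b t : t \in leaves k b -> tcov (nodes k b) t t = s ^+ 2 * k%:R.
Proof.
elim: k b => [|k IH] b /=; first by rewrite /tcov big_nil mulr0.
set b' := b + _; rewrite mem_cat -cat_cons tcov_cat !tcov_cons /nvec.
move=> /orP[tl|tr].
  have tn : t \notin leaves k b' by exact: leaves_disj.
  by rewrite (negbTE tn) tl (IH b)// tcov_vanish// -natr1 /=; ring.
have tn : t \notin leaves k b by exact: leaves_disj_sym.
by rewrite (negbTE tn) tr (IH b')// tcov_vanish// -natr1 /=; ring.
Qed.

(** [m] is the number of edges common to the paths to [t] and [u]. The two paths part below a node
    of height [k - m], whose two subtrees are at least [kap * 2 ^ (k - m)] apart by the choice of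
    gaps. *)
Lemma tcov_sep k b t u : t \in leaves k b -> u \in leaves k b -> t != u ->
  exists2 m : nat, tcov (nodes k b) t u = s ^+ 2 * m%:R &
    kap * 2 ^+ k <= `|t - u| * 2 ^+ m.
Proof.
elim: k b => [|k IH] b /=; first by rewrite !inE => /eqP -> /eqP ->; rewrite eqxx.
set b' := b + _; rewrite !mem_cat -cat_cons => + + tu.
have disj x : x \in leaves k b -> x \in leaves k b' = false.
  by move=> /leaves_disj/negbTE.
have disj' x : x \in leaves k b' -> x \in leaves k b = false.
  by move=> /leaves_disj_sym/negbTE.
move=> /orP[tl|tr] /orP[ul|ur].
- have [m hm1 hm2] := IH b tl ul tu; exists m.+1.
    rewrite tcov_cat !tcov_cons hm1 /nvec tl ul !disj// tcov_vanish ?disj//.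
    by rewrite -natr1 /=; ring.
  by rewrite !exprS mulrCA [leRHS]mulrCA ler_pM2l.
- exists 0%N.
    rewrite tcov_cat !tcov_cons /nvec tl ur disj// disj'// tcovC tcov_vanish ?disj'//.
    by rewrite tcov_vanish ?disj//=; ring.
  by rewrite expr0 mulr1 distrC; apply: le_trans (ler_norm _); exact: (leaves_sep tl ur).
- exists 0%N.
    rewrite tcov_cat !tcov_cons /nvec ul tr disj// disj'// tcov_vanish ?disj'//.
    by rewrite tcovC tcov_vanish ?disj//=; ring.
  by rewrite expr0 mulr1; apply: le_trans (ler_norm _); exact: (leaves_sep ul tr).
- have [m hm1 hm2] := IH b' tr ur tu; exists m.+1.
    rewrite tcov_cat !tcov_cons hm1 /nvec tr ur !disj'// tcov_vanish ?disj'//.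
    by rewrite -natr1 /=; ring.
  by rewrite !exprS mulrCA [leRHS]mulrCA ler_pM2l.
Qed.

Section values.
Variables beta c : R.
Hypothesis beta0 : 0 <= beta.

(** Smoothed probability that a tree of depth [k] started at height [y] has all leaves below [c]:
    the square comes from the two independent subtrees, the integral from the edge to each of
    them. *)
Fixpoint U k (y : R) : R :=
  if k is k'.+1 then (\int[gam]_z U k' (y + s * z)) ^+ 2
  else expR (- expR (beta * (y - c))).

Local Notation EF := (expF beta c).

Lemma gavgs_nodes k b w y : {in leaves k b, forall t, w t = y} ->
  gavgs (nodes k b) (EF (leaves k b)) w = U k y.
Proof.
elim: k b w y => [|k IH] b w y wy.
  by rewrite /expF /= big_seq1 wy// mem_head.
pose b' := b + kap * 2 ^+ k * (k%:R + 2).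
rewrite -[leaves k.+1 b]/(leaves k b ++ leaves k b') in wy *.
have van1 a : a \in nvec (leaves k b') :: nodes k b' -> {in leaves k b, forall t, a t = 0}.
  move=> al t tl.
  have tn : t \notin leaves k b' by exact: leaves_disj.
  move: al => /in_consP[->|/nodes_vanish]; last by apply.
  by rewrite /nvec (negbTE tn) mulr0.
have van2 a : a \in nvec (leaves k b) :: nodes k b -> {in leaves k b', forall t, a t = 0}.
  move=> al t tl.
  have tn : t \notin leaves k b by exact: leaves_disj_sym.
  move: al => /in_consP[->|/nodes_vanish]; last by apply.
  by rewrite /nvec (negbTE tn) mulr0.
rewrite -[nodes k.+1 b]/((nvec (leaves k b) :: nodes k b) ++ (nvec (leaves k b') :: nodes k b')).
rewrite gavgs_cat expF_cat.
rewrite (gavgs_dep_mul (nice_expF c (leaves k b') beta0) (@dep_expF beta c (leaves k b)) van1).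
rewrite (gavgs_mul_dep (nice_expF c (leaves k b) beta0) (dep_gavgs _ (@dep_expF beta c (leaves k b'))) van2).
rewrite -[U k.+1 y]/((\int[gam]_z U k (y + s * z)) ^+ 2) expr2 /=.
congr (_ * _); rewrite /gavg; apply: eq_Rintegral => z _; apply: IH => t tl.
- by rewrite wy ?mem_cat ?tl// /nvec tl mulr1 mulrC.
- by rewrite wy ?mem_cat ?tl ?orbT// /nvec tl mulr1 mulrC.
Qed.

Lemma U_ge0_le1 k y : 0 <= U k y <= 1.
Proof.
rewrite -(@gavgs_nodes k 0 (fun=> y))//.
by have [+ _ _] := nice_gavgs (nodes k 0) (nice_expF c (leaves k 0) beta0); apply.
Qed.

Lemma measurable_U k (p x : R) : measurable_fun [set: R] (fun z => U k (p + x * z)).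
Proof.
have [_ _ mF] := nice_gavgs (nodes k 0) (nice_expF c (leaves k 0) beta0).
have := mF _ R (fun z _ => p + x * z).
rewrite (_ : (fun z => U k (p + x * z)) =
  (fun z => gavgs (nodes k 0) (EF (leaves k 0)) (fun=> p + x * z))).
  by apply => t; apply: measurable_funD => //; apply: measurable_funM.
by apply/funext => z; rewrite (@gavgs_nodes k 0 (fun=> p + x * z) (p + x * z)).
Qed.

Lemma gint_U k (p x : R) : gint (fun z => U k (p + x * z)).
Proof.
apply: (@gint_bounded _ _ 1); first exact: measurable_U.
by move=> z; have /andP[h1 h2] := U_ge0_le1 k (p + x * z); rewrite ger0_norm.
Qed.

Lemma U_anti k y y' : y <= y' -> U k y' <= U k y.
Proof.
elim: k y y' => [|k IH] y y' yy' /=.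
  by rewrite ler_expR lerN2 ler_expR ler_wpM2l// lerD2r.
rewrite lerXn2r ?nnegrE//.
- by apply: Rintegral_ge0 => z _; have /andP[] := U_ge0_le1 k (y' + s * z).
- by apply: Rintegral_ge0 => z _; have /andP[] := U_ge0_le1 k (y + s * z).
- apply: le_Rintegral => //; [exact: gint_U|exact: gint_U|].
  by move=> z _; apply: IH; rewrite lerD2r.
Qed.

(** Trees start at 1, 3, 5, ... Under [kapk] each occupies an interval of length at most 1, so
    distinct trees are at distance at least 1 and may be treated as sharing no generation. *)
Fixpoint bleaves k n : seq R :=
  if n is n'.+1 then bleaves k n' ++ leaves k (1 + 2 * n'%:R) else [::].

Fixpoint bnodes k n : seq field :=
  if n is n'.+1 then bnodes k n' ++ nodes k (1 + 2 * n'%:R) else [::].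

Variable k : nat.
Hypothesis kapk : kap * k%:R * 2 ^+ k = 1.

Lemma bleaves_itv n t : t \in bleaves k n -> 1 <= t <= 2 * n%:R.
Proof.
elim: n => //= n IH; rewrite mem_cat => /orP[/IH/andP[h1 h2]|/leaves_itv].
  by rewrite h1 (le_trans h2)// ler_pM2l// ler_nat.
rewrite kapk -natr1 => /andP[h1 h2]; have n0 : 0 <= (n%:R : R) by [].
by apply/andP; split; lra.
Qed.

Lemma bleaves_far n t u : t \in bleaves k n -> u \in leaves k (1 + 2 * n%:R) -> 1 <= u - t.
Proof. move=> /bleaves_itv/andP[_ h1] /leaves_itv/andP[h2 _]; lra. Qed.

Lemma bleaves_disj n t : t \in bleaves k n -> t \notin leaves k (1 + 2 * n%:R).
Proof. by move=> h1; apply/negP => h2; have := bleaves_far h1 h2; rewrite subrr ler10. Qed.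

Lemma bleaves_disj_sym n t : t \in leaves k (1 + 2 * n%:R) -> t \notin bleaves k n.
Proof. by move=> h; apply/negP => /bleaves_disj; rewrite h. Qed.

Lemma bnodes_vanish n a t : a \in bnodes k n -> t \notin bleaves k n -> a t = 0.
Proof.
elim: n => //= n IH; rewrite !mem_cat negb_or => /orP[an|al] /andP[t1 t2].
  exact: IH.
exact: nodes_vanish al t2.
Qed.

Lemma gavgs_bnodes n w y : {in bleaves k n, forall t, w t = y} ->
  gavgs (bnodes k n) (EF (bleaves k n)) w = U k y ^+ n.
Proof.
elim: n => [|n IH] /= wy; first by rewrite /expF big_nil oppr0 expR0.
have van1 a : a \in nodes k (1 + 2 * n%:R) -> {in bleaves k n, forall t, a t = 0}.
  by move=> al t tl; apply: (nodes_vanish al); exact: bleaves_disj.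
have van2 a : a \in bnodes k n -> {in leaves k (1 + 2 * n%:R), forall t, a t = 0}.
  by move=> al t tl; apply: (bnodes_vanish al); exact: bleaves_disj_sym.
rewrite gavgs_cat expF_cat.
rewrite (gavgs_dep_mul (nice_expF c _ beta0) (@dep_expF beta c _) van1).
rewrite (gavgs_mul_dep (nice_expF c _ beta0) (dep_gavgs _ (@dep_expF beta c _)) van2).
rewrite exprSr IH; last by move=> t tl; rewrite wy// mem_cat tl.
by rewrite (@gavgs_nodes _ _ _ y)// => t tl; rewrite wy// mem_cat tl orbT.
Qed.

Lemma bcov_diag n t : t \in bleaves k n -> tcov (bnodes k n) t t = s ^+ 2 * k%:R.
Proof.
elim: n => //= n IH; rewrite mem_cat tcov_cat => /orP[tl|tr].
  rewrite IH// tcov_vanish ?addr0//; exact: bleaves_disj.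
rewrite tcov_diag// /tcov big_seq big1 ?add0r// => a al.
rewrite (bnodes_vanish al) ?mul0r//.
by exact: bleaves_disj_sym.
Qed.

Lemma bcov_sep n t u : t \in bleaves k n -> u \in bleaves k n -> t != u ->
  exists2 m : nat, tcov (bnodes k n) t u = s ^+ 2 * m%:R &
    1 <= k%:R * `|t - u| * 2 ^+ m.
Proof.
have kR : kap * 2 ^+ k * k%:R = 1 by rewrite -[RHS]kapk; ring.
have k1 : 1 <= (k%:R : R).
  rewrite ler1n lt0n; apply/eqP => k0; move: kR; rewrite k0 mulr0 => /eqP.
  by rewrite eq_sym oner_eq0.
elim: n => //= n IH; rewrite !mem_cat => + + tu.
have bvan x y : x \in leaves k (1 + 2 * n%:R) -> tcov (bnodes k n) x y = 0.
  move=> xl; rewrite /tcov big_seq big1// => a al.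
  by rewrite (bnodes_vanish al) ?mul0r//; exact: bleaves_disj_sym.
have nvan x y : x \in bleaves k n -> tcov (nodes k (1 + 2 * n%:R)) x y = 0.
  by move=> xl; rewrite tcov_vanish//; exact: bleaves_disj.
have far x y : x \in bleaves k n -> y \in leaves k (1 + 2 * n%:R) -> 1 <= k%:R * `|y - x| * 2 ^+ 0.
  move=> /bleaves_far/[apply] h; rewrite expr0 mulr1 -[leLHS]mulr1 ler_pM//.
  exact: le_trans h (ler_norm _).
move=> /orP[tl|tr] /orP[ul|ur].
- have [m h1 h2] := IH tl ul tu; exists m => //.
  by rewrite tcov_cat h1 nvan// addr0.
- exists 0%N; first by rewrite tcov_cat nvan// tcovC bvan// mulr0 addr0.
  by rewrite distrC; exact: far.
- exists 0%N; first by rewrite tcov_cat bvan// tcovC nvan// mulr0 addr0.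
  exact: far.
- have [m h1 h2] := tcov_sep tr ur tu; exists m.
    by rewrite tcov_cat h1 bvan// add0r.
  rewrite -[leLHS]kR mulrC -mulrA ler_wpM2l//.
Qed.

End values.
End tree.

(** * Success probability of a single critical tree *)

Section recursion.
Variable R : realType.
Local Notation gam := (normal_prob (0 : R) 1).
Local Notation gint f := (gam.-integrable setT (EFin \o f)).

(** In a field with covariance (1/2) log (1/|t-u|), halving the distance adds (log 2) / 2. For
    binary branching with this step variance s^2 the critical tilt sqrt (2 log 2 / s^2) is 2, as in
    [barrier_fun], and the speed sqrt (2 s^2 log 2) is log 2 per generation. *)
Definition step_sd : R := Num.sqrt (ln 2 / 2).
Local Notation s := step_sd.

Lemma step_sd2 : s ^+ 2 = ln 2 / 2.
Proof. by rewrite sqr_sqrtr// divr_ge0// ln_ge0// ler1n. Qed.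

Lemma step_sd_gt0 : 0 < s.
Proof. by rewrite sqrtr_gt0 divr_gt0// ln_gt0// ltr1n. Qed.

Let s0 := step_sd_gt0.

(* Standard deviation of the tilted walk after [k - 1/2] steps. *)
Definition walk_sd (k : nat) : R := s * Num.sqrt (k%:R - 1 / 2).

Let p k := walk_sd k.

Let half_gt0 k : 0 < (k.+1%:R : R) - 1 / 2.
Proof. by rewrite -natr1; have : 0 <= (k%:R : R) by []; lra. Qed.

Lemma walk_sd_gt0 k : 0 < p k.+1.
Proof. by rewrite mulr_gt0// sqrtr_gt0. Qed.

Lemma walk_sd_sqr k : p k.+1 ^+ 2 = s ^+ 2 * (k.+1%:R - 1 / 2).
Proof. by rewrite /p /walk_sd exprMn (sqr_sqrtr (ltW (half_gt0 k))). Qed.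

Lemma walk_sd_step k : s ^+ 2 = p k.+2 ^+ 2 - p k.+1 ^+ 2.
Proof. by rewrite !walk_sd_sqr -(natr1 k.+1); ring. Qed.

Lemma walk_sd_incr k : p k.+1 <= p k.+2.
Proof.
rewrite -(ler_pXn2r (n := 2))// ?nnegrE ?(ltW (walk_sd_gt0 _))//.
by rewrite -subr_ge0 -walk_sd_step sqr_ge0.
Qed.

(** If b^2 - a^2 = s^2 then 1/a - 1/b = s^2 / (a b (a + b)) >= s^2 / (2 b^3); so the cubes p_k^(-3)
    have bounded sums, by telescoping. *)
Lemma walk_sd_sum k : p k.+2 ^- 3 <= 2 / s ^+ 2 * ((p k.+1)^-1 - (p k.+2)^-1).
Proof.
have a0 := walk_sd_gt0 k; have b0 := walk_sd_gt0 k.+1; have ab := walk_sd_incr k.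
have sab := walk_sd_step k.
move: a0 b0 ab sab; move: (p k.+1) (p k.+2) => a b a0 b0 ab sab.
have s20 : 0 < s ^+ 2 by rewrite exprn_gt0.
have sn : s ^+ 2 != 0 by rewrite gt_eqF.
have an : a != 0 by rewrite gt_eqF.
have bn : b != 0 by rewrite gt_eqF.
have -> : 2 / s ^+ 2 * (a^-1 - b^-1) = 2 / ((b + a) * (a * b)).
  have ba : b + a != 0 by rewrite gt_eqF// addr_gt0.
  have ba' : b - a != 0 by apply: contra sn; rewrite sab subr_sqr => /eqP ->; rewrite mul0r.
  rewrite sab; have -> : b ^+ 2 - a ^+ 2 = (b - a) * (b + a) by rewrite subr_sqr.
  by field; rewrite an bn ba ba'.
rewrite ler_pdivlMr ?mulr_gt0 ?addr_gt0// [b ^- 3 * _]mulrC ler_pdivrMr ?exprn_gt0//.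
have h1 : (b + a) * (a * b) <= (2 * b) * (b * b).
  by apply: ler_pM; [lra|rewrite mulr_ge0// ltW|lra|rewrite ler_pM2r].
by apply: le_trans h1 _; rewrite le_eqVlt; apply/orP; left; apply/eqP; ring.
Qed.

(** 2/3 comes from [2 x / (1 + 2 x) >= 2 x / 3] for [x <= 1], [1 - expR (- 1)] is a lower bound for
    [1 - U 0] above level [c], the next two factors come from [gauss_tail], and [p 1 ^+ 3] cancels
    the denominator of the barrier. *)
Definition base_const : R :=
  2 / 3 * ((1 - expR (- 1)) * (normal_peak 1 * expR (- 1))) * p 1 ^+ 3.

Lemma base_const_gt0 : 0 < base_const.
Proof.
have e1 : 0 < 1 - expR (- 1) :> R by rewrite subr_gt0 expR_lt1; lra.
have n1 : 0 < (normal_peak 1 : R) by apply: normal_peak_gt0; rewrite oner_eq0.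
apply: mulr_gt0; last by apply: exprn_gt0; exact: walk_sd_gt0.
apply: mulr_gt0; first by lra.
by apply: mulr_gt0 => //; apply: mulr_gt0 => //; exact: expR_gt0.
Qed.

Section fixedc.
Variables beta c : R.
Hypothesis beta0 : 0 <= beta.
Local Notation U := (U s beta c).

Let x k y := 1 - \int[gam]_z U k (y + s * z).

Let x01 k y : 0 <= x k y <= 1.
Proof.
rewrite /x subr_ge0 lerBlDr lerDl; apply/andP; split.
  rewrite -[leRHS](gE_cst (1 : R)); apply: le_Rintegral => //.
  - exact: (gint_U s (@ltr01 R) c beta0).
  - exact: gint_cst.
  - by move=> z _; have /andP[] := U_ge0_le1 s (@ltr01 R) c beta0 k (y + s * z).
by apply: Rintegral_ge0 => z _; have /andP[] := U_ge0_le1 s (@ltr01 R) c beta0 k (y + s * z).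
Qed.

Let US k y : 2 * x k y / (1 + 2 * x k y) <= 1 - U k.+1 y.
Proof.
have /andP[h0 h1] := x01 k y.
rewrite -[U k.+1 y]/((\int[gam]_z U k (y + s * z)) ^+ 2).
have -> : \int[gam]_z U k (y + s * z) = 1 - x k y by rewrite /x opprB addrC subrK.
move: (x k y) h0 h1 => u u0 u1.
rewrite ler_pdivrMr ?ltr_wpDr ?mulr_ge0//; nra.
Qed.

Let xE k y : x k y = \int[gam]_z (1 - U k (y + s * z)).
Proof.
rewrite RintegralB//; [|exact: gint_cst|exact: (gint_U s (@ltr01 R) c beta0)].
by rewrite gE_cst.
Qed.

Let gi1U k y : gint (fun z => 1 - U k (y + s * z)).
Proof.
apply: (@gint_bounded _ _ 1).
  by apply: measurable_funB => //; exact: (measurable_U s (@ltr01 R) c beta0).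
move=> z; have /andP[h1 h2] := U_ge0_le1 s (@ltr01 R) c beta0 k (y + s * z).
by rewrite ger0_norm ?subr_ge0// lerBlDr lerDl.
Qed.

(** The extra [ln 2] makes the argument of the barrier equal to [ln 2] at [y = c - k ln 2], the
    height at which the bound is finally read; without it the barrier would vanish there. *)
Let bar k y := barrier_fun (p k) (c + ln 2 - k%:R * ln 2 - y).

Let base y : base_const * bar 1 y <= 1 - U 1 y.
Proof.
have p10 := walk_sd_gt0 0.
rewrite /bar mul1r addrK; set Z := c - y.
have q0 : 0 <= 1 - U 1 y by rewrite subr_ge0; have /andP[] := U_ge0_le1 s (@ltr01 R) c beta0 1 y.
have [Z0|Z0] := leP Z 0.
  have -> : barrier_fun (p 1) Z = 0; last by rewrite mulr0.
  by rewrite /barrier_fun max_r// !mul0r mulr0.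
have /andP[h0 h1] := x01 0 y.
apply: le_trans (US 0 y).
have e1 : 0 < 1 - expR (- 1) :> R by rewrite subr_gt0 expR_lt1; lra.
have tail : (1 - expR (- 1)) * (normal_peak 1 * expR (- 1) * expR (- (Z / s) ^+ 2)) <= x 0 y.
  rewrite xE; apply: gauss_tail.
  - by apply: measurable_funB => //; exact: (measurable_U s (@ltr01 R) c beta0).
  - move=> z; have /andP[u1 u2] := U_ge0_le1 s (@ltr01 R) c beta0 0 (y + s * z).
    by rewrite subr_ge0 u2 lerBlDr lerDl.
  - exact: ltW.
  - by rewrite divr_ge0// ltW.
  - move=> z; rewrite ler_pdivrMr// => hz; rewrite lerD2l lerN2 /= ler_expR lerN2.
    rewrite -[leLHS]expR0 ler_expR mulr_ge0//; rewrite /Z in hz; lra.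
have b1 : base_const * barrier_fun (p 1) Z <=
    2 / 3 * ((1 - expR (- 1)) * (normal_peak 1 * expR (- 1) * expR (- (Z / s) ^+ 2))).
  rewrite /barrier_fun max_l ?(ltW Z0)// /base_const.
  (* This is why [walk_sd] counts [k - 1/2] steps: [p 1 ^+ 2 = s ^+ 2 / 2] gives the first barrier
     the rate of [gauss_tail]. *)
  have -> : Z ^+ 2 / (2 * p 1 ^+ 2) = (Z / s) ^+ 2.
    rewrite walk_sd_sqr expr_div_n; field.
    by rewrite gt_eqF.
  have hZ : expR (- (2 * Z)) * Z <= 1.
    rewrite expRN mulrC ler_pdivrMr ?expR_gt0// mul1r.
    by apply: le_trans (expR_ge1Dx _); lra.
  set E := expR (- (Z / s) ^+ 2); set P := normal_peak 1 * expR (- 1).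
  have -> : 2 / 3 * ((1 - expR (- 1)) * P) * p 1 ^+ 3 * (expR (- (2 * Z)) * (Z * E / p 1 ^+ 3))
    = 2 / 3 * ((1 - expR (- 1)) * (P * E)) * (expR (- (2 * Z)) * Z).
    by field; rewrite gt_eqF.
  apply: ler_piMr => //.
  by rewrite !mulr_ge0 ?expR_ge0 ?normal_peak_ge0 ?(ltW e1).
apply: le_trans b1 _.
apply: (@le_trans _ _ (2 / 3 * x 0 y)); first by rewrite ler_wpM2l.
rewrite ler_pdivlMr ?ltr_wpDr ?mulr_ge0//; nra.
Qed.

Let A k := base_const^-1 + 2 / s ^+ 2 * ((p 1)^-1 - (p k)^-1).

Let A_gt0 k : 0 < A k.+1.
Proof.
rewrite ltr_pwDl ?invr_gt0 ?base_const_gt0// mulr_ge0 ?divr_ge0 ?sqr_ge0// subr_ge0.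
rewrite lef_pV2 ?posrE ?walk_sd_gt0//.
elim: k => // k IH; exact: le_trans IH (walk_sd_incr k).
Qed.

(* One generation turns the average [x] of [1 - U] into [2 * x - x ^+ 2 >= 2 * x / (1 + 2 * x)];
   the increments of [A] absorb the denominator and are summable since [bar k <= p k ^- 3]. *)
Lemma U_barrier k y : bar k.+1 y / A k.+1 <= 1 - U k.+1 y.
Proof.
elim: k y => [|k IH] y.
  by rewrite /A subrr mulr0 addr0 invrK mulrC; exact: base.
have pk := walk_sd_gt0 k; have pk1 := walk_sd_gt0 k.+1.
set Z := c + ln 2 - k.+2%:R * ln 2 - y.
have A0 := A_gt0 k; have A1 := A_gt0 k.+1.
have q0 : 0 <= 1 - U k.+2 y by rewrite subr_ge0; have /andP[] := U_ge0_le1 s (@ltr01 R) c beta0 k.+2 y.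
have [Z0|Z0] := leP Z 0.
  by rewrite /bar /barrier_fun -/Z max_r// !mul0r mulr0 mul0r.
have m0 : 0 <= bar k.+2 y by exact: barrier_fun_ge0.
have m1 : bar k.+2 y <= (p k.+2) ^- 3 by exact: barrier_fun_le.
have key : bar k.+2 y / A k.+1 <= 2 * x k.+1 y.
  have gb := gauss_barrier Z pk pk1 (walk_sd_step k).
  have i1 := @gint_barrier_fun R (p k.+1) (Z + 2 * s ^+ 2) s pk.
  have : (A k.+1)^-1 * \int[gam]_z barrier_fun (p k.+1) (Z + 2 * s ^+ 2 - s * z) <= x k.+1 y.
    rewrite -RintegralZl// xE; apply: le_Rintegral => //; first exact: gintZ.
    move=> z _; rewrite mulrC; have := IH (y + s * z); rewrite /bar.
    have -> : c + ln 2 - k.+1%:R * ln 2 - (y + s * z) = Z + 2 * s ^+ 2 - s * z.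
      by rewrite /Z step_sd2 -(natr1 k.+1); field.
    by [].
  have Ai : 0 <= (A k.+1)^-1 by rewrite invr_ge0 ltW.
  have := ler_wpM2l Ai gb.
  (* Criticality: the cost 1/2 of one tilted step is exactly made up by the two children. *)
  have -> : expR (- (2 * s ^+ 2)) = 2^-1.
    by rewrite step_sd2 mulrC divfK// expRN lnK// posrE.
  have -> : expR (- (2 * Z)) * (Z * expR (- (Z ^+ 2 / (2 * p k.+2 ^+ 2))) / p k.+2 ^+ 3) = bar k.+2 y.
    by rewrite /bar /barrier_fun -/Z max_l// ltW.
  move: (\int[gam]_z _) (x k.+1 y) => I X h1 h2; lra.
apply: le_trans (US k.+1 y).
have /andP[h0 h1] := x01 k.+1 y.
set m := bar k.+2 y in m0 m1 key *; set X := x k.+1 y in h0 h1 key *.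
have hA : A k.+1 + m <= A k.+2.
  have := walk_sd_sum k; rewrite -/(p _) => hs.
  have : A k.+2 = A k.+1 + 2 / s ^+ 2 * ((p k.+1)^-1 - (p k.+2)^-1) by rewrite /A; ring.
  by move=> ->; rewrite lerD2l; apply: le_trans m1 hs.
have hm : m <= 2 * X * A k.+1 by rewrite -ler_pdivrMr.
rewrite ler_pdivrMr// mulrAC ler_pdivlMr ?ltr_wpDr ?mulr_ge0//.
apply: (@le_trans _ _ (2 * X * (A k.+1 + m))).
  by rewrite mulrDr mulr1 [leRHS]mulrDr (mulrC m) lerD2r.
by rewrite ler_wpM2l// mulr_ge0.
Qed.

(** The barrier at argument [ln 2], made uniform in the depth: its Gaussian factor is smallest at
    [k = 1], [A k] stays below the last denominator, and [p k <= s * sqrt k] supplies [s ^+ 3] here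
    and the power -3/2 of the depth in [U_tail]. *)
Definition tail_const : R :=
  expR (- (2 * ln 2)) * (ln 2 * expR (- (ln 2 ^+ 2 / (2 * p 1 ^+ 2)))) / s ^+ 3 /
    (base_const^-1 + 2 / s ^+ 2 / p 1).

Lemma tail_const_gt0 : 0 < tail_const.
Proof.
have b0 := base_const_gt0; have p0 := walk_sd_gt0 0.
rewrite divr_gt0//.
  by rewrite divr_gt0 ?exprn_gt0// !mulr_gt0 ?expR_gt0// ln_gt0// ltr1n.
by rewrite addr_gt0 ?invr_gt0// !divr_gt0// exprn_gt0.
Qed.

Lemma U_tail k y : c - k.+1%:R * ln 2 <= y ->
  U k.+1 y <= 1 - tail_const / Num.sqrt k.+1%:R ^+ 3.
Proof.
move=> cy; apply: le_trans (U_anti s (@ltr01 R) c beta0 _ cy) _.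
rewrite lerBrDr addrC -lerBrDr; apply: le_trans (U_barrier k _).
rewrite /bar.
have -> : c + ln 2 - k.+1%:R * ln 2 - (c - k.+1%:R * ln 2) = ln 2 by ring.
have l20 : 0 < ln 2 :> R by rewrite ln_gt0// ltr1n.
rewrite /barrier_fun max_l ?(ltW l20)// /tail_const.
have p0 := walk_sd_gt0 0; have pk := walk_sd_gt0 k.
have p1k : p 1 <= p k.+1 by elim: (k) => // j IH; exact: le_trans IH (walk_sd_incr j).
have b0 := base_const_gt0.
set D := base_const^-1 + _ / p 1.
have AD : A k.+1 <= D.
  rewrite /A /D lerD2l ler_wpM2l ?divr_ge0 ?sqr_ge0//.
  by rewrite lerBlDr lerDl invr_ge0 ltW.
have D0 : 0 < D := lt_le_trans (A_gt0 k) AD.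
have sk0 : 0 < Num.sqrt (k.+1%:R : R) by rewrite sqrtr_gt0.
have pks : p k.+1 <= s * Num.sqrt k.+1%:R.
  by rewrite /p /walk_sd ler_pM2l// ler_sqrt// lerBlDr lerDl.
have e1 : expR (- (ln 2 ^+ 2 / (2 * p 1 ^+ 2))) <= expR (- (ln 2 ^+ 2 / (2 * p k.+1 ^+ 2))) :> R.
  have P1 : 0 < 2 * p 1 ^+ 2 := mulr_gt0 (ltr0Sn R 1) (exprn_gt0 2 p0).
  have P2 : 0 < 2 * p k.+1 ^+ 2 := mulr_gt0 (ltr0Sn R 1) (exprn_gt0 2 pk).
  rewrite ler_expR lerN2 ler_wpM2l ?sqr_ge0// lef_pV2 ?posrE//.
  by rewrite ler_pM2l// lerXn2r// nnegrE ltW.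
have qle : p k.+1 ^+ 3 <= s ^+ 3 * Num.sqrt k.+1%:R ^+ 3.
  by rewrite -exprMn lerXn2r// nnegrE ltW// mulr_gt0.
have q0 : 0 < p k.+1 ^+ 3 by rewrite exprn_gt0.
have t0 : 0 < Num.sqrt (k.+1%:R : R) ^+ 3 by rewrite exprn_gt0.
have s30 : 0 < s ^+ 3 by rewrite exprn_gt0.
have A0 := A_gt0 k.
move: e1 AD D0 A0 qle q0 t0 s30.
move: (expR (- (ln 2 ^+ 2 / (2 * p 1 ^+ 2)))) (expR (- (ln 2 ^+ 2 / (2 * p k.+1 ^+ 2))))
  D (A k.+1) (p k.+1 ^+ 3) (Num.sqrt (k.+1%:R : R) ^+ 3) (s ^+ 3) (expR_ge0 (- (ln 2 ^+ 2 / (2 * p 1 ^+ 2)))).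
move=> E1 E2 D A' q t s3 E10 e1 AD D0 A0 qle q0 t0 s30.
have e0 := expR_gt0 (- (2 * ln 2) : R).
move: (expR _) e0 => e e0.
have -> : e * (ln 2 * E1) / s3 / D / t = (e * ln 2) * (E1 * (s3 * t * D)^-1).
  by rewrite !invfM; ring.
have -> : e * (ln 2 * E2 / q) / A' = (e * ln 2) * (E2 * (q * A')^-1).
  by rewrite !invfM; ring.
rewrite ler_pM2l ?mulr_gt0//; apply: ler_pM => //.
  by rewrite invr_ge0 ltW// !mulr_gt0.
by rewrite lef_pV2 ?posrE ?mulr_gt0//; apply: ler_pM => //; exact: ltW.
Qed.

End fixedc.
End recursion.

(** * Many trees with a common Gaussian shift *)

Section tree_bound.
Variable R : realType.
Local Notation gam := (normal_prob (0 : R) 1).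
Local Notation gint f := (gam.-integrable setT (EFin \o f)).
Local Notation s := (step_sd R).

Lemma tree_bound (kap beta H sd : R) (k n : nat) : 0 < kap -> 0 <= beta -> 0 <= H ->
  kap * k.+1%:R * 2 ^+ k.+1 = 1 -> 0 < sd ->
  gavg (fun=> sd) (gavgs (bnodes kap s k.+1 n)
      (expF beta (k.+1%:R * ln 2 - H) (bleaves kap k.+1 n))) (fun=> 0)
  <= expR (- (H ^+ 2 / (2 * sd ^+ 2))) + expR (- (n%:R * (tail_const R / Num.sqrt k.+1%:R ^+ 3))).
Proof.
move=> kap0 beta0 H0 kapk sd0; set c := k.+1%:R * ln 2 - H.
set a := tail_const R / _; pose q := 1 - a.
(* The optimal exponent in the Chernoff bound for a shift below [- H]. Above [- H] each tree starts
   at least at [c - k.+1 ln 2], which is the range of [U_tail]. *)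
pose lam := H / sd ^+ 2.
have U01 y := U_ge0_le1 s kap0 c beta0 k.+1 y.
have sdn : sd != 0 by rewrite gt_eqF.
have q0 : 0 <= q.
  have := @U_tail R beta c beta0 k (c - k.+1%:R * ln 2) (lexx _).
  by apply: le_trans; have /andP[] := U01 (c - k.+1%:R * ln 2).
apply: (@le_trans _ _ (expR (- (H ^+ 2 / (2 * sd ^+ 2))) + q ^+ n)); last first.
  rewrite lerD2l -mulrN expRM_natl; apply: lerXn2r; rewrite ?nnegrE ?expR_ge0//.
  exact: expR_ge1Dx.
have gE : \int[gam]_z (expR (- (lam * H)) * expR (- (lam * sd) * z) + q ^+ n) =
    expR (- (H ^+ 2 / (2 * sd ^+ 2))) + q ^+ n.
  rewrite RintegralD//; [|by apply: gintZ; exact: gint_exp|exact: gint_cst].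
  rewrite gE_cst RintegralZl//; last exact: gint_exp.
  by rewrite gE_exp -expRD; congr (expR _ + _); rewrite /lam; field.
rewrite -gE; rewrite /gavg; apply: le_Rintegral => //.
- exact: nice_gint (nice_gavgs _ (nice_expF _ _ beta0)).
- apply: gintD; last exact: gint_cst.
  by apply: gintZ; exact: gint_exp.
move=> z _; rewrite (@gavgs_bnodes R kap s kap0 beta c beta0 k.+1 kapk n _ (z * sd)); last first.
  by move=> t _; rewrite add0r.
have e0 : 0 <= expR (- (lam * H)) * expR (- (lam * sd) * z) by rewrite mulr_ge0 ?expR_ge0.
have /andP[u0 u1] := U01 (z * sd).
have [hz|hz] := leP (- H) (z * sd).
  apply: (@le_trans _ _ (q ^+ n)); last by rewrite lerDr.
  apply: lerXn2r; rewrite ?nnegrE//.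
  by apply: U_tail => //; apply: le_trans hz; rewrite /c addrAC subrr add0r.
apply: (@le_trans _ _ 1); first exact: exprn_ile1.
apply: (@le_trans _ _ (expR (- (lam * H)) * expR (- (lam * sd) * z))); last first.
  by rewrite lerDl exprn_ge0.
rewrite -expRD -[leLHS]expR0 ler_expR.
have -> : - (lam * H) + - (lam * sd) * z = lam * (- H - z * sd) by ring.
apply: mulr_ge0; first by rewrite divr_ge0// exprn_ge0// ltW.
by rewrite subr_ge0 ltW.
Qed.

End tree_bound.

(** * From the random prime sum to Gaussian averages *)

Section law.
Context d (T : measurableType d) (R : realType) (P : probability T R).
Local Notation gam := (normal_prob (0 : R) 1).

(* The sub-sigma-algebra generated by [G] is carried by [T] itself, so the pair
   (X, identity) has a product law and Fubini applies. *)
Lemma indep_fubini (G : set (set T)) (X : {RV P >-> R})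
    (f : R * g_sigma_algebraType G -> R) :
  G `<=` measurable -> setI_closed G -> G setT -> standard_normal X ->
  (forall A C, measurable A -> G C ->
     P (X @^-1` A `&` C) = (P (X @^-1` A) * P C)%E) ->
  measurable_fun setT f -> (forall p, 0 <= f p) ->
  (\int[P]_w (f (X w, w))%:E = \int[gam]_z \int[P]_w (f (z, w))%:E)%E.
Proof.
move=> Gm GI GT nX ind mf f0.
pose S := g_sigma_algebraType G.
have SG : forall C : set S, measurable C -> d.-measurable (C : set T).
  move=> C; apply: smallest_sub => //; exact: sigma_algebra_measurable.
pose i : T -> S := fun w => w.
have mi : measurable_fun setT i by move=> _ C mC; rewrite setTI; exact: SG.
have mX : measurable_fun setT (X : T -> R) by exact: measurable_funP.
pose h : T -> R * S := fun w => (X w, i w).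
have mh : measurable_fun setT h by apply/measurable_fun_pairP; split.
pose I : {RV P >-> S} := HB.pack i (isMeasurableFun.Build _ _ _ _ i mi).
pose J : {RV P >-> (R * S)%type} := HB.pack h (isMeasurableFun.Build _ _ _ _ h mh).
have indS A C : measurable A -> measurable (C : set S) ->
    P (X @^-1` A `&` C) = (P (X @^-1` A) * P C)%E.
  move=> mA mC.
  have mXA : measurable (X @^-1` A) by rewrite -[X in measurable X]setTI; exact: mX.
  have fin : P (X @^-1` A) \is a fin_num by exact: fin_num_measure.
  pose r : {nonneg R} := NngNum (fine_ge0 (measure_ge0 P (X @^-1` A))).
  have := @g_sigma_algebra_measure_unique _ _ _ G Gm (fun=> setT) _ _ (mrestr P mXA) (mscale r P) GI.
  move=> U; have {}U := U (fun=> GT).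
  have cover : \bigcup_(k : nat) setT = [set: T] by rewrite -subTset => x _; exists 0%N.
  have agree A0 : G A0 -> mrestr P mXA A0 = mscale r P A0.
    by move=> GA0; rewrite /mrestr /mscale /= [A0 `&` _]setIC ind// fineK.
  have fin1 : nat -> (mrestr P mXA setT < +oo)%E.
    by move=> _; rewrite /mrestr setTI (le_lt_trans (probability_le1 _ _))// ltry.
  have eq1 : mrestr P mXA C = mscale r P C by exact: (U cover agree fin1).
  by rewrite setIC; apply: etrans eq1 _; rewrite /mscale /= fineK.
have law A : measurable A -> distribution P X A = gam A by exact: nX.
have eqJ E : measurable E -> distribution P J E = (distribution P X \x distribution P I)%E E.
  move=> mE; apply: esym.
  apply: (@product_measure_unique _ _ _ _ R _ _ (distribution P J) _ E mE) => A B mA mB.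
  exact: (indS A B mA mB).
transitivity (\int[distribution P J]_p (f p)%:E)%E.
  by rewrite ge0_integral_distribution//; exact: measurable_EFin.
rewrite (eq_measure_integral (distribution P X \x distribution P I)%E); last by move=> E mE _; exact: eqJ.
have f0E p : (0 <= (f p)%:E)%E by rewrite lee_fin.
rewrite (fubini_tonelli1 (fun p => (f p)%:E) (measurable_EFin mf) f0E).
have mid : @measurable_fun _ _ (measurableTypeR R) R setT (fun x => x).
  move=> _ A mA; rewrite setTI; exact: mA.
pose Z : {RV gam >-> R} := HB.pack (fun x : measurableTypeR R => (x : R)) (isMeasurableFun.Build _ _ _ _ _ mid).
transitivity (\int[distribution P X]_z \int[P]_w (f (z, w))%:E)%E; last first.
  rewrite (eq_measure_integral (distribution gam Z)); last first.
    by move=> A mA _; first [exact: (law A mA)|exact: (esym (law A mA))].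
  rewrite ge0_integral_distribution//; last first.
    by move=> z; apply: integral_ge0 => w _; rewrite lee_fin.
  have := measurable_fun_fubini_tonelli_F (m2 := distribution P I) _ (measurable_EFin mf) f0E.
  apply: eq_measurable_fun => z _; rewrite /fubini_F ge0_integral_distribution//.
  apply: measurable_EFin; apply: (measurableT_comp mf); exact: measurable_pair1.
apply: eq_integral => z _; rewrite /fubini_F ge0_integral_distribution//.
by apply: measurable_EFin; apply: (measurableT_comp mf); exact: measurable_pair1.
Qed.

Variable g : nat -> {RV P >-> R}.
Hypothesis g_normal : forall p : nat, prime p -> standard_normal (g p).
Hypothesis g_indep : mutually_independent [set p : nat | prime p] g.

(** One prime is integrated out at a time. [G] is the class of cylinder events of the remaining
    primes, closed under intersection, and [indep_fubini] replaces [g p] by a separate normal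
    variable. *)
Lemma law_gavgs (F : (R -> R) -> R) (ps : seq nat) (a : nat -> R -> R) (v : R -> R) :
  nice F -> uniq ps -> all prime ps ->
  (\int[P]_w (F (fun t => v t + \sum_(p <- ps) g p w * a p t)%R)%:E =
   (gavgs (map a ps) F v)%:E)%E.
Proof.
move=> nF; elim: ps v => [|p ps IH] v /=.
  move=> _ _; rewrite (eq_integral (cst (F v)%:E)); last first.
    by move=> w _; congr (F _)%:E; apply/funext => t; rewrite big_nil addr0.
  rewrite integral_cst// -[RHS]mule1; congr (_ * _)%E; exact: (@probability_setT _ _ _ P).
move=> /andP[pps ups] /andP[pp aps].
pose G : set (set T) := [set C | exists B : nat -> set R, (forall q, measurable (B q)) /\
  C = \bigcap_(q in [set` [fset x in ps]%fset]) (g q @^-1` B q)].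
have mg q : measurable_fun setT (g q : T -> R) by exact: measurable_funP.
have mgB q (B : set R) : measurable B -> measurable (g q @^-1` B).
  by move=> mB; rewrite -[X in measurable X]setTI; exact: mg.
have Gm : G `<=` measurable.
  move=> _ [B [mB ->]]; apply: bigcap_measurableType => q _; exact: mgB.
have GI : setI_closed G.
  move=> _ _ [B [mB ->]] [B' [mB' ->]]; exists (fun q => B q `&` B' q); split.
    by move=> q; exact: measurableI.
  rewrite -bigcapI; apply: eq_bigcapr => q _; by rewrite preimage_setI.
have GT : G setT.
  exists (fun=> setT); split => //; rewrite bigcapT// => q _; exact: preimage_setT.
have ind A C : measurable A -> G C -> P (g p @^-1` A `&` C) = (P (g p @^-1` A) * P C)%E.
  move=> mA [B [mB ->]].
  (* The product rule is used for [p] together with [ps] and for [ps] alone; [B'] agrees with [B] on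
     [ps], so the factors over [ps] are the same. *)
  pose B' q := if q == p then A else B q.
  have mB' q : measurable (B' q) by rewrite /B'; case: ifP.
  have sub : [set` [fset x in ps]%fset] `<=` [set p : nat | prime p].
    by move=> q /=; rewrite !inE => /(allP aps).
  have pn : p \notin [fset x in ps]%fset by rewrite !inE.
  have sub' : [set` (p |` [fset x in ps])%fset] `<=` [set p : nat | prime p].
    by move=> q /=; rewrite !inE => /orP[/eqP ->//|/(allP aps)].
  have Bp : B' p = A by rewrite /B' eqxx.
  have eB : \bigcap_(q in [set` [fset x in ps]%fset]) (g q @^-1` B' q) =
      \bigcap_(q in [set` [fset x in ps]%fset]) (g q @^-1` B q).
    apply: eq_bigcapr => q /=; rewrite !inE => qps; rewrite /B'; case: eqP => // qp.
    by move: pps; rewrite -qp qps.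
  have := g_indep sub' (fun q _ => mB' q).
  rewrite big_fsetU1//= set_fsetU1 bigcap_setU1 Bp -(g_indep sub (fun q _ => mB' q)).
  by rewrite eB.
pose f (zw : R * g_sigma_algebraType G) : R :=
  F (fun t => v t + zw.1 * a p t + \sum_(q <- ps) g q zw.2 * a q t).
have F0 u : 0 <= F u by case: nF => nF _ _; have /andP[] := nF u.
have mgS q : q \in ps -> measurable_fun setT (g q : g_sigma_algebraType G -> R).
  move=> qps _ B mB; rewrite setTI; apply: sub_sigma_algebra.
  exists (fun x => if x == q then B else setT); split; first by move=> x; case: ifP.
  rewrite eqEsubset; split => w /=.
    by move=> gw x /= _; case: eqP => [->|].
  by move=> /(_ q); rewrite /= eqxx; apply; rewrite !inE.
have mf : measurable_fun setT f.
  case: nF => _ _; apply => t; apply: measurable_funD.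
    by apply: measurable_funD => //; apply: measurable_funM.
  (* Membership in [ps] is recorded in each summand, because measurability for the generated
     sigma-algebra is known only for these [g q]. *)
  rewrite (_ : (fun s : R * g_sigma_algebraType G => \sum_(q <- ps) g q s.2 * a q t) =
     (fun s => \sum_(q <- ps) (if q \in ps then g q s.2 * a q t else 0))); last first.
    by apply/funext => x; rewrite big_seq [RHS]big_seq; apply: eq_bigr => q ->.
  apply: measurable_sum => q; case: (boolP (q \in ps)) => [qps|_] //.
  apply: measurable_funM => //.
  by apply: (@measurableT_comp _ _ _ _ _ _ (g q : g_sigma_algebraType G -> R)) => //; exact: mgS.
have f0 zw : 0 <= f zw by exact: F0.
transitivity (\int[P]_w (f (g p w, w))%:E)%E.
  apply: eq_integral => w _; congr (F _)%:E; apply/funext => t.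
  by rewrite big_cons addrA.
rewrite (indep_fubini Gm GI GT (g_normal pp) ind mf f0).
transitivity (\int[gam]_z (gavgs (map a ps) F (fun t => v t + z * a p t))%:E)%E.
  by apply: eq_integral => z _; rewrite -IH.
by rewrite gavg_EFin//; exact: nice_gavgs.
Qed.

End law.

(** * The event of the theorem and its probability *)

Section sup_event.
Context d (T : measurableType d) (R : realType) (P : probability T R).
Variable g : nat -> {RV P >-> R}.

Definition prime_vec (x : R) (p : nat) (t : R) : R :=
  cos (t * ln p%:R) / p%:R `^ (1 / 2 + 1 / ln x).

Definition primes_upto (x : R) : seq nat :=
  [seq p <- index_iota 0 (Num.truncn x).+1 | prime p].

Lemma random_prime_sumE x t w : random_prime_sum g x t w =
  \sum_(p <- primes_upto x) g p w * prime_vec x p t.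
Proof. by rewrite /random_prime_sum /primes_upto big_filter. Qed.

Lemma all_primes_upto x : all prime (primes_upto x).
Proof. exact: filter_all. Qed.

Lemma uniq_primes_upto x : uniq (primes_upto x).
Proof. by rewrite filter_uniq// iota_uniq. Qed.

Lemma continuous_random_prime_sum x w : continuous (fun t => random_prime_sum g x t w).
Proof.
rewrite (_ : (fun t => _) = (fun t => \sum_(p <- primes_upto x) g p w * prime_vec x p t)).
  elim: (primes_upto x) => [|p ps IH].
    rewrite (_ : (fun t => _) = cst 0); first exact: cst_continuous.
    by apply/funext => t; rewrite big_nil.
  rewrite (_ : (fun t => _) = (fun t => g p w * prime_vec x p t + \sum_(p <- ps) g p w * prime_vec x p t)).
    move=> t; apply: cvgD; last exact: IH.
    apply: cvgM; first exact: cvg_cst.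
    apply: cvgM; last exact: cvg_cst.
    apply: (@continuous_comp _ _ _ (fun t : R => t * ln p%:R) cos).
      by apply: cvgM; [exact: cvg_id|exact: cvg_cst].
    exact: continuous_cos.
  by apply/funext => t; rewrite big_cons.
by apply/funext => t; rewrite random_prime_sumE.
Qed.

Lemma measurable_random_prime_sum x t : measurable_fun setT (random_prime_sum g x t).
Proof.
rewrite (_ : random_prime_sum g x t =
  (fun w => \sum_(p <- primes_upto x) g p w * prime_vec x p t)); last first.
  by apply/funext => w; rewrite random_prime_sumE.
by apply: measurable_sum => p; apply: measurable_funM => //; exact: measurable_funP.
Qed.

Definition sup_event (x b c : R) : set T :=
  [set w : T | sup [set random_prime_sum g x t w | t in `[1, b]] <= c].

(** [sup] is a genuine supremum only on a nonempty set with an upper bound; the finite sum of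
    absolute values is such a bound, and [1 <= b] gives a point. *)
Lemma sup_eventP x b c w : 1 <= b ->
  sup_event x b c w <-> forall t, 1 <= t <= b -> random_prime_sum g x t w <= c.
Proof.
move=> b1; rewrite /sup_event /=; split => H.
  move=> t tb; apply: le_trans H; apply: ub_le_sup; last first.
    by exists t => //=; rewrite in_itv.
  exists (\sum_(p <- primes_upto x) `|g p w| * `|p%:R `^ (1 / 2 + 1 / ln x)|^-1) => _ [u _ <-].
  rewrite random_prime_sumE; apply: ler_sum => p _.
  apply: le_trans (ler_norm _) _; rewrite normrM ler_wpM2l// /prime_vec normrM.
  by rewrite normfV ler_piMl ?invr_ge0// ler_norml cos_geN1 cos_le1.
apply: ge_sup.
  by exists (random_prime_sum g x 1 w), 1 => //=; rewrite in_itv/= lexx.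
by move=> _ [t /= + <-]; rewrite in_itv/=; exact: H.
Qed.

(** By continuity in [t] a violation spreads to a neighbourhood, which contains a rational of the
    open interval ]1, b[ since [1 < b]; so the complement is a countable union. *)
Lemma measurable_sup_event x b c : 1 < b -> measurable (sup_event x b c).
Proof.
move=> b1.
have -> : sup_event x b c =
    ~` \bigcup_(q : rat) [set w | (1 < (ratr q : R) < b) && (c < random_prime_sum g x (ratr q) w)].
  apply/seteqP; split => w.
    move=> /(sup_eventP _ _ _ (ltW b1)) H [q _ /= /andP[/andP[q1 qb]]].
    by rewrite ltNge H// (ltW q1) ltW.
  move=> H; apply/(sup_eventP _ _ _ (ltW b1)) => t /andP[t1 tb].
  rewrite leNgt; apply/negP => ct.
  have := @continuous_random_prime_sum x w t.
  move=> /cvgrPdist_lt/(_ (random_prime_sum g x t w - c)).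
  rewrite subr_gt0 => /(_ ct)[e /= e0 He].
  have lt1 : Num.max 1 (t - e) < Num.min b (t + e).
    by rewrite lt_min !gt_max; apply/andP; split; apply/andP; split; lra.
  have [q] := rat_in_itvoo lt1; rewrite in_itv/= gt_max lt_min.
  move=> /andP[/andP[q1 qe] /andP[qb qe']].
  apply: H; exists q => //=; rewrite q1 qb/=.
  have := He (ratr q); rewrite /ball_ /= => /(_ _)/wrap[].
    by rewrite ltr_norml; apply/andP; split; lra.
  by move=> h; have := le_lt_trans (ler_norm _) h; lra.
apply: measurableC; apply: bigcupT_measurable_rat => q.
case: (boolP (1 < (ratr q : R) < b)) => qb; last first.
  rewrite (_ : [set w | _] = set0)//; apply/seteqP; split => w //=.
rewrite (_ : [set w | _] = random_prime_sum g x (ratr q) @^-1` `]c, +oo[); last first.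
  by apply/seteqP; split => w /=; rewrite in_itv/= andbT.
rewrite -[X in measurable X]setTI; apply: measurable_random_prime_sum => //.
Qed.

Hypothesis g_normal : forall p : nat, prime p -> standard_normal (g p).
Hypothesis g_indep : mutually_independent [set p : nat | prime p] g.

(* On the event, each of the [size r] terms [expR (beta * (S_t - c'))] is at most
   [expR (- beta)], so [expF] is at least [expR (- 1)] there. *)
Lemma sup_event_le x b c c' beta (kap : R -> R) (r : seq R) :
  1 < b -> 0 <= beta -> 0 <= c -> c + 1 <= c' -> (forall t, 0 <= kap t <= 1) ->
  {in r, forall t, 1 <= t <= b} -> (size r)%:R <= expR beta ->
  fine (P (sup_event x b c)) <=
    expR 1 * gavgs (map (fun p t => kap t * prime_vec x p t) (primes_upto x))
      (expF beta c' r) (fun=> 0).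
Proof.
move=> b1 beta0 c0 cc kap01 rb rs.
have nF := nice_expF c' r beta0.
have L := law_gavgs g_normal g_indep (fun p t => kap t * prime_vec x p t) (fun=> 0) nF
  (uniq_primes_upto x) (all_primes_upto x).
have mE := measurable_sup_event x c b1.
rewrite -lee_fin fineK; last exact: fin_num_measure.
rewrite EFinM -L.
have mF : measurable_fun setT (fun w => expF beta c' r
    (fun t => 0 + \sum_(p <- primes_upto x) g p w * (kap t * prime_vec x p t))).
  have [_ _] := nF; apply => t; apply: measurable_funD => //.
  by apply: measurable_sum => p; apply: measurable_funM => //; exact: measurable_funP.
have F0 u : 0 <= expF beta c' r u by have /andP[] := expF_ge0_le1 beta c' r u.
rewrite -ge0_integralZl//; last 2 first.
- exact: (measurable_EFin mF).
- by move=> w _; rewrite lee_fin.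
rewrite -[X in P X]setIT -integral_indic//.
apply: ge0_le_integral => //=.
- by apply/measurable_EFinP; exact: measurable_indic.
- by apply: measurable_EFin; apply: measurable_funM.
move=> w _; rewrite lee_fin indicE; case: (boolP (w \in _)); last first.
  by move=> _; rewrite mulr_ge0 ?expR_ge0.
rewrite inE => /(sup_eventP _ _ _ (ltW b1)) H /=.
rewrite /expF -expRD -[leLHS]expR0 ler_expR subr_ge0.
apply: (@le_trans _ _ (\sum_(t <- r) expR (- beta))).
  rewrite big_seq [leRHS]big_seq; apply: ler_sum => t tr; rewrite ler_expR.
  have := H t (rb t tr); rewrite random_prime_sumE => h.
  rewrite -[leRHS]mulrN1; apply: ler_wpM2l => //.
  under eq_bigr do rewrite mulrCA.
  rewrite -mulr_sumr; have /andP[k0 k1] := kap01 t.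
  have : kap t * (\sum_(p <- primes_upto x) g p w * prime_vec x p t) <= c.
    apply: le_trans (ler_wpM2l k0 h) _; rewrite ler_piMl//.
  lra.
rewrite big_const_seq count_predT iter_addr_0 -[X in X <= _]mulr_natl.
by rewrite expRN ler_pdivrMr ?expR_gt0// mul1r.
Qed.

End sup_event.

(** * The zeta function near the line Re = 1 *)

Section zeta_sums.
Variable R : realType.
Implicit Types (s u a b x y : R) (z w : R[i]).

Definition cnorm z : R := Normc.normc z.

Lemma cnormM z w : cnorm (z * w) = cnorm z * cnorm w.
Proof. exact: Normc.normcM. Qed.

Lemma cnormD z w : cnorm (z + w) <= cnorm z + cnorm w.
Proof. exact: (@le_normcD R z w). Qed.

Lemma cnormN z : cnorm (- z) = cnorm z.
Proof. exact: (@normcN R z). Qed.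

Lemma cnormB z w : cnorm (z - w) <= cnorm z + cnorm w.
Proof. by rewrite -(cnormN w); exact: cnormD. Qed.

Lemma cnorm0 : cnorm 0 = 0. Proof. exact: Normc.normc0. Qed.
Lemma cnorm1 : cnorm 1 = 1. Proof. exact: Normc.normc1. Qed.

Lemma cnorm_ge0 z : 0 <= cnorm z.
Proof. by case: z => a b; exact: sqrtr_ge0. Qed.

Lemma cnorm_real x : cnorm (Complex x 0) = `|x|.
Proof. by rewrite /cnorm /= expr0n/= addr0 sqrtr_sqr. Qed.

Lemma cnorm_sqr a b : cnorm (Complex a b) ^+ 2 = a ^+ 2 + b ^+ 2.
Proof. by rewrite /cnorm /= sqr_sqrtr// addr_ge0 ?sqr_ge0. Qed.

Lemma cnorm_le a b : cnorm (Complex a b) <= `|a| + `|b|.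
Proof.
rewrite -(ler_pXn2r (n := 2))// ?nnegrE ?cnorm_ge0 ?addr_ge0//.
rewrite cnorm_sqr -(real_normK (num_real a)) -(real_normK (num_real b)).
by have := mulr_ge0 (normr_ge0 a) (normr_ge0 b); move: `|a| `|b| => p q; nra.
Qed.

Lemma cnorm_geRe a b : `|a| <= cnorm (Complex a b).
Proof.
rewrite -(ler_pXn2r (n := 2))// ?nnegrE ?cnorm_ge0//.
by rewrite cnorm_sqr real_normK ?num_real// lerDl sqr_ge0.
Qed.

Lemma cnorm_geIm a b : `|b| <= cnorm (Complex a b).
Proof.
rewrite -(ler_pXn2r (n := 2))// ?nnegrE ?cnorm_ge0//.
by rewrite cnorm_sqr real_normK ?num_real// lerDr sqr_ge0.
Qed.

Lemma cnorm_sum I (r : seq I) (Q : pred I) (f : I -> R[i]) :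
  cnorm (\sum_(i <- r | Q i) f i) <= \sum_(i <- r | Q i) cnorm (f i).
Proof.
elim/big_ind2: _ => // [|z x w y zx wy]; first by rewrite cnorm0.
exact: le_trans (cnormD _ _) (lerD zx wy).
Qed.

Definition cexp a b : R[i] := Complex (expR a * cos b) (expR a * sin b).

Lemma cexpD a b a' b' : cexp (a + a') (b + b') = cexp a b * cexp a' b'.
Proof.
rewrite /cexp expRD cosD sinD; apply/eqP; rewrite eq_complex /=.
by apply/andP; split; apply/eqP; ring.
Qed.

Lemma cnorm_cexp a b : cnorm (cexp a b) = expR a.
Proof.
apply/eqP; rewrite -(eqrXn2 (n := 2)) ?cnorm_ge0 ?expR_ge0//.
by rewrite cnorm_sqr !exprMn -mulrDr cos2Dsin2 mulr1.
Qed.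

(* [n ^ (-1-w)] and [n ^ (-w)] for [w = s + iu]. *)
Definition zterm s u (n : nat) : R[i] := cexp (- ((1 + s) * ln n%:R)) (- (u * ln n%:R)).
Definition wterm s u (n : nat) : R[i] := cexp (- (s * ln n%:R)) (- (u * ln n%:R)).

Definition eterm s (n : nat) : R := expR (- ((1 + s) * ln n%:R)).
Definition dterm s (n : nat) : R := expR (- (s * ln n%:R)).

Lemma cnorm_zterm s u n : cnorm (zterm s u n) = eterm s n.
Proof. exact: cnorm_cexp. Qed.

Lemma cnorm_wterm s u n : cnorm (wterm s u n) = dterm s n.
Proof. exact: cnorm_cexp. Qed.

Lemma eterm_ge0 s n : 0 <= eterm s n. Proof. exact: expR_ge0. Qed.

Lemma dterm_ge0 s n : 0 <= dterm s n. Proof. exact: expR_ge0. Qed.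

Lemma ln_nat_ge0 (n : nat) : 0 <= ln (n%:R : R).
Proof. by case: n => [|n]; [rewrite ln0|rewrite ln_ge0// ler1n]. Qed.

Lemma ztermM s u m n : (0 < m)%N -> (0 < n)%N ->
  zterm s u (m * n) = zterm s u m * zterm s u n.
Proof.
move=> m0 n0; rewrite /zterm natrM lnM ?posrE ?ltr0n//.
by rewrite -cexpD; congr cexp; ring.
Qed.

Lemma expRN_ln_nat n : (0 < n)%N -> expR (- ln (n%:R : R)) = n%:R^-1.
Proof. by move=> n0; rewrite expRN lnK// posrE ltr0n. Qed.

Lemma etermE s n : (0 < n)%N -> eterm s n = n%:R^-1 * dterm s n.
Proof.
by move=> n0; rewrite -expRN_ln_nat// /eterm /dterm -expRD; congr expR; ring.
Qed.

Lemma ztermE s u n : (0 < n)%N -> zterm s u n = Complex n%:R^-1 0 * wterm s u n.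
Proof.
move=> n0; rewrite -expRN_ln_nat// /zterm /wterm.
have -> : Complex (expR (- ln (n%:R : R))) 0 = cexp (- ln n%:R) 0.
  by rewrite /cexp cos0 sin0 mulr1 mulr0.
by rewrite -cexpD; congr cexp; ring.
Qed.

Lemma dterm_le1 s n : 0 <= s -> dterm s n <= 1.
Proof. by move=> s0; rewrite expR_le1 oppr_le0 mulr_ge0// ln_nat_ge0. Qed.

Lemma eterm_le s n : 0 <= s -> (0 < n)%N -> eterm s n <= n%:R^-1.
Proof. by move=> s0 n0; rewrite etermE// ler_piMr ?invr_ge0// dterm_le1. Qed.

Definition lnstep (n : nat) : R := ln n.+1%:R - ln n%:R.

Lemma lnstep_le n : (0 < n)%N -> lnstep n <= n%:R^-1.
Proof.
move=> n0; have n0' : 0 < (n%:R : R) by rewrite ltr0n.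
rewrite /lnstep -ln_div ?posrE ?ltr0n//.
have -> : n.+1%:R / n%:R = 1 + n%:R^-1 :> R by rewrite -natr1 mulrDl divff ?gt_eqF// mul1r.
by apply: le_ln1Dx; rewrite (lt_trans (ltrN10 R))// invr_gt0.
Qed.

Lemma lnstep_ge n : (0 < n)%N -> n.+1%:R^-1 <= lnstep n.
Proof.
move=> n0; have n0' : 0 < (n%:R : R) by rewrite ltr0n.
have n1' : 0 < (n.+1%:R : R) by rewrite ltr0n.
rewrite /lnstep -[leRHS]opprB lerNr -ln_div ?posrE//.
have -> : n%:R / n.+1%:R = 1 + - n.+1%:R^-1 :> R.
  by rewrite -[in LHS](addrK 1 n%:R) natr1 mulrDl divff ?gt_eqF// mulN1r.
apply: le_ln1Dx; rewrite ltrN2 invf_lt1//.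
by rewrite ltr1n.
Qed.

Lemma lnstep_ge0 n : (0 < n)%N -> 0 <= lnstep n.
Proof. by move=> n0; apply: le_trans (lnstep_ge n0); rewrite invr_ge0. Qed.

Lemma dterm_step s n : dterm s n.+1 = dterm s n * expR (- (s * lnstep n)).
Proof. by rewrite /dterm -expRD; congr expR; rewrite /lnstep; ring. Qed.

(** One half of the integral test for x^(-1-s), whose primitive is - x^(-s) / s; [eterm_lower] is
    the other half. *)
Lemma eterm_upper s n : 0 < s -> (0 < n)%N ->
  eterm s n.+1 <= s^-1 * (dterm s n - dterm s n.+1).
Proof.
move=> s0 n0; rewrite mulrC ler_pdivlMr// etermE//.
have -> : dterm s n = dterm s n.+1 * expR (s * lnstep n).
  by rewrite dterm_step -mulrA -expRD addrC subrr expR0 mulr1.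
rewrite -[X in _ <= _ - X]mulr1 -mulrBr mulrC mulrA mulrC ler_wpM2l ?dterm_ge0//.
rewrite lerBrDl; apply: le_trans (expR_ge1Dx _).
by rewrite lerD2l ler_wpM2l ?(ltW s0)// lnstep_ge.
Qed.

Lemma eterm_lower s n : 0 < s -> (0 < n)%N ->
  s^-1 * (dterm s n - dterm s n.+1) <= eterm s n.
Proof.
move=> s0 n0; rewrite mulrC ler_pdivrMr// etermE// dterm_step.
rewrite -[X in X - _ <= _]mulr1 -mulrBr [leRHS]mulrAC [leRHS]mulrC ler_wpM2l ?dterm_ge0//.
have := expR_ge1Dx (- (s * lnstep n)).
have : s * lnstep n <= n%:R^-1 * s by rewrite mulrC ler_wpM2r ?(ltW s0)// lnstep_le.
by move=> h1 h2; lra.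
Qed.

Lemma eterm_tail s (M N : nat) : 0 < s -> (0 < M)%N ->
  \sum_(M.+1 <= n < N) eterm s n <= dterm s M / s.
Proof.
move=> s0 M0; have [MN|NM] := leqP M.+1 N; last first.
  by rewrite big_geq ?(ltnW NM)// divr_ge0 ?dterm_ge0 ?ltW.
rewrite -[N]prednK ?(leq_trans _ MN)// big_add1 /=.
apply: (@le_trans _ _ (\sum_(M <= n < N.-1) s^-1 * (dterm s n - dterm s n.+1))).
  rewrite big_nat [leRHS]big_nat; apply: ler_sum => n /andP[Mn _].
  by apply: eterm_upper => //; exact: leq_trans M0 Mn.
rewrite -mulr_sumr mulrC ler_wpM2r ?invr_ge0 ?(ltW s0)//.
rewrite -[leLHS]opprK -sumrN.
under eq_bigr do rewrite opprB.
rewrite telescope_sumr; first by rewrite opprB lerBlDr lerDl dterm_ge0.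
by rewrite -ltnS prednK// (leq_trans _ MN).
Qed.

Lemma invsqr_tail (M N : nat) : (0 < M)%N ->
  \sum_(M <= n < N) (n%:R ^- 2 : R) <= 2 / M%:R.
Proof.
move=> M0; have [MN|NM] := leqP M N; last first.
  by rewrite big_geq ?(ltnW NM)// divr_ge0.
have step n : (M <= n)%N -> n%:R ^- 2 <= - (2 / n.+1%:R) - (- (2 / n%:R)) :> R.
  move=> Mn; have n0 : (0 < n)%N by exact: leq_trans M0 Mn.
  have n1 : 1 <= (n%:R : R) by rewrite ler1n.
  have -> : - (2 / n.+1%:R) - (- (2 / n%:R)) = 2 / (n%:R * n.+1%:R) :> R.
    by rewrite -(natr1 n); field; apply/andP; split; apply: lt0r_neq0; lra.
  rewrite -(natr1 n); move: (n%:R : R) n1 => x x1.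
  have x0 : 0 < x by lra.
  rewrite ler_pdivlMr; last by rewrite mulr_gt0//; lra.
  have h : 0 <= x * (x - 1) by rewrite mulr_ge0//; lra.
  by rewrite [x ^- 2 * _]mulrC ler_pdivrMr ?exprn_gt0// expr2; lra.
apply: (@le_trans _ _ (\sum_(M <= n < N) (- (2 / n.+1%:R) - (- (2 / n%:R)) : R))).
  by rewrite big_nat [leRHS]big_nat; apply: ler_sum => n /andP[Mn _]; exact: step.
by rewrite (telescope_sumr (fun n => - (2 / n%:R)))// opprK gerDr oppr_le0 divr_ge0.
Qed.

(* First-order Taylor bound for [exp (- w x)] with [Re w >= 0]. *)
Lemma cexp_taylor s u x : 0 <= s -> 0 <= x <= 1 ->
  cnorm (cexp (- (s * x)) (- (u * x)) - 1 + Complex (s * x) (u * x)) <=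
    2 * (s + `|u|) ^+ 2 * x ^+ 2.
Proof.
move=> s0 /andP[x0 x1].
pose f1 y := expR (- (s * y)) * cos (- (u * y)).
pose f2 y := expR (- (s * y)) * sin (- (u * y)).
set v := s + `|u|.
have v0 : 0 <= v by rewrite addr_ge0.
have d1 (y : R) : is_derive y 1 f1 (- s * f1 y + u * f2 y).
  by rewrite /f1; apply: is_derive_eq; rewrite /f1 /f2 /GRing.scale/=; ring.
have d2 (y : R) : is_derive y 1 f2 (- s * f2 y - u * f1 y).
  by rewrite /f2; apply: is_derive_eq; rewrite /f1 /f2 /GRing.scale/=; ring.
have b (y : R) : 0 <= y -> `|f1 y| <= 1 /\ `|f2 y| <= 1.
  move=> y0; have e1 : expR (- (s * y)) <= 1 by rewrite expR_le1 oppr_le0 mulr_ge0.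
  have c1 : `|cos (- (u * y))| <= 1 by rewrite ler_norml cos_geN1 cos_le1.
  have c2 : `|sin (- (u * y))| <= 1 by rewrite ler_norml sin_geN1 sin_le1.
  by split; rewrite normrM (ger0_norm (expR_ge0 _)); rewrite -[leRHS]mulr1 ler_pM ?expR_ge0.
have lin (p q P Q : R) : `|P| <= 1 -> `|Q| <= 1 -> `|p * P + q * Q| <= `|p| + `|q|.
  move=> hP hQ; apply: le_trans (ler_normD _ _) _; rewrite !normrM.
  by apply: lerD; rewrite ler_piMr.
have vE (p q : R) : `|p| <= s -> `|q| <= `|u| -> `|p| + `|q| <= v by move=> h1 h2; exact: lerD.
have second (f df ddf : R -> R) (M : R) : 0 <= M ->
    (forall y : R, is_derive y 1 f (df y)) -> (forall y : R, is_derive y 1 df (ddf y)) ->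
    (forall y, 0 <= y <= 1 -> `|ddf y| <= M) ->
    `|f x - f 0 - df 0 * x| <= M * x ^+ 2.
  move=> M0 hf hdf hM.
  have dg (y : R) : is_derive y 1 (fun y => f y - df 0 * y) (df y - df 0).
    have := hf y => ?; apply: is_derive_eq; rewrite /GRing.scale/=; ring.
  have [->|xn] := eqVneq x 0; first by rewrite subrr mulr0 subr0 normr0 expr0n mulr0.
  have xp : 0 < x by rewrite lt_def xn.
  have cf : {within `[0, x], continuous (fun y => f y - df 0 * y)}.
    by apply: derivable_within_continuous => y _; exact: ex_derive.
  have [c + E] := @MVT R (fun y => f y - df 0 * y) (fun y => df y - df 0) 0 x xp (fun y _ => dg y) cf.
  rewrite in_itv/= => /andP[c0 cx].
  move: E; rewrite mulr0 !subr0 => E.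
  rewrite addrAC E normrM (ger0_norm x0) expr2 mulrA ler_wpM2r//.
  apply: le_trans (mvt_bound (ltW c0) (le_trans (ltW cx) x1) hdf hM) _.
  by rewrite ler_wpM2l// ltW.
have dd1 (y : R) : is_derive y 1 (fun y => - s * f1 y + u * f2 y)
    (- s * (- s * f1 y + u * f2 y) + u * (- s * f2 y - u * f1 y)).
  have := d1 y => ?; have := d2 y => ?; apply: is_derive_eq.
  by rewrite /GRing.scale/=; ring.
have dd2 (y : R) : is_derive y 1 (fun y => - s * f2 y - u * f1 y)
    (- s * (- s * f2 y - u * f1 y) - u * (- s * f1 y + u * f2 y)).
  have := d1 y => ?; have := d2 y => ?; apply: is_derive_eq.
  by rewrite /GRing.scale/=; ring.
have bd P Q : `|P| <= 1 -> `|Q| <= 1 -> `|- s * P + u * Q| <= v.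
  by move=> hP hQ; apply: le_trans (lin _ _ _ _ hP hQ) _; apply: vE; rewrite ?normrN ?(ger0_norm s0).
have bd' P Q : `|P| <= 1 -> `|Q| <= 1 -> `|- s * P - u * Q| <= v.
  by move=> hP hQ; have := bd P (- Q) hP; rewrite normrN mulrN; apply.
have bdv P Q : `|P| <= v -> `|Q| <= v -> `|- s * P + u * Q| <= v ^+ 2.
  move=> hP hQ; apply: le_trans (ler_normD _ _) _; rewrite !normrM normrN (ger0_norm s0).
  by rewrite expr2 {2}/v mulrDl lerD// ler_wpM2l.
have bdv' P Q : `|P| <= v -> `|Q| <= v -> `|- s * P - u * Q| <= v ^+ 2.
  by move=> hP hQ; have := bdv P (- Q) hP; rewrite normrN mulrN; apply.
have t1 := @second f1 _ _ (v ^+ 2) (sqr_ge0 _) d1 dd1.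
have t2 := @second f2 _ _ (v ^+ 2) (sqr_ge0 _) d2 dd2.
have f10 : f1 0 = 1 by rewrite /f1 !mulr0 oppr0 expR0 cos0 mulr1.
have f20 : f2 0 = 0 by rewrite /f2 !mulr0 oppr0 sin0 mulr0.
rewrite f10 f20 in t1 t2.
have -> : cexp (- (s * x)) (- (u * x)) - 1 + Complex (s * x) (u * x) =
    Complex (f1 x - 1 - (- s * 1 + u * 0) * x) (f2 x - 0 - (- s * 0 - u * 1) * x).
  apply/eqP; rewrite eq_complex /=.
  by apply/andP; split; apply/eqP; rewrite -/(f1 x) -/(f2 x); ring.
apply: le_trans (cnorm_le _ _) _.
rewrite -mulrA mulr_natl mulr2n; apply: lerD; [apply: t1|apply: t2] => y /andP[y0 _];
  have [h1 h2] := b y y0.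
- by apply: bdv; [exact: bd|exact: bd'].
- by apply: bdv'; [exact: bd'|exact: bd].
Qed.

Definition zsum s u (N : nat) : R[i] := \sum_(1 <= n < N) zterm s u n.

Lemma wterm_step s u n :
  wterm s u n.+1 = wterm s u n * cexp (- (s * lnstep n)) (- (u * lnstep n)).
Proof. by rewrite /wterm -cexpD; congr cexp; rewrite /lnstep; ring. Qed.

(** For [w = s + iu], the product w n^(-1-w) is the first-order term of n^(-w) - (n+1)^(-w); the
    second-order remainder is summable in [n]. *)
Lemma zterm_approx s u n : 0 <= s -> (0 < n)%N ->
  cnorm (Complex s u * zterm s u n - (wterm s u n - wterm s u n.+1)) <=
    (s + `|u| + 2 * (s + `|u|) ^+ 2) / n%:R ^+ 2.
Proof.
set v := s + `|u|; move=> s0 n0; have n0' : 0 < (n%:R : R) by rewrite ltr0n.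
have v0 : 0 <= v by rewrite addr_ge0.
set de := lnstep n; have de0 : 0 <= de by exact: lnstep_ge0.
have de1 : de <= n%:R^-1 by exact: lnstep_le.
have n1 : n%:R^-1 <= 1 :> R by rewrite invf_le1// ler1n.
have -> : Complex s u * zterm s u n - (wterm s u n - wterm s u n.+1) =
  wterm s u n * (Complex s u * Complex (n%:R^-1 - de) 0 +
    (cexp (- (s * de)) (- (u * de)) - 1 + Complex (s * de) (u * de))).
  rewrite wterm_step ztermE//.
  have -> : Complex (s * de) (u * de) = Complex s u * Complex de 0 :> R[i].
    by apply/eqP; rewrite eq_complex /=; apply/andP; split; apply/eqP; ring.
  have -> : Complex (n%:R^-1 - de) 0 = Complex n%:R^-1 0 - Complex de 0 :> R[i].
    by apply/eqP; rewrite eq_complex /=; apply/andP; split; apply/eqP; ring.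
  ring.
rewrite cnormM cnorm_wterm.
apply: le_trans (_ : 1 * ((v + 2 * v ^+ 2) / n%:R ^+ 2) <= _); last by rewrite mul1r.
apply: ler_pM; rewrite ?dterm_ge0 ?cnorm_ge0 ?dterm_le1//.
apply: le_trans (cnormD _ _) _; rewrite mulrDl; apply: lerD.
  rewrite cnormM cnorm_real ler_pM ?cnorm_ge0//.
    by apply: le_trans (cnorm_le _ _) _; rewrite /v ger0_norm.
  rewrite ger0_norm ?subr_ge0//.
  apply: (@le_trans _ _ (n%:R^-1 - n.+1%:R^-1)); first by rewrite lerD2l lerN2; exact: lnstep_ge.
  rewrite -natr1; move: (n%:R : R) n0' => x x0.
  have -> : x^-1 - (x + 1)^-1 = (x * (x + 1))^-1.
    by field; apply/andP; split; apply: lt0r_neq0; lra.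
  by rewrite lef_pV2 ?posrE ?exprn_gt0 ?mulr_gt0//; nra.
apply: le_trans (cexp_taylor u s0 _) _; first by rewrite de0 (le_trans de1).
by rewrite ler_wpM2l ?mulr_ge0 ?sqr_ge0// -exprVn lerXn2r// nnegrE ltW// invr_gt0.
Qed.

(** Sum [zterm_approx] and divide by [w = s + iu]. Since |w| >= (s + |u|) / 2, the quotient grows
    only linearly in [s + |u|]. *)
Lemma zsum_approx s u (M N : nat) : 0 < s -> (0 < M)%N -> (M <= N)%N ->
  cnorm ((zsum s u N - zsum s u M) - (wterm s u M - wterm s u N) / Complex s u) <=
    (4 + 8 * (s + `|u|)) / M%:R.
Proof.
set v := s + `|u|; move=> s0 M0 MN.
have v0 : 0 < v by rewrite ltr_pwDl.
have wn : 0 < cnorm (Complex s u).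
  by apply: lt_le_trans (cnorm_geRe _ _); rewrite gtr0_norm.
have w0 : Complex s u != 0.
  by apply/eqP => h; move: wn; rewrite h cnorm0 ltxx.
have wv : v / 2 <= cnorm (Complex s u).
  have := cnorm_geRe s u; have := cnorm_geIm s u; rewrite (gtr0_norm s0) /v; lra.
have -> : zsum s u N - zsum s u M = \sum_(M <= n < N) zterm s u n.
  by rewrite /zsum (big_cat_nat M0 MN)/= addrAC subrr add0r.
have -> : \sum_(M <= n < N) zterm s u n - (wterm s u M - wterm s u N) / Complex s u =
  (\sum_(M <= n < N) (Complex s u * zterm s u n - (wterm s u n - wterm s u n.+1))) / Complex s u.
  rewrite sumrB -mulr_sumr.
  have -> : \sum_(M <= n < N) (wterm s u n - wterm s u n.+1) = wterm s u M - wterm s u N.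
    rewrite -[LHS]opprK -sumrN; under eq_bigr do rewrite opprB.
    by rewrite telescope_sumr// opprB.
  by rewrite [RHS]mulrBl [X in _ = X - _]mulrAC divff// mul1r.
rewrite cnormM; set S := cnorm (\sum_(_ <= _ < _) _).
have -> : cnorm (Complex s u)^-1 = (cnorm (Complex s u))^-1 by exact: Normc.normcV.
rewrite ler_pdivrMr//.
apply: (@le_trans _ _ ((v + 2 * v ^+ 2) * (2 / M%:R))).
  apply: le_trans (cnorm_sum _ _ _) _.
  apply: (@le_trans _ _ (\sum_(M <= n < N) (v + 2 * v ^+ 2) * n%:R ^- 2)).
    rewrite big_nat [leRHS]big_nat; apply: ler_sum => n /andP[Mn _].
    by apply: zterm_approx; [exact: ltW|exact: leq_trans M0 Mn].
  rewrite -mulr_sumr ler_wpM2l ?invsqr_tail//.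
  by rewrite addr_ge0 ?mulr_ge0 ?sqr_ge0 ?(ltW v0).
have M0' : 0 < (M%:R : R)^-1 by rewrite invr_gt0 ltr0n.
apply: (@le_trans _ _ ((4 + 8 * v) / M%:R * (v / 2))); last first.
  by rewrite ler_wpM2l// mulr_ge0// ?(ltW M0')//; lra.
by rewrite le_eqVlt; apply/orP; left; apply/eqP; field; rewrite pnatr_eq0 -lt0n.
Qed.

Lemma harmonic_le N : (0 < N)%N -> \sum_(1 <= n < N) (n%:R^-1 : R) <= 1 + ln N%:R.
Proof.
have h m : \sum_(1 <= n < m.+2) (n%:R^-1 : R) <= 1 + ln m.+1%:R.
  elim: m => [|m IH]; first by rewrite big_nat1 ln1 invr1 addr0.
  rewrite big_nat_recr//=; apply: le_trans (lerD IH (lexx _)) _.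
  by rewrite -addrA lerD2l addrC -lerBrDr; exact: (lnstep_ge (ltn0Sn m)).
case: N => // -[_|N _]; first by rewrite big_geq// ln1 addr0.
by apply: le_trans (h N) _; rewrite lerD2l ler_ln ?posrE ?ltr0n// ler_nat.
Qed.

Lemma zsum_le_harmonic s u N : 0 <= s -> (0 < N)%N -> cnorm (zsum s u N) <= 1 + ln N%:R.
Proof.
move=> s0 N0; apply: le_trans (cnorm_sum _ _ _) _; apply: le_trans (harmonic_le N0).
rewrite big_nat [leRHS]big_nat; apply: ler_sum => n /andP[n0 _].
by rewrite cnorm_zterm eterm_le.
Qed.

(** The sum is cut at M just above |u|: up to M it is at most the harmonic sum, beyond M
    [zsum_approx] leaves the pole term 2 / |u| and an error (4 + 8 v) / M <= 20. *)
Lemma zsum_upper s u N : 0 < s -> s <= 1 -> u != 0 -> (0 < N)%N ->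
  cnorm (zsum s u N) <= 2 / `|u| + 21 + ln (1 + `|u|).
Proof.
move=> s0 s1 u0 N0; have u0' : 0 < `|u| by rewrite normr_gt0.
have i0 : 0 <= 2 / `|u| by rewrite divr_ge0.
pose M := (Num.truncn `|u|).+1.
have [M1 M2] : `|u| <= M%:R /\ M%:R <= 1 + `|u|.
  have := truncn_itv (normr_ge0 u); rewrite /M => /andP[h1 h2]; split; first exact: ltW.
  by rewrite -natr1 addrC lerD2l.
have lnM : ln M%:R <= ln (1 + `|u|) by rewrite ler_ln ?posrE ?ltr0n// ltr_pwDl.
have [NM|MN] := leqP N M.
  apply: le_trans (zsum_le_harmonic u (ltW s0) N0) _.
  have : ln (N%:R : R) <= ln M%:R by rewrite ler_ln ?posrE ?ltr0n// ler_nat.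
  lra.
have A := zsum_approx u s0 (ltn0Sn _ : (0 < M)%N) (ltnW MN).
set v := s + `|u| in A.
have w0 : `|u| <= cnorm (Complex s u) by exact: cnorm_geIm.
have wn : 0 < cnorm (Complex s u) by exact: lt_le_trans w0.
have B : cnorm ((wterm s u M - wterm s u N) / Complex s u) <= 2 / `|u|.
  rewrite cnormM; have -> : cnorm (Complex s u)^-1 = (cnorm (Complex s u))^-1 by exact: Normc.normcV.
  apply: ler_pM; rewrite ?cnorm_ge0 ?invr_ge0 ?cnorm_ge0//.
    apply: le_trans (cnormB _ _) _; rewrite !cnorm_wterm.
    have := dterm_le1 M (ltW s0); have := dterm_le1 N (ltW s0); lra.
  by rewrite lef_pV2 ?posrE.
have Cc := zsum_le_harmonic u (ltW s0) (ltn0Sn _ : (0 < M)%N).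
have D : (4 + 8 * v) / M%:R <= 20.
  have m1 : 1 <= (M%:R : R) by rewrite ler1n.
  rewrite ler_pdivrMr ?ltr0n//; rewrite /v; lra.
have -> : zsum s u N = (zsum s u N - zsum s u M - (wterm s u M - wterm s u N) / Complex s u)
   + (wterm s u M - wterm s u N) / Complex s u + zsum s u M by ring.
apply: le_trans (cnormD _ _) _; have := cnormD (zsum s u N - zsum s u M - (wterm s u M - wterm s u N) / Complex s u) ((wterm s u M - wterm s u N) / Complex s u).
lra.
Qed.

End zeta_sums.

(** * Stability in s, and the Euler product by sieving *)

Section euler.
Variable R : realType.
Implicit Types (s u a b x y : R) (z w : R[i]).
Local Notation cnorm := (@cnorm R).

Lemma cexp0 : cexp 0 0 = 1 :> R[i].
Proof. by rewrite /cexp expR0 cos0 sin0 mulr1 mulr0. Qed.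

Lemma cnorm_cexp_real_sub1 a : a <= 0 -> cnorm (cexp a 0 - 1) <= - a.
Proof.
move=> a0; have -> : cexp a 0 - 1 = Complex (expR a - 1) 0.
  by rewrite /cexp cos0 sin0; apply/eqP; rewrite eq_complex /=; apply/andP; split; apply/eqP; ring.
rewrite cnorm_real ler0_norm ?subr_le0 ?expR_le1//.
by have := expR_ge1Dx a; lra.
Qed.

(** Below M the terms are compared one by one, n^(-s) and n^(-eta) differing by at most eta log M;
    beyond M both sums are given by [zsum_approx], whose errors are at most 12 eta by the lower
    bound on M. The last term vanishes as N grows. *)
Lemma zsum_lip s eta u (M N : nat) : 0 < s -> s <= eta -> eta <= 1 -> 1 <= `|u| ->
  (0 < M)%N -> (M <= N)%N -> (1 + `|u|) / eta <= M%:R ->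
  cnorm (zsum s u N - zsum eta u N) <= 26 * eta * (1 + ln M%:R) ^+ 2 + 2 * dterm s N.
Proof.
move=> s0 se e1 u1 M0 MN Meta.
have e0 : 0 < eta by exact: lt_le_trans se.
have L0 := ln_nat_ge0 R M; set L := ln M%:R in L0 *.
have A1 := zsum_approx u s0 M0 MN; have A2 := zsum_approx u e0 M0 MN.
set w1 := Complex s u in A1; set w2 := Complex eta u in A2.
have M0' : 0 < (M%:R : R) by rewrite ltr0n.
have bM v : v <= 1 -> (4 + 8 * (v + `|u|)) / M%:R <= 12 * eta.
  move=> v1; rewrite ler_pdivrMr//; move: Meta; rewrite ler_pdivrMr// => Meta; lra.
have {}A1 := le_trans A1 (bM _ (le_trans se e1)); have {}A2 := le_trans A2 (bM _ e1).
have n1 : 1 <= cnorm w1 by apply: le_trans u1 _; exact: cnorm_geIm.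
have n2 : 1 <= cnorm w2 by apply: le_trans u1 _; exact: cnorm_geIm.
have w1n : w1 != 0 by apply/eqP => h; move: n1; rewrite h cnorm0 ler10.
have w2n : w2 != 0 by apply/eqP => h; move: n2; rewrite h cnorm0 ler10.
have divle z w : 1 <= cnorm w -> cnorm (z / w) <= cnorm z.
  move=> hw; rewrite cnormM; have -> : cnorm w^-1 = (cnorm w)^-1 by exact: Normc.normcV.
  by rewrite ler_piMr ?cnorm_ge0// invf_le1// (lt_le_trans ltr01).
have wdiff n : (0 < n)%N -> (n <= M)%N -> wterm eta u n - wterm s u n =
    wterm s u n * (cexp (- ((eta - s) * ln n%:R)) 0 - 1) /\
    cnorm (cexp (- ((eta - s) * ln n%:R)) 0 - 1) <= eta * L.
  move=> n0 nM; split.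
    by rewrite mulrBr mulr1 /wterm -cexpD; congr (cexp _ _ - _); ring.
  have ln0 := ln_nat_ge0 R n.
  apply: le_trans (cnorm_cexp_real_sub1 _) _.
    by rewrite oppr_le0 mulr_ge0// subr_ge0.
  rewrite opprK ler_pM ?subr_ge0//; first lra.
  by rewrite ler_ln ?posrE ?ltr0n// ler_nat.
have B1 : cnorm (wterm s u M / w1 - wterm eta u M / w2) <= eta * L + eta.
  have -> : wterm s u M / w1 - wterm eta u M / w2 =
    - ((wterm eta u M - wterm s u M) / w1) + wterm eta u M * ((w2 - w1) / w1 / w2).
    by field; rewrite w1n w2n.
  apply: le_trans (cnormD _ _) _; rewrite cnormN; apply: lerD.
    have [-> h] := wdiff M M0 (leqnn M).
    apply: le_trans (divle _ _ n1) _; rewrite cnormM cnorm_wterm.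
    apply: le_trans _ h; rewrite ler_piMl ?cnorm_ge0 ?dterm_le1// ltW//.
  rewrite cnormM cnorm_wterm; apply: (@le_trans _ _ (1 * eta)); last by rewrite mul1r.
  apply: ler_pM; rewrite ?dterm_ge0 ?cnorm_ge0 ?dterm_le1 ?(ltW e0)//.
  apply: le_trans (divle _ _ n2) _; apply: le_trans (divle _ _ n1) _.
  have -> : w2 - w1 = Complex (eta - s) 0.
    by apply/eqP; rewrite eq_complex /=; apply/andP; split; apply/eqP; ring.
  by rewrite cnorm_real ger0_norm ?subr_ge0//; lra.
have dN : dterm eta N <= dterm s N.
  by rewrite ler_expR lerN2 ler_wpM2r// ln_nat_ge0.
have B2 : cnorm (wterm s u N / w1 - wterm eta u N / w2) <= 2 * dterm s N.
  apply: le_trans (cnormB _ _) _.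
  have h1 := divle (wterm s u N) _ n1; have h2 := divle (wterm eta u N) _ n2.
  rewrite !cnorm_wterm in h1 h2; lra.
have B3 : cnorm (zsum s u M - zsum eta u M) <= eta * L * (1 + L).
  rewrite /zsum -sumrB; apply: le_trans (cnorm_sum _ _ _) _.
  apply: (@le_trans _ _ (\sum_(1 <= n < M) eta * L * n%:R^-1)); last first.
    by rewrite -mulr_sumr ler_wpM2l ?harmonic_le// mulr_ge0// ltW.
  rewrite big_nat [leRHS]big_nat; apply: ler_sum => n /andP[n0 nM].
  have [h1 h2] := wdiff n n0 (ltnW nM).
  have -> : zterm s u n - zterm eta u n = - (Complex n%:R^-1 0 * (wterm eta u n - wterm s u n)).
    by rewrite !ztermE//; ring.
  rewrite cnormN h1 !cnormM cnorm_real cnorm_wterm ger0_norm ?invr_ge0//.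
  rewrite mulrC ler_wpM2r ?invr_ge0//; apply: le_trans _ h2.
  by rewrite ler_piMl ?cnorm_ge0 ?dterm_le1// ltW.
have -> : zsum s u N - zsum eta u N =
  (zsum s u N - zsum s u M - (wterm s u M - wterm s u N) / w1)
  - (zsum eta u N - zsum eta u M - (wterm eta u M - wterm eta u N) / w2)
  + ((wterm s u M / w1 - wterm eta u M / w2) - (wterm s u N / w1 - wterm eta u N / w2))
  + (zsum s u M - zsum eta u M) by rewrite !mulrBl; ring.
set X1 := zsum s u N - _ - _ in A1 *; set X2 := zsum eta u N - _ - _ in A2 *.
set X3 := _ - _ in B1 *; set X4 := _ - _ in B2 *; set X5 := _ - _ in B3 *.
have h1 := cnormD (X1 - X2 + (X3 - X4)) X5; have h2 := cnormD (X1 - X2) (X3 - X4).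
have h3 := cnormB X1 X2; have h4 := cnormB X3 X4.
have h5 : 24 * eta + (eta * L + eta) + eta * L * (1 + L) <= 26 * eta * (1 + L) ^+ 2.
  have : 0 <= eta * L by rewrite mulr_ge0// ltW.
  have : 0 <= eta * L * L by rewrite !mulr_ge0// ltW.
  by rewrite sqrrD; nra.
lra.
Qed.

Lemma dterm_small s (e : R) : 0 < s -> 0 < e ->
  exists N0, forall N, (N0 <= N)%N -> dterm s N <= e.
Proof.
move=> s0 e0; pose N0 := (Num.truncn (expR (- ln e / s))).+1; exists N0 => N hN.
rewrite -[leRHS]lnK ?posrE// ler_expR lerNl -ler_pdivrMl// mulrC.
rewrite -[leLHS]expRK ler_ln ?posrE ?expR_gt0//; last first.
  by rewrite ltr0n; apply: leq_trans hN.
have := truncn_itv (expR_ge0 (- ln e / s)) => /andP[_ /ltW h].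
by apply: le_trans h _; rewrite ler_nat.
Qed.

Definition cop (k n : nat) : bool := all (fun q => prime q ==> ~~ (q %| n)%N) (iota 0 k).

Lemma copS k n : cop k.+1 n = cop k n && (prime k ==> ~~ (k %| n)%N).
Proof. by rewrite /cop -addn1 iotaD all_cat /= add0n andbT. Qed.

Lemma cop_mul k m : prime k -> cop k (k * m) = cop k m.
Proof.
move=> kp; apply: eq_in_all => q; rewrite mem_iota add0n => /andP[_ qk].
case: (boolP (prime q)) => //= qp; rewrite Euclid_dvdM// dvdn_prime2//.
by rewrite (ltn_eqF qk).
Qed.

Lemma cop1 k : cop k 1.
Proof.
by apply/allP => q _; apply/implyP => qp; rewrite dvdn1; case: eqP qp => // ->.
Qed.

Lemma cop_lt k n : (1 < n)%N -> (n < k)%N -> cop k n = false.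
Proof.
move=> n1 nk; apply/negP => /allP/(_ (pdiv n)).
rewrite mem_iota add0n/= (leq_ltn_trans (pdiv_leq (ltnW n1)) nk) pdiv_prime// pdiv_dvd.
by move/(_ isT).
Qed.

(** The new bound is N / k rounded up, the number of multiples of k in [0, N[. *)
Lemma sum_dvd (V : zmodType) (f : nat -> V) (k N : nat) : (0 < k)%N ->
  \sum_(0 <= n < N | (k %| n)%N) f n = \sum_(0 <= m < (N + k.-1) %/ k) f (k * m)%N.
Proof.
move=> k0; elim: N => [|N IH].
  by rewrite big_geq// add0n divn_small ?prednK// big_geq.
rewrite big_mkcond big_nat_recr//= -big_mkcond/= IH.
have -> : ((N.+1 + k.-1) = N + k)%N by rewrite addSn -addnS prednK.
have -> : ((N + k) %/ k = (N %/ k).+1)%N by rewrite divnDr ?dvdnn// divnn k0 addn1.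
case: (boolP (k %| N)%N) => [/dvdnP[q ->]|kN].
  rewrite divnMDl// (divn_small (m := k.-1)) ?prednK// addn0 mulnK//.
  by rewrite [RHS]big_nat_recr//= mulnC.
have h : (0 < N %% k)%N by rewrite lt0n.
have e1 : (N %% k + k.-1 = 1 * k + (N %% k).-1)%N.
  by rewrite mul1n -[in LHS](prednK h) addSn -addnS prednK// addnC.
have e2 : ((N %/ k * k + N %% k + k.-1) %/ k = (N %/ k).+1)%N.
  rewrite -addnA e1 divnMDl// divnMDl// (divn_small (m := (N %% k).-1)) ?addn0 ?addn1//.
  by apply: leq_ltn_trans (leq_pred _) _; exact: ltn_pmod.
by rewrite -divn_eq in e2; rewrite addr0 e2.
Qed.

(** A real substitute for the complex logarithm: |1 - z|^2 = 1 + y with y = - 2 Re z + |z|^2 >= -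
    3/4, and ln (1 + y) lies between y - 4 y^2 and y. As y^2 <= (25/4) |z|^2, the error in 2 ln |1 -
    z| is at most 26 |z|^2. *)
Lemma ln_cnorm1B z : cnorm z <= 1 / 2 -> 0 < cnorm (1 - z) /\
  `|ln (cnorm (1 - z)) + complex.Re z| <= 13 * cnorm z ^+ 2.
Proof.
case: z => a b hz.
have z0 := cnorm_ge0 (Complex a b); have ha := cnorm_geRe a b.
have hr := cnorm_sqr a b.
have -> : 1 - Complex a b = Complex (1 - a) (- b).
  by apply/eqP; rewrite eq_complex /=; apply/andP; split; apply/eqP; ring.
have hs := cnorm_sqr (1 - a) (- b).
set r := cnorm (Complex a b) in hz z0 ha hr *; set q := cnorm _ in hs *.
have q0 : 0 <= q by exact: cnorm_ge0.
move: ha; rewrite ler_norml => /andP[a1 a2].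
pose y := - 2 * a + r ^+ 2.
have hs' : q ^+ 2 = 1 + y by rewrite hs /y hr; ring.
have y1 : - (3 / 4) <= y by rewrite /y; nra.
have qp : 0 < q.
  by rewrite lt_neqAle q0 andbT; apply/eqP => h; move: hs'; rewrite -h expr0n/=; lra.
split=> //=.
have hl : 2 * ln q = ln (1 + y) by rewrite -hs' lnXn// mulr_natl.
have l1 : ln (1 + y) <= y by apply: le_ln1Dx; lra.
have l2 : y - 4 * y ^+ 2 <= ln (1 + y).
  have yp : 0 < 1 + y by lra.
  have := le_ln1Dx (x := (1 + y)^-1 - 1); rewrite subrKC lnV ?posrE// => h.
  have : - ln (1 + y) <= (1 + y)^-1 - 1 by apply: h; rewrite ltrBDr addrC subrr invr_gt0.
  have : (1 + y)^-1 - 1 <= - y + 4 * y ^+ 2.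
    rewrite lerBlDr -div1r ler_pdivrMr//.
    have -> : (- y + 4 * y ^+ 2 + 1) * (1 + y) = 1 + y ^+ 2 * (3 + 4 * y) by ring.
    by rewrite lerDl mulr_ge0 ?sqr_ge0//; lra.
  lra.
have y2 : y ^+ 2 <= 25 / 4 * r ^+ 2.
  have e1 : y <= 5 / 2 * r by rewrite /y; nra.
  have e2 : - (5 / 2 * r) <= y by rewrite /y; nra.
  nra.
rewrite ler_norml; apply/andP; rewrite /y in l1 l2 y2 hl *; split; lra.
Qed.

Section fixed.
Variables s u : R.
Hypothesis s0 : 0 < s.
Local Notation z := (zterm s u).

Definition esum_term k n : R[i] := if (0 < n)%N && cop k n then z n else 0.
Definition esum_cop k N : R[i] := \sum_(0 <= n < N) esum_term k n.
Definition eprod k : R[i] := \prod_(0 <= p < k | prime p) (1 - z p).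

Let ceil_div N k := ((N + k.-1) %/ k)%N.

(** A step of the sieve of Eratosthenes: the surviving multiples of the prime k form z k times the
    same sum, cut at N / k rounded up. *)
Lemma esum_copS k N : prime k ->
  esum_cop k.+1 N = esum_cop k N - z k * esum_cop k (ceil_div N k).
Proof.
move=> kp; have k0 := prime_gt0 kp.
apply/eqP; rewrite eq_sym subr_eq; apply/eqP.
have -> : z k * esum_cop k (ceil_div N k) = \sum_(0 <= n < N | (k %| n)%N) esum_term k n.
  rewrite sum_dvd// mulr_sumr; apply: eq_bigr => m _.
  rewrite /esum_term muln_gt0 k0/= cop_mul//.
  by case: ifP => [/andP[m0 _]|_]; rewrite ?mulr0// ztermM.
rewrite [X in _ + X]big_mkcond -big_split/=; apply: eq_bigr => n _.
rewrite /esum_term copS kp/=; case: (0 < n)%N => /=; last by case: ifP; rewrite addr0.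
by case: (cop k n) => /=; case: (k %| n)%N; rewrite /= ?addr0 ?add0r.
Qed.

Lemma esum_term_le k n : (0 < n)%N -> cnorm (esum_term k n) <= eterm s n.
Proof.
move=> n0; rewrite /esum_term; case: ifP; first by rewrite cnorm_zterm.
by rewrite cnorm0 eterm_ge0.
Qed.

Lemma esum_cop_tail k N' N : (N'.+1 < N)%N -> (0 < N')%N ->
  cnorm (esum_cop k N - esum_cop k N'.+1) <= dterm s N' / s.
Proof.
move=> NN N0; rewrite /esum_cop (big_cat_nat (leq0n N'.+1) (ltnW NN))/= addrAC subrr add0r.
apply: le_trans (eterm_tail _ s0 N0); apply: le_trans (cnorm_sum _ _ _) _.
rewrite big_nat [leRHS]big_nat; apply: ler_sum => n /andP[n0 _].
by apply: esum_term_le; exact: leq_trans n0.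
Qed.

Lemma esum_cop_cauchy k e : 0 < e -> exists N0, forall N N', (N0 <= N')%N -> (N' <= N)%N ->
  cnorm (esum_cop k N - esum_cop k N') <= e.
Proof.
move=> e0; have [M0 hM] := dterm_small s0 (mulr_gt0 e0 s0).
exists M0.+2 => N N' h1; rewrite leq_eqVlt => /orP[/eqP ->|NN].
  by rewrite subrr cnorm0 ltW.
case: N' h1 NN => // -[//|N'] h1 NN.
apply: le_trans (esum_cop_tail k NN _) _ => //.
rewrite ler_pdivrMr//; apply: hM; exact: leq_trans (leqnSn _) h1.
Qed.

Lemma cnorm_z_le1 n : (0 < n)%N -> cnorm (z n) <= 1.
Proof.
move=> n0; rewrite cnorm_zterm; apply: le_trans (eterm_le (ltW s0) n0) _.
by rewrite invf_le1 ?ltr0n// ler1n.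
Qed.

Lemma eprodS k : eprod k.+1 = eprod k * (if prime k then 1 - z k else 1).
Proof. by rewrite /eprod big_mkcond big_nat_recr//= -big_mkcond. Qed.

(** The finite Euler product sieves the partial sum only up to the change of cut-off from N to N / k
    at each prime; for fixed k both cut-offs are far out in a convergent tail. *)
Lemma esum_cop_conv k e : 0 < e -> exists N0, forall N, (N0 <= N)%N ->
  cnorm (esum_cop k N - eprod k * zsum s u N) <= e.
Proof.
elim: k e => [|k IH] e e0.
  exists 1%N => N N1; rewrite /eprod big_geq// mul1r.
  rewrite /esum_cop /zsum big_ltn// /esum_term ltnn/= add0r.
  rewrite big_nat [X in _ - X]big_nat -sumrB big1 ?cnorm0 ?ltW//.
  by move=> n /andP[n0 _]; rewrite n0 /cop /= subrr.
case: (boolP (prime k)) => kp; last first.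
  have [N0 h] := IH e e0; exists N0 => N hN; move: (h N hN).
  have -> : esum_cop k.+1 N = esum_cop k N.
    by apply: eq_bigr => n _; rewrite /esum_term copS (negbTE kp) andbT.
  by rewrite eprodS (negbTE kp) mulr1.
have e4 : 0 < e / 4 by rewrite divr_gt0.
have [N0 h] := IH _ e4; have [N1 h'] := esum_cop_cauchy k e4.
have k0 := prime_gt0 kp.
exists (maxn N0 (N1 * k)) => N; rewrite geq_max => /andP[hN0 hN1].
rewrite eprodS kp esum_copS//.
have -> : esum_cop k N - z k * esum_cop k (ceil_div N k) - eprod k * (1 - z k) * zsum s u N =
  (1 - z k) * (esum_cop k N - eprod k * zsum s u N) +
  z k * (esum_cop k N - esum_cop k (ceil_div N k)) by ring.
have c1 : (N1 <= ceil_div N k)%N.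
  by rewrite /ceil_div leq_divRL// (leq_trans hN1)// leq_addr.
have c2 : (ceil_div N k <= N)%N.
  rewrite /ceil_div; case: N hN0 hN1 c1 => [|N] _ _ _.
    by rewrite add0n divn_small// prednK.
  by apply: (@leq_trans ((N.+1 * k) %/ k)); [apply: leq_div2r; rewrite mulSn addSn -addnS prednK// addnC leq_add2l leq_pmulr| rewrite mulnK].
apply: le_trans (cnormD _ _) _; rewrite !cnormM.
have a1 := h N hN0; have a2 := h' _ _ c1 c2.
have b1 : cnorm (1 - z k) <= 2.
  by apply: le_trans (cnormB _ _) _; rewrite cnorm1; have := cnorm_z_le1 k0; lra.
have b2 := cnorm_z_le1 k0.
have m1 := ler_pM (cnorm_ge0 _) (cnorm_ge0 _) b1 a1.
have m2 := ler_pM (cnorm_ge0 _) (cnorm_ge0 _) b2 a2.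
lra.
Qed.

(** Below k only n = 1 survives the sieve, so the rest is a tail. *)
Lemma esum_cop_near1 k N : (2 <= k)%N -> (k < N)%N ->
  cnorm (esum_cop k N - 1) <= dterm s k.-1 / s.
Proof.
move=> k2 kN; have -> : 1 = esum_cop k k.
  rewrite /esum_cop big_ltn ?(ltnW k2)// big_ltn// {1 2}/esum_term/= cop1 add0r.
  rewrite big_nat big1 => [|n /andP[n1 nk]]; last by rewrite /esum_term cop_lt// andbF.
  by rewrite addr0 /zterm ln1 !mulr0 oppr0 cexp0.
case: k k2 kN => [//|[//|k]] _ kN; exact: esum_cop_tail.
Qed.

Definition primesum k : R := \sum_(0 <= p < k | prime p) eterm s p * cos (u * ln p%:R).

Lemma primesumS k : primesum k.+1 =
  primesum k + (if prime k then eterm s k * cos (u * ln k%:R) else 0).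
Proof. by rewrite /primesum big_mkcond big_nat_recr//= -big_mkcond. Qed.

Lemma cnorm_eprod k : 0 < cnorm (eprod k) /\
  `|ln (cnorm (eprod k)) + primesum k| <= \sum_(0 <= p < k | prime p) 13 * p%:R ^- 2.
Proof.
elim: k => [|k [IH0 IH]].
  by rewrite /eprod /primesum !big_geq// cnorm1 ln1 addr0 normr0.
rewrite primesumS eprodS [X in _ <= X]big_mkcond big_nat_recr//= -big_mkcond/=.
case: (boolP (prime k)) => kp; last by rewrite mulr1 !addr0.
have k0 := prime_gt0 kp; have k0' : 0 < (k%:R : R) by rewrite ltr0n.
have zk : cnorm (z k) <= k%:R^-1 by rewrite cnorm_zterm eterm_le// ltW.
have zk2 : cnorm (z k) <= 1 / 2.
  apply: le_trans zk _; rewrite div1r lef_pV2 ?posrE//.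
  by rewrite ler_nat prime_gt1.
have [h0 h] := ln_cnorm1B zk2; rewrite cnormM; split; first exact: mulr_gt0.
rewrite lnM ?posrE//.
have -> : eterm s k * cos (u * ln k%:R) = complex.Re (z k) by rewrite /zterm /cexp /= cosN.
have -> : ln (cnorm (eprod k)) + ln (cnorm (1 - z k)) + (primesum k + complex.Re (z k)) =
  (ln (cnorm (eprod k)) + primesum k) + (ln (cnorm (1 - z k)) + complex.Re (z k)) by ring.
apply: le_trans (ler_normD _ _) _; apply: lerD => //.
apply: le_trans h _; rewrite ler_pM2l//.
by rewrite -exprVn; apply: lerXn2r; rewrite ?nnegrE ?cnorm_ge0 ?invr_ge0.
Qed.

Lemma sum_prime_invsqr k : \sum_(0 <= p < k | prime p) 13 * p%:R ^- 2 <= 13 :> R.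
Proof.
rewrite -mulr_sumr -[leRHS]mulr1 ler_pM2l//.
have [k2|k2] := leqP k 2.
  rewrite big_nat_cond big1 ?ler01// => p /andP[/andP[_ pk] pp].
  by have := leq_trans pk k2; rewrite ltnNge prime_gt1.
rewrite (big_cat_nat (n := 2))//=; last exact: ltnW.
rewrite big_nat_cond big1 ?add0r => [|p /andP[/andP[_ p2] pp]]; last first.
  by move: p2; rewrite ltnNge prime_gt1.
apply: (@le_trans _ _ (2 / 2%:R)); last by rewrite divff.
apply: (le_trans _ (@invsqr_tail R 2 k isT)).
by rewrite big_mkcond; apply: ler_sum => p _; case: ifP => // _.
Qed.

(** The sieved sum is within 1/4 of 1 and within 1/4 of [eprod k * zsum s u N], so the logarithm of
    that product has modulus at most 1; the prime squares contribute 13. No limit is formed: N is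
    taken large after k. *)
Lemma euler_log : exists k0, forall k, (k0 <= k)%N ->
  exists N0, forall N, (N0 <= N)%N ->
    0 < cnorm (zsum s u N) /\ `|ln (cnorm (zsum s u N)) - primesum k| <= 14.
Proof.
have e4 : 0 < 1 / 4 * s by rewrite mulr_gt0.
have [k0 hk0] := dterm_small s0 e4; exists k0.+2 => k hk.
have hk' : dterm s k.-1 / s <= 1 / 4.
  by rewrite ler_pdivrMr//; apply: hk0; case: k hk => // k /ltnW.
have k2 : (2 <= k)%N by apply: leq_trans hk.
have q0 : 0 < 1 / 4 :> R by [].
have [N0 hN] := esum_cop_conv k q0; exists (maxn N0 k.+1) => N.
rewrite geq_max => /andP[/hN h1 kN].
have h2 := le_trans (esum_cop_near1 k2 kN) hk'.
have [p0 hp] := cnorm_eprod k; have hp' := le_trans hp (sum_prime_invsqr k).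
have h3 : cnorm (1 - eprod k * zsum s u N) <= 1 / 2.
  have -> : 1 - eprod k * zsum s u N =
    (esum_cop k N - eprod k * zsum s u N) - (esum_cop k N - 1) by ring.
  by apply: le_trans (cnormB _ _) _; lra.
have h4 : 1 / 2 <= cnorm (eprod k) * cnorm (zsum s u N).
  have := cnormD (1 - eprod k * zsum s u N) (eprod k * zsum s u N).
  by rewrite subrK cnorm1 cnormM; lra.
have h5 : cnorm (eprod k) * cnorm (zsum s u N) <= 3 / 2.
  have := cnormB 1 (1 - eprod k * zsum s u N).
  by rewrite opprB addrC subrK cnorm1 cnormM; lra.
have z0 : 0 < cnorm (zsum s u N).
  rewrite -(pmulr_rgt0 _ p0); apply: lt_le_trans h4 => //.
split=> //.
have m0 : 0 < cnorm (eprod k) * cnorm (zsum s u N) by exact: mulr_gt0.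
have l1 : ln (cnorm (eprod k)) + ln (cnorm (zsum s u N)) <= 1 / 2.
  rewrite -lnM ?posrE//; have := le_ln1Dx (x := cnorm (eprod k) * cnorm (zsum s u N) - 1).
  by rewrite subrKC; lra.
have l2 : -1 <= ln (cnorm (eprod k)) + ln (cnorm (zsum s u N)).
  rewrite -lnM ?posrE//.
  have : 1 / (cnorm (eprod k) * cnorm (zsum s u N)) <= 2.
    by rewrite ler_pdivrMr//; lra.
  have := le_ln1Dx (x := 1 / (cnorm (eprod k) * cnorm (zsum s u N)) - 1).
  rewrite subrKC div1r lnV ?posrE// ltrBDr addNr invr_gt0 m0 => /(_ isT); lra.
move: hp'; rewrite !ler_norml => /andP[a1 a2]; apply/andP; split; lra.
Qed.

End fixed.
End euler.

(** * The prime sums F(u): upper bounds, truncation, and 3-4-1 *)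

Section primesum.
Variable R : realType.
Implicit Types (s u : R).
Local Notation cnorm := (@cnorm R).

Lemma primesum0E s k : primesum s 0 k = \sum_(0 <= p < k | prime p) eterm s p.
Proof. by apply: eq_bigr => p _; rewrite mul0r cos0 mulr1. Qed.

Lemma primesum0_le s k k' : (k <= k')%N -> primesum s 0 k <= primesum s 0 k'.
Proof.
move=> kk; rewrite !primesum0E (big_cat_nat (n := k) (p := k'))//= lerDl.
by apply: sumr_ge0 => p _; exact: eterm_ge0.
Qed.

Lemma zterm0E s n : zterm s 0 n = Complex (eterm s n) 0.
Proof. by rewrite /zterm /cexp mul0r oppr0 cos0 sin0 mulr1 mulr0. Qed.

Lemma zsum0E s N : zsum s 0 N = Complex (\sum_(1 <= n < N) eterm s n) 0.
Proof.
rewrite /zsum; elim: N => [|[|N] IH]; [by rewrite !big_geq|by rewrite !big_geq|].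
rewrite big_nat_recr//= IH [in RHS]big_nat_recr//= zterm0E; apply/eqP; rewrite eq_complex /=.
by apply/andP; split; apply/eqP; ring.
Qed.

Lemma cnorm_zsum0 s N : cnorm (zsum s 0 N) = \sum_(1 <= n < N) eterm s n.
Proof.
by rewrite zsum0E cnorm_real ger0_norm// sumr_ge0// => n _; exact: eterm_ge0.
Qed.

Lemma eterm1 s : eterm s 1 = 1.
Proof. by rewrite /eterm ln1 mulr0 oppr0 expR0. Qed.

Lemma primesum0_upper s k : 0 < s -> s <= 1 -> primesum s 0 k <= ln (2 / s) + 14.
Proof.
move=> s0 s1; have [k0 hk] := euler_log 0 s0.
have [N0 hN] := hk (maxn k0 k) (leq_maxl _ _).
apply: le_trans (primesum0_le s (leq_maxr k0 k)) _.
have [h0 h] := hN (maxn N0 2) (leq_maxl _ _).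
have : cnorm (zsum s 0 (maxn N0 2)) <= 2 / s.
  rewrite cnorm_zsum0 big_ltn ?leq_max ?orbT// eterm1.
  apply: le_trans (lerD (lexx _) (eterm_tail _ s0 (ltn0Sn 0))) _.
  rewrite /dterm ln1 mulr0 oppr0 expR0 [leRHS]mulrDl lerD2r.
  by rewrite div1r invf_ge1.
move=> hl; have : ln (cnorm (zsum s 0 (maxn N0 2))) <= ln (2 / s).
  by rewrite ler_ln ?posrE ?divr_gt0.
by move: h; rewrite ler_norml => /andP[a1 a2]; lra.
Qed.

(** By the integral test the partial sum is at least (1 - N^(-s)) / s, hence at least 1 / (2 s) once
    N^(-s) <= 1/2. *)
Lemma primesum0_lower s : 0 < s ->
  exists k0, forall k, (k0 <= k)%N -> - ln (2 * s) - 14 <= primesum s 0 k.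
Proof.
move=> s0; have [k0 hk] := euler_log 0 s0; exists k0 => k kk.
have [N0 hN] := hk k kk; have q0 : 0 < 1 / 2 :> R by [].
have [N1 hN1] := dterm_small s0 q0.
pose N := (maxn N0 N1).+1.
have [h0 h] := hN N (leq_trans (leq_maxl _ _) (leqnSn _)).
have d := hN1 N (leq_trans (leq_maxr _ _) (leqnSn _)).
have : (2 * s)^-1 <= cnorm (zsum s 0 N).
  rewrite cnorm_zsum0.
  apply: (@le_trans _ _ (\sum_(1 <= n < N) - (s^-1 * (dterm s n.+1 - dterm s n)))).
    rewrite sumrN -mulr_sumr telescope_sumr// /dterm ln1 mulr0 oppr0 expR0 -/(dterm s N).
    by rewrite invfM mulrC -mulrN ler_pM2l ?invr_gt0//; lra.
  rewrite big_nat [leRHS]big_nat; apply: ler_sum => n /andP[n0 _].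
  by rewrite -mulrN opprB eterm_lower.
move=> hl; have : ln ((2 * s)^-1) <= ln (cnorm (zsum s 0 N)).
  by rewrite ler_ln ?posrE ?invr_gt0 ?mulr_gt0.
rewrite lnV ?posrE ?mulr_gt0//.
by move: h; rewrite ler_norml => /andP[a1 a2]; lra.
Qed.

Lemma ln2_le1 : ln (2 : R) <= 1.
Proof. by have := @le_ln1Dx R 1; rewrite -[1 + 1]/(2 : R) => -> //; lra. Qed.

(* For [v := s * ln p >= 2] one has [2 exp (- v) <= exp (- v / 4)], so the tail
   at [s] is at most the difference of the full sums at [s / 4] and at [s]. *)
Lemma primesum_tail s X k : 0 < s -> s <= 1 -> (0 < X)%N -> 2 <= s * ln X%:R ->
  \sum_(X <= p < k | prime p) eterm s p <= 32.
Proof.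
move=> s0 s1 X0 hX; have [k0 hk] := primesum0_lower s0.
pose k1 := (k + (k0 + X))%N.
have kk1 : (k <= k1)%N by exact: leq_addr.
have Xk1 : (X <= k1)%N by rewrite /k1 addnA leq_addl.
apply: (@le_trans _ _ (\sum_(X <= p < k1 | prime p) eterm s p)).
  have [Xk|kX] := leqP X k; last first.
    by rewrite big_geq ?(ltnW kX)//; apply: sumr_ge0 => p _; exact: eterm_ge0.
  rewrite (big_cat_nat (n := k) (p := k1))//= lerDl.
  by apply: sumr_ge0 => p _; exact: eterm_ge0.
have q0 : 0 < s / 4 by rewrite divr_gt0.
have q1 : s / 4 <= 1 by lra.
have l1 := primesum0_upper k1 q0 q1.
have l2 : - ln (2 * s) - 14 <= primesum s 0 k1.
  by apply: hk; rewrite /k1 addnCA leq_addr.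
have le p : (0 < p)%N -> eterm s p <= eterm (s / 4) p.
  move=> p0; rewrite ler_expR lerN2 ler_wpM2r ?ln_nat_ge0//; lra.
apply: (@le_trans _ _ (\sum_(0 <= p < k1 | prime p) (eterm (s / 4) p - eterm s p))).
  rewrite [leRHS](big_cat_nat (n := X))//= -[leLHS]add0r; apply: lerD.
    by apply: sumr_ge0 => p pp; rewrite subr_ge0 le// prime_gt0.
  rewrite big_nat_cond [leRHS]big_nat_cond; apply: ler_sum => p /andP[/andP[Xp _] pp].
  have v2 : 2 <= s * ln p%:R.
    apply: le_trans hX _; rewrite ler_pM2l// ler_ln ?posrE ?ltr0n ?(leq_trans X0)//.
    by rewrite ler_nat.
  have -> : eterm (s / 4) p = eterm s p * expR (3 / 4 * (s * ln p%:R)).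
    by rewrite /eterm -expRD; congr expR; field.
  rewrite -[X in _ - X]mulr1 -mulrBr ler_peMr ?eterm_ge0//.
  by have := expR_ge1Dx (3 / 4 * (s * ln p%:R)); lra.
rewrite sumrB -!primesum0E.
(* The logarithms of s cancel, so the bound does not depend on s: 28 + 4 ln 2 <= 32. *)
have e : ln (2 / (s / 4)) + ln (2 * s) = 4 * ln 2.
  have -> : 2 / (s / 4) = 2 ^+ 3 / s by field; rewrite gt_eqF.
  rewrite ln_div ?posrE ?exprn_gt0// lnXn// lnM ?posrE//; ring.
by have := ln2_le1; lra.
Qed.

(** For s = 2 / log x the factor p^(-s) is already at most exp (- 2) at the cut-off, so primes
    beyond it contribute O(1). Estimates for long sums thus pass to the sum over p <= x. *)
Lemma primesum_trunc s u X k : 0 < s -> s <= 1 -> (0 < X)%N -> 2 <= s * ln X%:R ->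
  (X <= k)%N -> `|primesum s u k - primesum s u X| <= 32.
Proof.
move=> s0 s1 X0 hX Xk; rewrite /primesum (big_cat_nat (n := X) (p := k))//= addrAC subrr add0r.
apply: le_trans (primesum_tail k s0 s1 X0 hX).
apply: le_trans (ler_norm_sum _ _ _) _; apply: ler_sum => p _.
rewrite normrM ger0_norm ?eterm_ge0// ler_piMr ?eterm_ge0//.
by rewrite ler_norml cos_geN1 cos_le1.
Qed.

Lemma primesum_upper s u X : 0 < s -> s <= 1 -> (0 < X)%N -> 2 <= s * ln X%:R ->
  u != 0 -> primesum s u X <= ln (2 / `|u| + 21 + ln (1 + `|u|)) + 46.
Proof.
move=> s0 s1 X0 hX u0; have [k0 hk] := euler_log u s0.
have [N0 hN] := hk (maxn k0 X) (leq_maxl _ _).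
have [h0 h] := hN N0.+1 (leqnSn _).
have := primesum_trunc u s0 s1 X0 hX (leq_maxr k0 X).
have := zsum_upper s0 s1 u0 (ltn0Sn N0) => hz.
have : ln (cnorm (zsum s u N0.+1)) <= ln (2 / `|u| + 21 + ln (1 + `|u|)).
  by rewrite ler_ln ?posrE//; exact: lt_le_trans hz.
by move: h; rewrite !ler_norml => /andP[a1 a2] a3 /andP[a4 a5]; lra.
Qed.

Lemma primesum0_lower_trunc s X : 0 < s -> s <= 1 -> (0 < X)%N -> 2 <= s * ln X%:R ->
  - ln (2 * s) - 46 <= primesum s 0 X.
Proof.
move=> s0 s1 X0 hX; have [k0 hk] := primesum0_lower s0.
have h := hk (maxn k0 X) (leq_maxl _ _).
have := primesum_trunc 0 s0 s1 X0 hX (leq_maxr k0 X).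
by rewrite ler_norml => /andP[a1 a2]; lra.
Qed.

Lemma cos_341 u : 0 <= 3 + 4 * cos u + cos (2 * u).
Proof.
have -> : 2 * u = u + u by ring.
rewrite cosD; have := cos2Dsin2 u; have := sqr_ge0 (1 + cos u); nra.
Qed.

Lemma primesum_341 s u k :
  0 <= 3 * primesum s 0 k + 4 * primesum s u k + primesum s (2 * u) k.
Proof.
rewrite primesum0E /primesum !mulr_sumr -!big_split/=; apply: sumr_ge0 => p _.
have -> : 3 * eterm s p + 4 * (eterm s p * cos (u * ln p%:R)) +
    eterm s p * cos (2 * u * ln p%:R) =
  eterm s p * (3 + 4 * cos (u * ln p%:R) + cos (2 * (u * ln p%:R))).
  by rewrite -mulrA; ring.
by rewrite mulr_ge0 ?eterm_ge0 ?cos_341.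
Qed.
End primesum.

(** * Lower bound for F(u) with u >= 1 *)

Section zeta_lower.
Variable R : realType.
Implicit Types (s u eta : R).
Local Notation cnorm := (@cnorm R).

Lemma ln_le_sub1 (y : R) : 0 < y -> ln y <= y - 1.
Proof. by move=> y0; have := @le_ln1Dx R (y - 1); rewrite subrKC; apply; lra. Qed.

(* The 3-4-1 inequality bounds the logarithm below by those at [0] and [2 * u]. *)
Lemma zsum_lower eta u : 0 < eta -> eta <= 1 -> 1 <= u ->
  exists N0, forall N, (N0 <= N)%N -> 0 < cnorm (zsum eta u N) /\
    - (3 / 4 * ln (2 / eta)) - 1 / 4 * ln (22 + ln (1 + 2 * u)) - 28 <=
      ln (cnorm (zsum eta u N)).
Proof.
move=> e0 e1 u1.
have [k1 hk1] := euler_log u e0; have [k2 hk2] := euler_log (2 * u) e0.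
pose k := maxn k1 k2.
have [N1 hN1] := hk1 k (leq_maxl _ _); have [N2 hN2] := hk2 k (leq_maxr _ _).
exists (maxn N1 N2).+1 => N hN.
have [z1 l1] := hN1 N (leq_trans (leq_trans (leq_maxl _ _) (leqnSn _)) hN).
have [z2 l2] := hN2 N (leq_trans (leq_trans (leq_maxr _ _) (leqnSn _)) hN).
split=> //.
have u2 : 2 * u != 0 by apply/eqP => h; lra.
have := zsum_upper e0 e1 u2 (leq_ltn_trans (leq0n _) hN).
rewrite ger0_norm; last lra.
move=> hz.
have l3 : ln (cnorm (zsum eta (2 * u) N)) <= ln (22 + ln (1 + 2 * u)).
  rewrite ler_ln ?posrE//; last by apply: ltr_wpDr => //; rewrite ln_ge0//; lra.
  apply: le_trans hz _; rewrite lerD2r.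
  have : 2 / (2 * u) <= 1 by rewrite ler_pdivrMr; lra.
  lra.
have l4 := primesum_341 eta u k; have l5 := primesum0_upper k e0 e1.
move: l1 l2; rewrite !ler_norml => /andP[a1 a2] /andP[a3 a4].
lra.
Qed.

(* Chosen so that the Lipschitz error [26 * eta * (21 / q) ^+ 2] of [zsum_lip] at
   [eta = q ^+ 20], [q = zcst / l] is at most a quarter of the lower bound for [zsum]. *)
Definition zcst : R := expR (- 35) / (4 * 26 * 21 ^+ 2).

Lemma zcst_gt0 : 0 < zcst. Proof. by rewrite divr_gt0 ?expR_gt0 ?mulr_gt0 ?exprn_gt0. Qed.

Lemma zcst_le1 : zcst <= 1.
Proof.
rewrite ler_pdivrMr ?mulr_gt0 ?exprn_gt0// mul1r.
apply: (@le_trans _ _ 1).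
  by rewrite expR_le1; lra.
by rewrite !mulr_ege1 ?exprn_ege1// ler1n.
Qed.

(** At [eta = q ^+ 20] the 3-4-1 inequality leaves [D], a constant times q^15 / l, since eta^(3/4) =
    q^15. The Lipschitz error is of order eta q^(-2) = q^18, and q^3 <= q = zcst / l makes it the
    smaller one. Then 82 = 35 + 1 + 14 + 32: from [D], the factor 1/2, [euler_log] and the
    truncation. *)
Lemma primesum_lower s u X l : l = 1 + ln (1 + u) ->
  0 < s -> (0 < X)%N -> 2 <= s * ln X%:R -> 1 <= u -> s <= (zcst / l) ^+ 20 ->
  15 * ln zcst - 82 - 16 * ln l <= primesum s u X.
Proof.
move=> lE s0 X0 hX u1; have l1 : 1 <= l.
  by rewrite lE lerDl ln_ge0//; lra.
have k0 := zcst_gt0; have k1 := zcst_le1.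
have l0 : 0 < l by lra.
set q := zcst / l; have qE : q = zcst / l by []; have q0 : 0 < q by rewrite divr_gt0.
have ql : q <= l^-1 by rewrite ler_piMl// invr_ge0 ltW.
have q1 : q <= 1 by apply: le_trans ql _; rewrite invf_le1.
have lnq : ln q = ln zcst - ln l by rewrite ln_div.
clearbody q; set eta := q ^+ 20 => se; have e0 : 0 < eta by rewrite exprn_gt0.
have e1 : eta <= 1 by apply: exprn_ile1; rewrite // ltW.
have s1 := le_trans se e1.
have u0 : 0 < u by lra.
have ll0 : 0 <= ln l by rewrite ln_ge0.
have [N1 hN1] := zsum_lower e0 e1 u1.
pose D := expR (15 * ln q - ln l - 35).
have hD N : (N1 <= N)%N -> D <= cnorm (zsum eta u N).
  move=> /hN1[h1 h2]; rewrite -[leRHS]lnK ?posrE// ler_expR.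
  apply: le_trans h2.
  have -> : ln (2 / eta) = ln 2 - 20 * ln q.
    by rewrite ln_div ?posrE// lnXn// mulr_natl.
  have : ln (22 + ln (1 + 2 * u)) <= 22 + ln l.
    have : ln (1 + 2 * u) <= l.
      apply: (@le_trans _ _ (ln (2 * (1 + u)))).
        by rewrite ler_ln ?posrE//; lra.
      rewrite lnM ?posrE//; last lra.
      by rewrite lE; have := ln2_le1 R; lra.
    move=> h; apply: (@le_trans _ _ (ln (23 * l))).
      rewrite ler_ln ?posrE ?mulr_gt0//; first lra.
      by apply: ltr_wpDr => //; rewrite ln_ge0//; lra.
    by rewrite lnM ?posrE// lerD2r; apply: le_trans (ln_le_sub1 _) _ => //; lra.
  by have := ln2_le1 R; lra.
have [N2 hN2] := dterm_small s0 (expR_gt0 (15 * ln q - ln l - 35 - 3)).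
have [k2 hk2] := euler_log u s0.
have [N3 hN3] := hk2 (maxn k2 X) (leq_maxl _ _).
pose M := (Num.truncn ((1 + u) / eta)).+1.
pose N := (M + (N1 + (N2 + N3)))%N.
have nN1 : (N1 <= N)%N by rewrite /N addnCA leq_addr.
have nN2 : (N2 <= N)%N by rewrite /N !addnA -(addnA _ N2) addnCA leq_addr.
have nN3 : (N3 <= N)%N by rewrite /N !addnA leq_addl.
have nM : (M <= N)%N by exact: leq_addr.
have [h1 h2] := hN3 N nN3.
have y0 : 0 <= (1 + u) / eta by rewrite divr_ge0//; lra.
have /andP[t1 t2] := truncn_itv y0.
have un : `|u| = u by rewrite gtr0_norm.
have Meta : (1 + `|u|) / eta <= M%:R by rewrite un ltW.
have u1' : 1 <= `|u| by rewrite un.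
have lip := zsum_lip s0 se e1 u1' (ltn0Sn _ : (0 < M)%N) nM Meta.
(* ln M is at most ln 2 + ln (1 + u) + 20 ln (1/q), with ln (1 + u) = l - 1 <= 1/q - 1 and ln (1/q)
   <= 1/q - 1; hence 21 = 1 + 20. *)
have hM : 1 + ln (M%:R : R) <= 21 / q.
  have M2 : M%:R <= 2 * ((1 + u) / eta).
    rewrite /M -(natr1 (Num.truncn _)); have : 1 <= (1 + u) / eta by rewrite ler_pdivlMr//; lra.
    lra.
  have : ln (M%:R : R) <= ln (2 * ((1 + u) / eta)).
    by rewrite ler_ln ?posrE ?ltr0n// mulr_gt0// divr_gt0//; lra.
  rewrite lnM ?posrE ?divr_gt0//; last lra.
  rewrite ln_div ?posrE//; last lra.
  have -> : ln eta = 20 * ln q by rewrite /eta lnXn// mulr_natl.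
  have := ln_le_sub1 (y := q^-1); rewrite invr_gt0 lnV ?posrE// => /(_ q0).
  have : l <= q^-1 by rewrite -[l]invrK lef_pV2 ?posrE ?invr_gt0.
  have := ln2_le1 R; rewrite lE; lra.
have DE : D = q ^+ 15 * expR (-35) / l.
  rewrite /D !expRD (expRN (ln l)) expRM_natl !lnK ?posrE//.
  by rewrite mulrAC.
have hlip : 26 * eta * (1 + ln M%:R) ^+ 2 <= D / 4.
  apply: (@le_trans _ _ (26 * eta * (21 / q) ^+ 2)).
    apply: ler_wpM2l; first by apply: mulr_ge0; rewrite ?(ltW e0).
    apply: lerXn2r => //; rewrite nnegrE; last by rewrite divr_ge0 ?(ltW q0).
    by rewrite addr_ge0// ln_nat_ge0.
  have -> : 26 * eta * (21 / q) ^+ 2 = 26 * 21 ^+ 2 * (q ^+ 15 * q ^+ 3).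
    by rewrite /eta; field; rewrite gt_eqF.
  have q3 : q ^+ 3 <= zcst / l.
    rewrite -qE exprS ler_piMr ?(ltW q0)//; apply: exprn_ile1 => //; exact: ltW.
  have -> : D / 4 = 26 * 21 ^+ 2 * (q ^+ 15 * (zcst / l)).
    rewrite DE /zcst; have : 21 != 0 :> R by [].
    by move: (21 : R) => v v0; field; rewrite gt_eqF.
  by rewrite ler_pM2l ?mulr_gt0 ?exprn_gt0// ler_pM2l// exprn_gt0.
have hd : 2 * dterm s N <= D / 4.
  have := hN2 N nN2; rewrite expRD -/D => h.
  have e3 : expR (- 3 : R) <= 1 / 8.
    have -> : - 3 = - (1 + 1 + 1) :> R by ring.
    rewrite expRN -div1r ler_pdivrMr ?expR_gt0// !expRD.
    have := expR_ge1Dx (1 : R); set e := expR 1 => he.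
    have : 4 <= e * e by nra.
    nra.
  have D0 : 0 < D by exact: expR_gt0.
  have := ler_wpM2l (ltW D0) e3; lra.
have hz : D / 2 <= cnorm (zsum s u N).
  have := cnormD (zsum s u N) (- (zsum s u N - zsum eta u N)).
  have -> : zsum s u N + - (zsum s u N - zsum eta u N) = zsum eta u N by ring.
  by rewrite cnormN; have := hD N nN1; lra.
have lz : ln D - ln 2 <= ln (cnorm (zsum s u N)).
  by rewrite -ln_div ?posrE ?expR_gt0// ler_ln ?posrE// divr_gt0 ?expR_gt0.
have tr := primesum_trunc u s0 s1 X0 hX (leq_maxr k2 X).
move: lz; rewrite /D expRK lnq.
move: h2 tr; rewrite !ler_norml => /andP[a1 a2] /andP[a3 a4].
have := ln2_le1 R; lra.
Qed.
End zeta_lower.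

(** * Comparison with the branching random walk *)

Section comparison.
Context d (T : measurableType d) (R : realType) (P : probability T R).
Variable g : nat -> {RV P >-> R}.
Hypothesis g_normal : forall p : nat, prime p -> standard_normal (g p).
Hypothesis g_indep : mutually_independent [set p : nat | prime p] g.

Lemma tcov_map (f : nat -> R -> R) (ps : seq nat) t u :
  tcov (map f ps) t u = \sum_(p <- ps) f p t * f p u.
Proof. by rewrite /tcov big_map. Qed.

(** The hypotheses on [cov] have the shape of [bcov_diag] and [bcov_sep], so that Slepian's
    inequality applies with the vector [fun=> sd] added to the trees as common shift. *)
Lemma sup_event_tree (x b c V sd H : R) (k n : nat)
    (cov := tcov (map (prime_vec x) (primes_upto x))) :
  1 < b -> 2 * n%:R <= b -> 0 <= c -> 0 <= H -> 0 < sd -> 0 < V ->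
  c + 1 <= k.+1%:R * ln 2 - H ->
  V = sd ^+ 2 + ln 2 / 2 * k.+1%:R ->
  (forall t, 1 <= t <= b -> V <= cov t t) ->
  (forall t u (m : nat), 1 <= t <= b -> 1 <= u <= b -> t != u ->
    1 <= k.+1%:R * `|t - u| * 2 ^+ m -> cov t u <= sd ^+ 2 + ln 2 / 2 * m%:R) ->
  fine (P (sup_event g x b c)) <=
    expR 1 * (expR (- (H ^+ 2 / (2 * sd ^+ 2))) +
              expR (- (n%:R * (tail_const R / Num.sqrt k.+1%:R ^+ 3)))).
Proof.
move=> b1 nb c0 H0 sd0 V0 cK VE Vd Voff.
have K0 : 0 < (k.+1%:R : R) * 2 ^+ k.+1 by rewrite mulr_gt0 ?exprn_gt0.
pose kap := (k.+1%:R * 2 ^+ k.+1 : R)^-1.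
have kap0 : 0 < kap by rewrite invr_gt0.
have kapk : kap * k.+1%:R * 2 ^+ k.+1 = 1 by rewrite -mulrA mulVf// gt_eqF.
pose r := bleaves kap k.+1 n.
have rb t : t \in r -> 1 <= t <= b.
  move=> /(bleaves_itv kap0 kapk)/andP[t1 t2]; rewrite t1/=; exact: le_trans nb.
(* Any [beta >= 0] with [size r <= expR beta] would do, as [tree_bound] is uniform in [beta]. *)
pose beta := (size r)%:R : R.
have beta0 : 0 <= beta by [].
have rs : (size r)%:R <= expR beta by apply: le_trans (expR_ge1Dx _); rewrite lerDr.
(* Scaling [X_t] down to variance [V] preserves the event, as [c >= 0]. *)
pose lam t := if 1 <= t <= b then Num.sqrt (V / cov t t) else 0.
have covp t : 1 <= t <= b -> 0 < cov t t by move=> /Vd; exact: lt_le_trans.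
have lam01 t : 0 <= lam t <= 1.
  rewrite /lam; case: ifP => [tb|_]; last by rewrite lexx ler01.
  rewrite sqrtr_ge0/= -[leRHS]sqrtr1 ler_sqrt// ler_pdivrMr ?covp// mul1r.
  exact: Vd.
have := sup_event_le g_normal g_indep x b1 beta0 c0 cK lam01 rb rs.
move=> h; apply: le_trans h _; rewrite ler_pM2l ?expR_gt0//.
have tb := @tree_bound R kap beta H sd k n kap0 beta0 H0 kapk sd0.
apply: le_trans tb.
have covl t u : \sum_(a <- [seq (fun t => lam t * prime_vec x p t) | p <- primes_upto x]) a t * a u =
    lam t * lam u * cov t u.
  rewrite big_map /cov tcov_map mulr_sumr; apply: eq_bigr => p _; ring.
have diag t : t \in r -> lam t * lam t * cov t t =
    sd * sd + tcov (bnodes kap (step_sd R) k.+1 n) t t.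
  move=> tr; rewrite bcov_diag// step_sd2 -(expr2 sd) -VE /lam rb// -expr2 sqr_sqrtr.
    by rewrite divfK// gt_eqF// covp// rb.
  by rewrite divr_ge0 ?(ltW V0)// ltW// covp// rb.
apply: (@slepian R beta _ r beta0 _ ((fun=> sd) :: bnodes kap (step_sd R) k.+1 n) (fun=> 0)).
- move=> t u tr ur; rewrite covl -/(tcov _ t u) tcov_cons.
  have [->|tu] := eqVneq t u; first by rewrite diag.
  have [m -> hm] := bcov_sep (step_sd R) kap0 kapk tr ur tu.
  have := Voff t u m (rb t tr) (rb u ur) tu hm.
  rewrite step_sd2 -(expr2 sd); set B := cov t u; set A := sd ^+ 2 + _ => BA.
  have A0 : 0 <= A.
    by rewrite addr_ge0 ?sqr_ge0// mulr_ge0// divr_ge0// ln_ge0// ler1n.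
  have /andP[a0 a1] := lam01 t; have /andP[b0 b1'] := lam01 u.
  have ab0 : 0 <= lam t * lam u by exact: mulr_ge0.
  have ab1 : lam t * lam u <= 1 by exact: mulr_ile1.
  (* Scaling by a factor at most 1 lowers a nonnegative covariance and keeps a negative one below 0,
     hence below [A]. *)
  have [B0|/ltW B0] := leP 0 B; last by apply: le_trans A0; exact: mulr_ge0_le0.
  by apply: le_trans BA; rewrite ler_piMl.
- by move=> t tr; rewrite covl -/(tcov _ t t) tcov_cons diag.
Qed.
End comparison.

(** * Covariances of the random prime sum *)

Section prime_cov.
Variable R : realType.
Variable x : R.
Hypothesis x1 : 1 < x.

Local Notation s := (2 / ln x).
Local Notation X := (Num.truncn x).+1.
Local Notation cov := (tcov (map (prime_vec x) (primes_upto x))).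

Let lnx0 : 0 < ln x. Proof. by rewrite ln_gt0. Qed.
Let s0 : 0 < s. Proof. by rewrite divr_gt0. Qed.

Let sX : 2 <= s * ln X%:R.
Proof.
rewrite mulrAC ler_pdivlMr// ler_pM2l// ler_ln ?posrE ?ltr0n//; last exact: lt_trans x1.
by have /andP[_ /ltW] := truncn_itv (ltW (lt_trans ltr01 x1)).
Qed.

Lemma prime_cov t u : cov t u = (primesum s (t - u) X + primesum s (t + u) X) / 2.
Proof.
rewrite tcov_map /primes_upto big_filter /primesum -big_split/= mulr_suml.
apply: eq_bigr => p pp; have p0 : (p%:R : R) != 0 by rewrite pnatr_eq0 -lt0n prime_gt0.
rewrite /prime_vec /powR (negbTE p0) -!expRN.
have -> : eterm s p = expR (- ((1 / 2 + 1 / ln x) * ln p%:R)) * expR (- ((1 / 2 + 1 / ln x) * ln p%:R)).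
  by rewrite -expRD /eterm; congr expR; field; rewrite gt_eqF.
by rewrite (mulrBl _ t u) (mulrDl t u) cosB cosD; field.
Qed.

Variable b : R.
Hypothesis b1 : 1 <= b.
Local Notation L := (1 + ln (1 + 2 * b)).

Let L1 : 1 <= L. Proof. by have := b1 => h; rewrite lerDl ln_ge0//; lra. Qed.

(** F(0) supplies the main term - ln (2 s) and F(2 t) is bounded below by [primesum_lower]; 128 = 46
    + 82. *)
Lemma prime_cov_diag t : s <= (zcst R / L) ^+ 20 -> 1 <= t <= b ->
  (15 * ln (zcst R) - ln (2 * s) - 128 - 16 * ln L) / 2 <= cov t t.
Proof.
move=> sL /andP[t1 tb]; have b1' := b1; rewrite prime_cov subrr.
have k0 := zcst_gt0 R; have k1 := zcst_le1 R; have L0 := lt_le_trans ltr01 L1.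
pose l := 1 + ln (1 + (t + t)).
have l1 : 1 <= l by rewrite lerDl ln_ge0//; lra.
have lL : l <= L by rewrite lerD2l ler_ln ?posrE; lra.
have l0 := lt_le_trans ltr01 l1.
have qq : (zcst R / L) ^+ 20 <= (zcst R / l) ^+ 20.
  apply: lerXn2r; rewrite ?nnegrE ?divr_ge0 ?(ltW k0) ?(ltW L0) ?(ltW l0)//.
  by rewrite ler_pM2l// lef_pV2 ?posrE.
have qL : 0 <= zcst R / L by rewrite divr_ge0// ltW.
have qL1 : zcst R / L <= 1 by rewrite ler_pdivrMr// mul1r (le_trans k1).
have s1 : s <= 1 by apply: le_trans sL (exprn_ile1 _ qL qL1).
have t2 : 1 <= t + t by lra.
have h1 := primesum_lower (erefl l) s0 (ltn0Sn _) sX t2 (le_trans sL qq).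
have h2 := primesum0_lower_trunc s0 s1 (ltn0Sn _) sX.
have : ln l <= ln L by rewrite ler_ln.
lra.
Qed.

(** The distance hypothesis bounds F(t - u) by m ln 2 + ln k.+1 + ln L + 68; F(t + u) is away from
    the pole, as t + u >= 2, and adds only ln L + 68. Here 68 = 22 + 46, where 22 bounds ln (2 +
    21). *)
Lemma prime_cov_off t u (k m : nat) : s <= 1 -> 1 <= t <= b -> 1 <= u <= b -> t != u ->
  1 <= k.+1%:R * `|t - u| * 2 ^+ m ->
  cov t u <= (m%:R * ln 2 + ln k.+1%:R + 2 * ln L + 136) / 2.
Proof.
move=> s1 /andP[t1 tb] /andP[u1 ub] tu hm; have b1' := b1; rewrite prime_cov.
have tu0 : t - u != 0 by rewrite subr_eq0.
have tu0' : t + u != 0 by rewrite gt_eqF//; lra.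
have h1 := primesum_upper s0 s1 (ltn0Sn _) sX tu0.
have h2 := primesum_upper s0 s1 (ltn0Sn _) sX tu0'.
have L0 := lt_le_trans ltr01 L1.
have v0 : 0 < `|t - u| by rewrite normr_gt0.
have vb : `|t - u| <= 2 * b by rewrite ler_norml; apply/andP; split; lra.
have tub : `|t + u| = t + u by rewrite ger0_norm//; lra.
have K0 : 0 < (k.+1%:R : R) by [].
have K1 : 1 <= (k.+1%:R : R) by rewrite ler1n.
have m0 : 0 < (2 : R) ^+ m by rewrite exprn_gt0.
have m1 : 1 <= (2 : R) ^+ m by rewrite exprn_ege1// ler1n.
have Km1 : 1 <= k.+1%:R * (2 : R) ^+ m by rewrite mulr_ege1.
have lv v : 0 <= v -> v <= 2 * b -> 0 <= ln (1 + v) /\ ln (1 + v) <= L - 1.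
  move=> v0' vb'; split; first by rewrite ln_ge0//; lra.
  by rewrite lerBrDl lerD2l ler_ln ?posrE; lra.
have [p0 p1] := lv _ (ltW v0) vb.
have tu1 : 0 <= t + u by lra.
have tu2 : t + u <= 2 * b by lra.
have [q0 q1] := lv _ tu1 tu2.
have ln23 : ln (23 : R) <= 22 by apply: le_trans (ln_le_sub1 _) _; lra.
have e1 : ln (2 / `|t - u| + 21 + ln (1 + `|t - u|)) <=
    m%:R * ln 2 + ln k.+1%:R + ln L + 22.
  apply: (@le_trans _ _ (ln (k.+1%:R * 2 ^+ m * (23 * L)))).
    have i0 : 0 <= 2 / `|t - u| by rewrite divr_ge0.
    rewrite ler_ln ?posrE; [|lra|by rewrite !mulr_gt0].
    have i1 : 2 / `|t - u| <= 2 * (k.+1%:R * 2 ^+ m).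
      rewrite ler_pdivrMr// -mulrA ler_peMr//.
      by rewrite mulrAC.
    have : 21 + (L - 1) <= k.+1%:R * 2 ^+ m * (21 * L).
      by rewrite -[leLHS]mul1r; apply: ler_pM => //; lra.
    have : 2 * (k.+1%:R * 2 ^+ m) <= k.+1%:R * 2 ^+ m * (2 * L).
      by rewrite mulrC ler_pM2l ?mulr_gt0//; lra.
    have -> : k.+1%:R * 2 ^+ m * (23 * L) =
      k.+1%:R * 2 ^+ m * (21 * L) + k.+1%:R * 2 ^+ m * (2 * L) by ring.
    lra.
  rewrite !lnM ?posrE ?mulr_gt0// lnXn// -[ln 2 *+ m]mulr_natl; lra.
have e2 : ln (2 / `|t + u| + 21 + ln (1 + `|t + u|)) <= ln L + 22.
  rewrite tub; apply: (@le_trans _ _ (ln (23 * L))).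
    have i0 : 0 <= 2 / (t + u) by rewrite divr_ge0.
    have i1 : 2 / (t + u) <= 1 by rewrite ler_pdivrMr; lra.
    by rewrite ler_ln ?posrE ?mulr_gt0//; lra.
  by rewrite lnM ?posrE//; lra.
lra.
Qed.
End prime_cov.

(** * Elementary inequalities in the scale q = y^(1/4) *)

Section asymptotics.
Variable R : realType.

Lemma expRN_le (v : R) : 0 < v -> expR (- v) <= v^-1.
Proof.
by move=> v0; rewrite expRN lef_pV2 ?posrE ?expR_gt0//; have := expR_ge1Dx v; lra.
Qed.

Lemma ln2_ge : 1 / 2 <= ln (2 : R).
Proof.
have := ln_le_sub1 (y := 2^-1 : R); rewrite invr_gt0 lnV ?posrE// => /(_ (ltr0Sn R 1)).
lra.
Qed.

Lemma expR_ge_6 (y : R) : 20 <= y -> 6 * y <= expR y.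
Proof.
move=> hy; have -> : y = y / 2 + y / 2 by field.
rewrite expRD; have := expR_ge1Dx (y / 2); set e := expR _ => he; nra.
Qed.

(** With q = y^(1/4) one has H = q^3 and y = q^4, and all comparisons become polynomial. The
    threshold 300 lets q^3 absorb every numerical constant and multiple of q that arises. *)
Lemma pow_facts (q : R) : 300 <= q ->
  [/\ 300 <= q ^+ 3, 300 * q <= q ^+ 3, 300 * q ^+ 3 <= q ^+ 4 & q <= q ^+ 3].
Proof.
move=> hq; have q1 : 1 <= q by lra.
have h2 : 300 * q <= q ^+ 2 by rewrite expr2 ler_pM2r//; lra.
have h3 : q ^+ 2 <= q ^+ 3 by rewrite ler_eXn2l//; lra.
have h4 : 300 * q ^+ 3 <= q ^+ 4 by rewrite [leRHS]exprS ler_pM2r// exprn_gt0//; lra.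
by split; lra.
Qed.

(** The inner expression is at most 7 y, and ln y = 4 ln q <= 4 q: this is the O(log y) error, to be
    absorbed by q^3. *)
Lemma ln_scale_le (q y Y : R) : 300 <= q -> y = q ^+ 4 -> Y = expR y ->
  ln (1 + ln (1 + 2 * (2 * Y ^+ 2))) <= 6 + 4 * q.
Proof.
move=> hq yE YE; have [h1 h2 h3 h4] := pow_facts hq.
have y1 : 1 <= y by rewrite yE; lra.
have Y1 : 1 <= Y by rewrite YE -[leLHS]expR0 ler_expR; lra.
have Y2 : 1 <= Y ^+ 2 by rewrite exprn_ege1.
have Y0 : 0 < Y by lra.
have l1 : ln (1 + 2 * (2 * Y ^+ 2)) <= 4 + 2 * y.
  apply: (@le_trans _ _ (ln (5 * Y ^+ 2))); first by rewrite ler_ln ?posrE; lra.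
  rewrite lnM ?posrE ?exprn_gt0// lnXn// YE expRK -[y *+ 2]mulr_natl.
  by have := ln_le_sub1 (y := 5 : R); lra.
have l0 : 0 <= ln (1 + 2 * (2 * Y ^+ 2)) by rewrite ln_ge0//; lra.
apply: (@le_trans _ _ (ln (7 * y))); first by rewrite ler_ln ?posrE; lra.
have q0 : 0 < q by lra.
rewrite lnM ?posrE//; last lra.
rewrite yE lnXn// -[ln q *+ 4]mulr_natl.
have := ln_le_sub1 q0; have := ln_le_sub1 (y := 7 : R); lra.
Qed.

(** From n >= Y^2 / 2 and sqrt K <= 2 sqrt Y the exponent is at least v sqrt Y / 16 >= v q^2 / 16;
    exp (- a) <= 1 / a then weakens the bound to the power of q asked for. *)
Lemma barrier_term_le (q y Y v : R) (K n : nat) : 1 <= q -> y = q ^+ 4 -> y <= Y -> 2 <= Y ->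
  v = tail_const R -> (0 < K)%N -> K%:R <= 2 * Y -> Y ^+ 2 - 1 <= n%:R ->
  expR (- (n%:R * (v / Num.sqrt K%:R ^+ 3))) <= 16 / v / q ^+ 2.
Proof.
move=> q1 yE yY Y2 vE K0 KY nY.
have v0 : 0 < v by rewrite vE tail_const_gt0.
have Y0 : 0 < Y by lra.
pose w := Num.sqrt Y; have w0 : 0 < w by rewrite sqrtr_gt0.
have wE : w ^+ 2 = Y by rewrite sqr_sqrtr// ltW.
have q0 : 0 < q by lra.
have qw : q ^+ 2 <= w.
  rewrite -(ler_pXn2r (n := 2))// ?nnegrE ?exprn_ge0 ?(ltW q0) ?(ltW w0)//.
  by rewrite wE -exprM -yE.
have K0' : 0 < (K%:R : R) by rewrite ltr0n.
have Kw : Num.sqrt K%:R <= 2 * w.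
  rewrite -(ler_pXn2r (n := 2))// ?nnegrE ?sqrtr_ge0 ?mulr_ge0 ?(ltW w0)//.
  by rewrite sqr_sqrtr ?ler0n// exprMn wE; lra.
have sK : 0 < Num.sqrt (K%:R : R) by rewrite sqrtr_gt0.
have nw : w ^+ 4 / 2 <= n%:R.
  have -> : w ^+ 4 = Y ^+ 2 by rewrite -wE -exprM.
  by apply: le_trans nY; nra.
have key : v * q ^+ 2 / 16 <= n%:R * (v / Num.sqrt K%:R ^+ 3).
  apply: (@le_trans _ _ (w ^+ 4 / 2 * (v / (2 * w) ^+ 3))).
    have -> : w ^+ 4 / 2 * (v / (2 * w) ^+ 3) = v * w / 16 by field; rewrite gt_eqF.
    by rewrite ler_pM2r// ler_pM2l.
  have w20 : 0 < 2 * w by rewrite mulr_gt0.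
  have p1 : 0 < (2 * w) ^+ 3 by rewrite exprn_gt0.
  have p2 : 0 < Num.sqrt (K%:R : R) ^+ 3 by rewrite exprn_gt0.
  apply: ler_pM => //.
  - by rewrite divr_ge0// exprn_ge0// ltW.
  - by rewrite divr_ge0// ltW.
  - rewrite ler_pM2l// lef_pV2 ?posrE//.
    by apply: lerXn2r; rewrite ?nnegrE// ltW.
apply: (@le_trans _ _ (expR (- (v * q ^+ 2 / 16)))); first by rewrite ler_expR lerN2.
apply: le_trans (expRN_le _) _; first by rewrite !mulr_gt0 ?exprn_gt0 ?invr_gt0.
rewrite le_eqVlt; apply/orP; left; apply/eqP; field.
by rewrite !gt_eqF.
Qed.

Lemma root_term_le (q sd2 : R) : 1 <= q -> 0 < sd2 -> 2 * sd2 <= 4 * q ^+ 4 ->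
  expR (- ((q ^+ 3) ^+ 2 / (2 * sd2))) <= 4 / q ^+ 2.
Proof.
move=> q1 s0 sq; have q0 : 0 < q by lra.
have q2 : 0 < q ^+ 2 by rewrite exprn_gt0.
apply: (@le_trans _ _ (expR (- (q ^+ 2 / 4)))).
  rewrite ler_expR lerN2 ler_pdivlMr ?mulr_gt0//.
  apply: (@le_trans _ _ (q ^+ 2 / 4 * (4 * q ^+ 4))).
    by rewrite ler_pM2l// divr_gt0.
  by rewrite le_eqVlt; apply/orP; left; apply/eqP; field.
apply: le_trans (expRN_le _) _; first by rewrite divr_gt0.
by rewrite invf_div.
Qed.
End asymptotics.

(** * Choice of the parameters *)

Section main.
Context d (T : measurableType d) (R : realType) (P : probability T R).
Variable g : nat -> {RV P >-> R}.
Hypothesis g_normal : forall p : nat, prime p -> standard_normal (g p).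
Hypothesis g_indep : mutually_independent [set p : nat | prime p] g.

Lemma sup_event_bound (x Y y q : R) : ln x = expR Y -> Y = expR y -> y = q ^+ 4 ->
  300 - 20 * ln (zcst R) <= q ->
  fine (P (sup_event g x (2 * Y ^+ 2) (Y - y - 5 * q ^+ 3))) <=
    expR 1 * (4 + 16 / tail_const R) / q ^+ 2.
Proof.
move=> xE YE yE qz.
have z0 : ln (zcst R) <= 0 by rewrite ln_le0// zcst_le1.
have hq : 300 <= q by lra.
have [h1 h2 h3 h4] := pow_facts hq; rewrite -yE in h3.
have y20 : 20 <= y by lra.
have q1 : 1 <= q by lra.
have Y6 := expR_ge_6 y20; rewrite -YE in Y6.
have lnx0 : 0 < ln x by rewrite xE expR_gt0.
have x1 : 1 < x.
  by rewrite ltNge; apply/negP => h; have := ln_le0 h; rewrite leNgt lnx0.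
have [Y0 Y2 yY] : [/\ 0 < Y, 2 <= Y & y <= Y] by split; lra.
have l2 := ln2_ge R; have l2' := ln2_le1 R; have l20 : 0 < ln (2 : R) by lra.
have hlnL := ln_scale_le hq yE YE.
(* This depth leaves a common variance [sd2 >= (y + 2 q^3) / 2], enough for the excess (ln K + 2 ln
   L + 136) / 2 of [prime_cov_off], since ln K <= 1 + y and ln L = O(q). *)
set kR := (Y - y - 3 * q ^+ 3) / ln 2.
have kR1 : 1 <= kR by rewrite ler_pdivlMr//; lra.
have /andP[t1 t2] := truncn_itv (le_trans ler01 kR1).
have tr0 : (0 < Num.truncn kR)%N by rewrite truncn_gt0.
pose k := (Num.truncn kR).-1.
have kE : Num.truncn kR = k.+1 by rewrite /k prednK.
rewrite kE in t1 t2.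
have K1 : k.+1%:R * ln 2 <= Y - y - 3 * q ^+ 3.
  by rewrite -ler_pdivlMr.
have K2 : Y - y - 3 * q ^+ 3 < k.+1%:R * ln 2 + ln 2.
  move: t2; rewrite ltr_pdivrMr// -(natr1 k.+1); lra.
have KY : k.+1%:R <= 2 * Y.
  have : k.+1%:R * (1 / 2) <= k.+1%:R * ln (2 : R) by rewrite ler_pM2l.
  lra.
pose n := Num.truncn (Y ^+ 2).
have /andP[n1 n2] := truncn_itv (sqr_ge0 Y); rewrite -/n in n1 n2.
rewrite -(natr1 n) in n2.
(* The q^3 taken off Y pays for the constants, 16 ln L and - 15 ln zcst in [prime_cov_diag]. *)
pose V := (Y - q ^+ 3) / 2.
pose sd2 := V - ln 2 / 2 * k.+1%:R.
have s1 : (y + 2 * q ^+ 3) / 2 <= sd2 by rewrite /sd2 /V; lra.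
have s2 : sd2 <= (y + 2 * q ^+ 3 + 1) / 2 by rewrite /sd2 /V; lra.
have sd20 : 0 < sd2 by lra.
have s4 : 2 * sd2 <= 4 * q ^+ 4 by rewrite -yE; lra.
have sdE : Num.sqrt sd2 ^+ 2 = sd2 by rewrite sqr_sqrtr// ltW.
have V0 : 0 < V by rewrite /V; lra.
have b1 : 1 < 2 * Y ^+ 2 by nra.
have nb : 2 * n%:R <= 2 * Y ^+ 2 by rewrite ler_pM2l.
have c0 : 0 <= Y - y - 5 * q ^+ 3 by lra.
have H0 : 0 <= q ^+ 3 by lra.
(* Origin of 5: the depth loses 3 q^3, the common shift one more, and the last q^3 covers rounding
   by ln 2 and the margin 1. *)
have cK : Y - y - 5 * q ^+ 3 + 1 <= k.+1%:R * ln 2 - q ^+ 3 by lra.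
have VE : V = Num.sqrt sd2 ^+ 2 + ln 2 / 2 * k.+1%:R by rewrite sdE /sd2 subrK.
have sx1 : 2 / ln x <= 1.
  rewrite ler_pdivrMr// mul1r xE; have := expR_ge1Dx Y; lra.
(* In logarithms Y has to dominate ln 2 + 20 ln L - 20 ln zcst; the hypothesis on [q] keeps the last
   term below q. *)
have sxz : 2 / ln x <= (zcst R / (1 + ln (1 + 2 * (2 * Y ^+ 2)))) ^+ 20.
  have L0 : 0 < 1 + ln (1 + 2 * (2 * Y ^+ 2)).
    by apply: ltr_wpDr => //; rewrite ln_ge0//; lra.
  have k0 := zcst_gt0 R.
  rewrite -ler_ln ?posrE ?exprn_gt0 ?divr_gt0// lnXn ?divr_gt0//.
  rewrite (@ln_div _ 2) ?posrE// (@ln_div _ (zcst R)) ?posrE// xE expRK.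
  by rewrite -[_ *+ 20]mulr_natl; lra.
have hd t : 1 <= t <= 2 * Y ^+ 2 ->
    V <= tcov (map (prime_vec x) (primes_upto x)) t t.
  move=> tb; apply: le_trans (prime_cov_diag x1 (ltW b1) sxz tb).
  have -> : ln (2 * (2 / ln x)) = 2 * ln 2 - Y.
    rewrite lnM ?posrE ?divr_gt0// ln_div ?posrE// xE expRK; ring.
  by rewrite /V; lra.
have lK : ln (k.+1%:R : R) <= 1 + y.
  apply: (@le_trans _ _ (ln (2 * Y))).
    by rewrite ler_ln ?posrE ?ltr0n// mulr_gt0.
  by rewrite lnM ?posrE// YE expRK; lra.
have ho t u (m : nat) : 1 <= t <= 2 * Y ^+ 2 -> 1 <= u <= 2 * Y ^+ 2 -> t != u ->
    1 <= k.+1%:R * `|t - u| * 2 ^+ m ->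
    tcov (map (prime_vec x) (primes_upto x)) t u <= Num.sqrt sd2 ^+ 2 + ln 2 / 2 * m%:R.
  move=> tb ub tu hm.
  apply: le_trans (prime_cov_off x1 (ltW b1) sx1 tb ub tu hm) _.
  by rewrite sdE; lra.
have sd0 : 0 < Num.sqrt sd2 by rewrite sqrtr_gt0.
have := sup_event_tree g_normal g_indep b1 nb c0 H0 sd0 V0 cK VE hd ho.
move=> h; apply: le_trans h _; rewrite -mulrA ler_pM2l ?expR_gt0//.
rewrite [leRHS]mulrDl; apply: lerD.
  by rewrite sdE; exact: root_term_le.
by apply: (barrier_term_le (y := y) (Y := Y)) => //; rewrite lerBlDr ltW.
Qed.
End main.

(** * Passage to large x *)

Section near.
Variable R : realType.

(** [expR] inverts [ln] only at positive arguments; beyond exp (exp (exp Q)) every iterated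
    logarithm involved is in that range. *)
Lemma logloglog_large (Q : R) : 0 <= Q -> \forall x \near +oo_R,
  [/\ ln x = expR (loglog x), loglog x = expR (logloglog x) & Q <= logloglog x].
Proof.
move=> Q0; near=> x.
have hx : expR (expR (expR Q)) <= x by near: x; exact: nbhs_pinfty_ge.
have h1 : expR (expR Q) <= ln x.
  by rewrite -[leLHS]expRK ler_ln ?posrE ?expR_gt0// (lt_le_trans _ hx) ?expR_gt0.
have p1 : 0 < ln x by apply: lt_le_trans h1; exact: expR_gt0.
have h2 : expR Q <= loglog x by rewrite -[leLHS]expRK ler_ln ?posrE ?expR_gt0.
have p2 : 0 < loglog x by apply: lt_le_trans h2; exact: expR_gt0.
have h3 : Q <= logloglog x by rewrite -[leLHS]expRK ler_ln ?posrE ?expR_gt0.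
by split=> //; rewrite lnK.
Unshelve. all: by end_near.
Qed.

Lemma root4_powR (y : R) : 0 <= y ->
  [/\ y = (y `^ (1 / 4)) ^+ 4, y `^ (3 / 4) = (y `^ (1 / 4)) ^+ 3 &
      y `^ (- (1 / 2)) = ((y `^ (1 / 4)) ^+ 2)^-1].
Proof.
move=> y0; have e n : (y `^ (1 / 4)) ^+ n = y `^ (1 / 4 * n%:R).
  by rewrite -powR_mulrn ?powR_ge0// -powRrM.
rewrite !e powRN; split.
- by rewrite (_ : 1 / 4 * 4 = 1) ?powRr1//; field.
- by congr (_ `^ _); field.
- by congr ((_ `^ _)^-1); field.
Qed.

Lemma root4_ge (Q y : R) : 0 <= Q -> Q ^+ 4 <= y -> Q <= y `^ (1 / 4).
Proof.
move=> Q0 Qy; have [e _ _] := root4_powR (le_trans (exprn_ge0 4 Q0) Qy).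
by rewrite -(ler_pXn2r (n := 4))// ?nnegrE ?powR_ge0// -e.
Qed.
End near.

Theorem corollary2 (R : realType) (d : measure_display) (T : measurableType d)
    (P : probability T R) (g : nat -> {RV P >-> R})
    (g_normal : forall p : nat, prime p -> standard_normal (g p))
    (g_indep : mutually_independent [set p : nat | prime p] g) :
  exists r : R -> R,
    (r =O_ (+oo_R) (fun x : R => logloglog x `^ (3 / 4))) /\
    ((fun x : R =>
        fine (P [set w : T |
          sup [set random_prime_sum g x t w | t in `[1, 2 * loglog x ^+ 2]]
          <= loglog x - logloglog x + r x]))
      =O_ (+oo_R) (fun x : R => logloglog x `^ (- (1 / 2)))).
Proof.
(* [r] is negative: its size is the room [5 * q ^+ 3] below [Y - y] used in [sup_event_bound]. *)
exists (fun x => - (5 * logloglog x `^ (3 / 4))); split.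
  apply/eqO_exP; exists 5 => //; near=> x.
  by rewrite normrN normrM ger0_norm.
pose Q : R := 300 - 20 * ln (zcst R).
have Q0 : 0 <= Q by have := ln_le0 (zcst_le1 R); rewrite /Q; lra.
pose C := expR 1 * (4 + 16 / tail_const R).
have C0 : 0 < C.
  by rewrite mulr_gt0 ?expR_gt0// addr_gt0// divr_gt0// tail_const_gt0.
apply/eqO_exP; exists C => //; near=> x.
have [xE YE yQ] : [/\ ln x = expR (loglog x), loglog x = expR (logloglog x) &
    Q ^+ 4 <= logloglog x].
  by near: x; apply: logloglog_large; exact: exprn_ge0.
have [yE e3 e2] := root4_powR (le_trans (exprn_ge0 4 Q0) yQ).
rewrite ger0_norm ?fine_ge0// e2 e3 ger0_norm; last by rewrite invr_ge0 exprn_ge0// powR_ge0.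
exact: (sup_event_bound g_normal g_indep xE YE yE (root4_ge Q0 yQ)).
Unshelve. all: by end_near.
Qed.
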